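(* Let $\mathrm{e}\in(0,1)$ be a constant restitution coefficient, let $f_0\ge0$ satisfy $\int_{\mathbb{R}^3}f_0\,dv=1$, $\int_{\mathbb{R}^3}f_0(v)v\,dv=0$, $\int_{\mathbb{R}^3}f_0(v)|v|^2dv<\infty$ and $\int_{\mathbb{R}^3}f_0\log f_0\,dv<\infty$, and let $f(t,v)$ be the unique solution to the inelastic Boltzmann equation $\partial_tf=\mathcal{Q}_e(f,f)$, $f(0,\cdot)=f_0$. Set $\mathcal{E}(t)=\int_{\mathbb{R}^3}f(t,v)|v|^2dv$. Then there are two constants $a,b>0$ such that $$\int_0^t\sqrt{\mathcal{E}(s)}\,ds\ge\frac1b\log(1+ab\,t)\qquad\forall t\ge0.$$ Consequently, $$\sup\Big\{\lambda\ge0:\ \sup_{t\ge0}(1+t)^{2\lambda}\mathcal{E}(t)<\infty\Big\}=\inf\Big\{\lambda>0:\ \limsup_{t\to\infty}(1+t)^{2\lambda}\mathcal{E}(t)>0\Big\}=1.$$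
   Context: Inelastic hard-sphere collisions: for $v,v_\star\in\mathbb{R}^3$ and $n\in\mathbb{S}^2$ put $u=v-v_\star$; with constant restitution coefficient $\mathrm{e}$, the post-collision velocities are $v'=v-\frac{1+\mathrm{e}}{2}(u\cdot n)n$, $v_\star'=v_\star+\frac{1+\mathrm{e}}{2}(u\cdot n)n$. The collision operator $\mathcal{Q}_e$ is defined in weak form, for smooth test functions $\psi$, by $$\int_{\mathbb{R}^3}\mathcal{Q}_e(f,f)\psi\,dv=\frac1{2\pi}\int_{\mathbb{R}^3\times\mathbb{R}^3\times\mathbb{S}^2}|u\cdot n|f(v)f(v_\star)\big(\psi(v')+\psi(v_\star')-\psi(v)-\psi(v_\star)\big)\,dv\,dv_\star\,dn.$$ The Cauchy problem is spatially homogeneous and known to be well-posed for nonnegative $f_0$ of unit mass, zero momentum and finite energy; its solution is nonnegative, conserves mass and momentum, and its energy satisfies $\frac{d}{dt}\mathcal{E}(t)=-\frac{1-\mathrm{e}^2}8\int_{\mathbb{R}^3\times\mathbb{R}^3}f(t,v)f(t,v_\star)|v-v_\star|^3\,dv\,dv_\star$. *)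

(* Defs.v *)
From HB Require Import structures.
From mathcomp Require Import all_boot all_order all_algebra.
From mathcomp Require Import all_classical all_reals all_analysis.

Set Implicit Arguments.
Unset Strict Implicit.
Unset Printing Implicit Defensive.

Import Order.TTheory GRing.Theory Num.Theory.
Import numFieldNormedType.Exports.

Local Open Scope classical_set_scope.
Local Open Scope ring_scope.

(* R^3 is the triple product, so that it is at once a normed space (with the
   max norm, only used for its topology) and a measurable space. The Euclidean
   structure is given by [dot] and [enorm]. *)
Notation vec R := (R * R * R)%type.

(* The product measure [m1 \x m2]; a copy is needed because [m1 \x m2] itself
   is only inferred to be sigma-finite for subprobabilities. *)
Section SigmaFiniteProduct.
Context d1 d2 (T1 : measurableType d1) (T2 : measurableType d2) (R : realType).
Variable m1 : {sigma_finite_measure set T1 -> \bar R}.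
Variable m2 : {sigma_finite_measure set T2 -> \bar R}.

Definition sf_prod : set (T1 * T2) -> \bar R := (m1 \x m2)%E.

HB.instance Definition _ := Measure.on sf_prod.

HB.instance Definition _ := Measure_isSigmaFinite.Build _ _ _ sf_prod
  (lebesgue_integral_fubini.product_measure_sigma_finite_subproof m1 m2).

End SigmaFiniteProduct.

Section Kinetic.
Variable R : realType.
Implicit Types (v w n : vec R) (f g psi : vec R -> R) (e t : R).

Local Notation leb := (@lebesgue_measure R).

Definition leb3 : {sigma_finite_measure set
    (measurableTypeR R * measurableTypeR R * measurableTypeR R)%type -> \bar R} :=
  sf_prod (sf_prod leb leb) leb.

Definition dot v w : R := v.1.1 * w.1.1 + v.1.2 * w.1.2 + v.2 * w.2.

Definition enorm v : R := Num.sqrt (dot v v).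

Definition sph (theta phi : R) : vec R :=
  (sin theta * cos phi, sin theta * sin phi, cos theta).

(* Integral for the surface measure dn = sin(theta) dtheta dphi on S^2,
   of total mass 4 pi. *)
Definition sphere_int (F : vec R -> R) : R :=
  \int[leb]_(theta in `[0, pi]) \int[leb]_(phi in `[0, 2 * pi])
    (F (sph theta phi) * sin theta).

Definition post1 e v w n : vec R :=
  v - ((1 + e) / 2 * dot (v - w) n) *: n.

Definition post2 e v w n : vec R :=
  w + ((1 + e) / 2 * dot (v - w) n) *: n.

Definition collision_weak e f psi : R :=
  (2 * pi)^-1 * \int[(leb3 \x leb3)%E]_p sphere_int (fun n =>
    `|dot (p.1 - p.2) n| * f p.1 * f p.2 *
    (psi (post1 e p.1 p.2 n) + psi (post2 e p.1 p.2 n) - psi p.1 - psi p.2)).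

Definition iter_derive (ws : seq (vec R)) psi : vec R -> R :=
  foldr (fun w g v => 'D_w g v) psi ws.

Definition smooth psi : Prop := forall ws : seq (vec R),
  continuous (iter_derive ws psi) /\
  forall v w, derivable (iter_derive ws psi) v w.

Definition test_function psi : Prop :=
  smooth psi /\ exists r : R, forall v, r < enorm v -> psi v = 0.

(* Solutions of d_t f = Q_e(f, f), f(0, .) = f0, in the class
   C([0, oo); L^1_2) /\ L^1_loc([0, oo); L^1_3) in which the Cauchy problem is
   well-posed (L^1_k: weight 1 + |v|^k). The cubic moment bound is what makes
   the energy dissipation rate locally integrable in time and excludes spurious
   weak solutions. Conservation of mass and momentum and the dissipation of
   energy are consequences and are not assumed. Nothing is required of f at
   negative times. *)
Record boltzmann_solution e f0 (f : R -> vec R -> R) : Prop := {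
  sol_ge0 : forall t v, 0 <= t -> 0 <= f t v ;
  sol_measurable : forall t, 0 <= t -> measurable_fun setT (f t) ;
  sol_L12 : forall t, 0 <= t ->
    (\int[leb3]_v (f t v * (1 + enorm v ^+ 2))%:E < +oo)%E ;
  sol_continuous : forall t, 0 <= t ->
    (fun s => \int[leb3]_v (`|f s v - f t v| * (1 + enorm v ^+ 2))%:E)%E
      @ within `[0, +oo[ (nbhs t) --> 0%E ;
  sol_L13 : forall T, 0 <= T ->
    (\int[leb]_(t in `[0%R, T]) \int[leb3]_v (f t v * enorm v ^+ 3)%:E
       < +oo)%E ;
  sol_init : {ae leb3, forall v, f 0 v = f0 v} ;
  sol_eqn : forall psi, test_function psi -> forall t, 0 < t ->
    is_derive t 1 (fun s => \int[leb3]_v (f s v * psi v))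
      (collision_weak e (f t) psi) }.

Definition energy (f : R -> vec R -> R) t : R :=
  \int[leb3]_v (f t v * enorm v ^+ 2).

End Kinetic.

Arguments leb3 {R}.

(* Main.v *)
(** The upper bound is Haff's: by Jensen the dissipation is at least a multiple
of E^(3/2), so E(t) <= C (1+t)^-2. For the lower bound, put
Y(t) = \int_0^t sqrt(E(s)) ds. Undoing the collision by three one-coordinate
shears shows that the entropy grows at a rate at most C sqrt(E), so the entropy
at time t is at most S0 + C Y(t). Half of the mass lies within distance
sqrt(2E) of the origin, and concentrating it there costs entropy of order
- log E; hence Y' = sqrt(E) >= a exp(-b Y), which integrates to
Y >= log(1 + a b t) / b. A decay of E faster than (1+t)^-2 would make Y bounded.

The logarithm is truncated: eta N y = min(max(ln y, 0), N), with primitive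
beta N, keeps all quantities finite uniformly in time. The weak formulation is
extended from smooth test functions to all nonnegative measurable functions,
in the form moment + loss = moment + gain between [0, oo]-valued functionals,
which are determined by their values on indicators of boxes. *)
Require Import Defs.
From HB Require Import structures.
From mathcomp Require Import all_boot all_order all_algebra.
From mathcomp Require Import all_classical all_reals all_analysis.
From mathcomp Require Import measurable_realfun lra ring.

Set Implicit Arguments.
Unset Strict Implicit.
Unset Printing Implicit Defensive.

Import Order.TTheory GRing.Theory Num.Theory.
Import numFieldNormedType.Exports.

Local Open Scope classical_set_scope.
Local Open Scope ring_scope.


(** * Nonnegative integrands and positive functionals *)

(** The weak equation admits only test functions that do not depend on time, while the entropy calls
    for the logarithm of the solution itself. On a short interval [s, t] the test function is
    therefore [eta N (g t)], frozen at the final time, and convexity of [beta N] turns the increment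
    of its moment into a bound for the increment of the entropy. Freezing replaces [g r] by [g t] in
    the collision terms; the error is a constant depending on N times the weighted L^1 distance of
    [g r] and [g t], arbitrarily small on short intervals because the solution is continuous in
    time. A local-to-global principle for increments replaces differentiation of the entropy in
    time, and N is chosen only at the end, of the order of minus the logarithm of the volume on
    which half of the mass sits. *)

Section NonnegIntegrands.
Context d (T : measurableType d) (R : realType).
Implicit Types (f g h : T -> R).

Definition nnm f := measurable_fun setT f /\ forall x, 0 <= f x.

Lemma nnm_ge0 f x : nnm f -> 0 <= f x. Proof. by case=> _; exact. Qed.

Lemma nnm_meas f : nnm f -> measurable_fun setT f. Proof. by case. Qed.

Lemma nnm_cst (c : R) : 0 <= c -> nnm (fun=> c).
Proof. by move=> c0; split => //; exact: measurable_cst. Qed.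

Lemma nnmD f g : nnm f -> nnm g -> nnm (fun x => f x + g x).
Proof.
by move=> [mf f0] [mg g0]; split=> [|x]; [exact: measurable_funD|exact: addr_ge0].
Qed.

Lemma nnmM f g : nnm f -> nnm g -> nnm (fun x => f x * g x).
Proof.
by move=> [mf f0] [mg g0]; split=> [|x]; [exact: measurable_funM|exact: mulr_ge0].
Qed.

Lemma nnmZ (c : R) f : 0 <= c -> nnm f -> nnm (fun x => c * f x).
Proof. by move=> c0; apply: nnmM; exact: nnm_cst. Qed.

Lemma nnmX f n : nnm f -> nnm (fun x => f x ^+ n).
Proof.
by move=> [mf f0]; split=> [|x]; [exact: measurable_funX|exact: exprn_ge0].
Qed.

Lemma nnm_norm f : measurable_fun setT f -> nnm (fun x => `|f x|).
Proof. by move=> mf; split=> // ; exact: measurableT_comp. Qed.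

Lemma nnm_indic (A : set T) : measurable A -> nnm (\1_A : T -> R).
Proof. by move=> mA; split=> [|x]; [exact: measurable_indic|rewrite indicE]. Qed.

Lemma nnm_sum (I : Type) (s : seq I) (F : I -> T -> R) :
  (forall i, nnm (F i)) -> nnm (fun x => \sum_(i <- s) F i x).
Proof.
move=> mF; elim: s => [|i s IH].
  by under eq_fun do rewrite big_nil; exact: nnm_cst.
by under eq_fun do rewrite big_cons; exact: nnmD.
Qed.

Lemma nnm_min f (c : R) : 0 <= c -> nnm f -> nnm (fun x => Num.min (f x) c).
Proof.
move=> c0 [mf f0]; split; first by apply: measurable_minr => //; exact: measurable_cst.
by move=> x; rewrite le_min f0.
Qed.

Variable mu : {measure set T -> \bar R}.

Lemma nintD f g : nnm f -> nnm g ->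
  (\int[mu]_x (f x + g x)%:E = \int[mu]_x (f x)%:E + \int[mu]_x (g x)%:E)%E.
Proof.
move=> [mf f0] [mg g0]; under eq_integral do rewrite EFinD.
by rewrite ge0_integralD//; try (exact/measurable_EFinP); move=> x _; rewrite lee_fin.
Qed.

Lemma nintZ (c : R) f : 0 <= c -> nnm f ->
  (\int[mu]_x (c * f x)%:E = c%:E * \int[mu]_x (f x)%:E)%E.
Proof.
move=> c0 [mf f0]; under eq_integral do rewrite EFinM.
by rewrite ge0_integralZl//; try (exact/measurable_EFinP); move=> x _; rewrite lee_fin.
Qed.

Lemma nint_ge0 f : (forall x, 0 <= f x) -> (0 <= \int[mu]_x (f x)%:E)%E.
Proof. by move=> f0; apply: integral_ge0 => x _; rewrite lee_fin. Qed.

Lemma nint_le f g : nnm f -> nnm g -> (forall x, f x <= g x) ->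
  (\int[mu]_x (f x)%:E <= \int[mu]_x (g x)%:E)%E.
Proof.
move=> [mf f0] [mg g0] fg; apply: ge0_le_integral => //.
- by move=> x _; rewrite lee_fin.
- exact/measurable_EFinP.
- exact/measurable_EFinP.
- by move=> x _; rewrite lee_fin.
Qed.

Lemma nint_mct (hn : nat -> T -> R) h :
  (forall n, nnm (hn n)) -> (forall x, nondecreasing_seq (hn ^~ x)) ->
  (forall x, hn n x @[n --> \oo] --> h x) ->
  (\int[mu]_x (hn n x)%:E @[n --> \oo] --> \int[mu]_x (h x)%:E)%E.
Proof.
move=> mh nd ch.
have := @cvg_monotone_convergence _ _ _ mu setT measurableT
  (fun n x => (hn n x)%:E) _ _ _.
rewrite (_ : (\int[mu]_x (h x)%:E)%E =
  (\int[mu]_x limn ((fun n x => (hn n x)%:E) ^~ x))%E); last first.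
  apply: eq_integral => x _; apply/esym/cvg_lim => //.
  by apply: cvg_EFin; [exact: nearW|exact: ch].
apply.
- by move=> n; apply/measurable_EFinP; have [] := mh n.
- by move=> n x _; rewrite lee_fin; exact: nnm_ge0.
- by move=> x _ m n mn; rewrite lee_fin; exact: nd.
Qed.

End NonnegIntegrands.

Section PositiveFunctionals.
Context d (T : measurableType d) (R : realType).
Implicit Types (h : T -> R) (L : (T -> R) -> \bar R).

(** An abstract integral on finite nonnegative measurable functions. Moments, collision integrals
    and their integrals over time all have this form without being written against one measure, and
    any two of them can be compared as if they were measures. *)
Record posfun (L : (T -> R) -> \bar R) : Prop := {
  pf_ge0 : forall h, nnm h -> (0 <= L h)%E ;
  pfD : forall h k, nnm h -> nnm k -> L (fun x => h x + k x) = (L h + L k)%E ;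
  pfZ : forall (c : R) h, 0 <= c -> nnm h -> L (fun x => c * h x) = (c%:E * L h)%E ;
  pf_mct : forall (hn : nat -> T -> R) h,
    (forall n, nnm (hn n)) -> (forall x, nondecreasing_seq (hn ^~ x)) ->
    nnm h -> (forall x, hn n x @[n --> \oo] --> h x) ->
    L (hn n) @[n --> \oo] --> L h }.

Lemma pf_le L h k : posfun L -> nnm h -> nnm k -> (forall x, h x <= k x) ->
  (L h <= L k)%E.
Proof.
move=> PL mh mk hk.
have md : nnm (fun x => k x - h x).
  split=> [|x]; last by rewrite subr_ge0.
  by apply: measurable_funB; [exact: nnm_meas|exact: nnm_meas].
have -> : k = fun x => h x + (k x - h x) by apply/funext => x; rewrite addrC subrK.
by rewrite pfD// leeDl// pf_ge0.
Qed.

Lemma pf0 L : posfun L -> L (fun=> 0) = 0%E.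
Proof.
move=> PL; have m0 : nnm ((fun=> 0) : T -> R) by exact: nnm_cst.
have := @pfZ _ PL 0 (fun=> 0) (lexx _) m0.
by under eq_fun do rewrite mul0r; rewrite mul0e.
Qed.

Lemma pf_sum L (I : Type) (s : seq I) (F : I -> T -> R) : posfun L ->
  (forall i, nnm (F i)) ->
  L (fun x => \sum_(i <- s) F i x) = (\sum_(i <- s) L (F i))%E.
Proof.
move=> PL mF; elim: s => [|i s IH].
  by under eq_fun do rewrite big_nil; rewrite big_nil pf0.
under eq_fun do rewrite big_cons.
by rewrite pfD//; [rewrite IH big_cons|exact: nnm_sum].
Qed.

Section PosfunMeasure.
Variables (L : (T -> R) -> \bar R) (PL : posfun L).

(* Measures of Rocq are total on sets, hence the junk value off the
   measurable ones. *)
Definition pf_measure of posfun L := fun A : set T =>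
  if `[< measurable A >] then L \1_A else 0%E.

Lemma pf_measureE A : measurable A -> pf_measure PL A = L \1_A.
Proof. by move=> mA; rewrite /pf_measure; case: asboolP. Qed.

Let pm0 : pf_measure PL set0 = 0%E.
Proof. by rewrite pf_measureE// indic0; exact: pf0. Qed.

Let pm_ge0 A : (0 <= pf_measure PL A)%E.
Proof.
by rewrite /pf_measure; case: asboolP => // mA; apply: pf_ge0 => //; exact: nnm_indic.
Qed.

Let pm_sigma : semi_sigma_additive (pf_measure PL).
Proof.
move=> F mF tF mUF; rewrite pf_measureE//.
rewrite (_ : (fun n => _) = fun n => L (fun x => \sum_(i <- index_iota 0 n) \1_(F i) x)).
  apply: (pf_mct PL).
  - by move=> n; apply: nnm_sum => i; exact: nnm_indic.
  - move=> x; apply/nondecreasing_seqP => n.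
    by rewrite big_nat_recr//= lerDl indicE.
  - exact: nnm_indic.
  (* By disjointness the partial sums of the indicators are eventually constant at each point. *)
  - move=> x; have [[k _ Fkx]|nF] := pselect ((\bigcup_n F n) x).
      apply: cvg_near_cst; exists k.+1 => // n /= kn.
      rewrite (bigD1_seq k)/= ?iota_uniq ?mem_index_iota// big1 ?addr0.
        by rewrite !indicE !mem_set//; exists k.
      move=> i ik; rewrite indicE memNset// => Fix.
      have /trivIsetP/(_ i k I I ik) := tF.
      by move=> /seteqP[/(_ x)/= H _]; apply: H.
    apply: cvg_near_cst; apply: nearW => n; rewrite indicE memNset//.
    by apply: big1 => i _; rewrite indicE memNset// => Fix; apply: nF; exists i.
apply/funext => n; rewrite (pf_sum _ PL); last by move=> i; exact: nnm_indic.
by apply: eq_bigr => i _; rewrite pf_measureE.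
Qed.

HB.instance Definition _ := isMeasure.Build _ _ _ (pf_measure PL) pm0 pm_ge0 pm_sigma.

End PosfunMeasure.

Import HBNNSimple.

(** Simple functions increase to h, and each is a finite nonnegative combination of indicators. *)
Lemma posfun_ext L1 L2 : posfun L1 -> posfun L2 ->
  (forall A, measurable A -> L1 \1_A = L2 \1_A) -> forall h, nnm h -> L1 h = L2 h.
Proof.
move=> P1 P2 L12 h mh.
have mEh : measurable_fun setT (EFin \o h) by apply/measurable_EFinP; exact: nnm_meas.
pose hn := nnsfun_approx measurableT mEh.
have mhn n : nnm (hn n) by split=> // x; exact: fun_ge0.
have ndh x : nondecreasing_seq (fun n => hn n x).
  by move=> a b ab; exact/lefP/nd_nnsfun_approx.
have ch x : hn n x @[n --> \oo] --> h x.
  have Eh0 y : setT y -> (0 <= (EFin \o h) y)%E by rewrite lee_fin nnm_ge0.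
  exact: (fine_cvg (cvg_nnsfun_approx measurableT mEh Eh0 (x := x) I)).
have := pf_mct P1 mhn ndh mh ch; have := pf_mct P2 mhn ndh mh ch.
suff -> : (fun n => L1 (hn n)) = (fun n => L2 (hn n)) by move=> c1 c2; exact: cvg_unique c2 c1.
apply/funext => n.
(* The absolute value makes every summand nonnegative for arbitrary y, as [pf_sum] requires; it
   changes nothing on the range of the approximant, which is nonnegative. *)
have hE : hn n = (fun x => \sum_(y <- finmap.enum_fset (fset_set (range (hn n))))
    `|y| * \1_(hn n @^-1` [set y]) x) :> (T -> R).
  apply/funext => x; rewrite {1}fimfunE fsbig_finite//=.
  apply: eq_big_seq => y; rewrite in_fset_set// inE => -[z _ <-].
  by rewrite ger0_norm// fun_ge0.
have mi y : nnm (fun x => \1_(hn n @^-1` [set y]) x : R).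
  by apply: nnm_indic; exact: measurable_funPTI.
rewrite hE !pf_sum//; try by move=> y; apply: nnmZ.
by apply: eq_bigr => y _; rewrite !pfZ// L12.
Qed.

(** Uniqueness of measures on a generating family stable under intersection. Finiteness on the
    constant 1 gives finiteness on the exhausting sets. *)
Lemma posfun_unique (G : set (set T)) (g : (set T)^nat) L1 L2 :
  measurable = <<s G >> -> setI_closed G -> (forall i, G (g i)) ->
  \bigcup_k (g k) = setT -> posfun L1 -> posfun L2 ->
  (forall A, G A -> L1 \1_A = L2 \1_A) -> (L1 (fun=> 1%R) < +oo)%E ->
  forall h, nnm h -> L1 h = L2 h.
Proof.
move=> mG GI Gg gT P1 P2 L12 L1oo; apply: posfun_ext => // A mA.
have GM B : G B -> measurable B by rewrite mG; exact: sub_sigma_algebra.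
have := @measure_unique _ R T G g mG GI Gg gT (pf_measure P1) (pf_measure P2) _ _ A mA.
rewrite /= !pf_measureE//; apply.
- by move=> B GB; rewrite !pf_measureE ?L12//; exact: GM.
- move=> k; rewrite pf_measureE; last exact: GM.
  apply: le_lt_trans L1oo; apply: pf_le => //.
  by apply: nnm_indic; exact: GM.
Qed.

Lemma posfun_add L1 L2 : posfun L1 -> posfun L2 -> posfun (fun h => (L1 h + L2 h)%E).
Proof.
move=> P1 P2; split.
- by move=> h mh; rewrite adde_ge0// pf_ge0.
- by move=> h k mh mk; rewrite !pfD// addeACA.
- move=> c h c0 mh; rewrite !pfZ// ge0_muleDr//; exact: pf_ge0.
- move=> hn h mhn nd mh ch; apply: cvgeD.
  + by apply: ge0_adde_def; rewrite inE pf_ge0.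
  + exact: (pf_mct P1).
  + exact: (pf_mct P2).
Qed.

End PositiveFunctionals.

(** Integration against the image under X of the measure with density w. The three uses are moments
    (X the identity), loss (X a velocity before the collision) and gain (X a velocity after it). *)
Lemma posfun_int d d' (S : measurableType d) (T : measurableType d') (R : realType)
  (mu : {measure set S -> \bar R}) (w : S -> R) (X : S -> T) :
  nnm w -> measurable_fun setT X ->
  posfun (fun h : T -> R => (\int[mu]_x (w x * h (X x))%:E)%E).
Proof.
move=> mw mX.
have nX h : nnm h -> nnm (fun x => w x * h (X x)).
  move=> [mh h0]; apply: nnmM => //; split=> //; exact: measurableT_comp.
split.
- by move=> h mh; apply: nint_ge0 => x; apply: nnm_ge0 (nX _ _).
- by move=> h k mh mk; under eq_integral do rewrite mulrDr; rewrite nintD//; exact: nX.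
- by move=> c h c0 mh; under eq_integral do rewrite mulrCA; rewrite nintZ//; exact: nX.
- move=> hn h mhn nd mh ch; apply: nint_mct.
  + by move=> n; exact: nX.
  + by move=> x m n mn; rewrite ler_wpM2l ?(nnm_ge0 _ mw)// nd.
  + by move=> x; apply: cvgMr; exact: ch.
Qed.

Lemma posfun_family d d' (S : measurableType d) (T : measurableType d') (R : realType)
  (mu : {measure set S -> \bar R}) (D : set S) (L : S -> (T -> R) -> \bar R) :
  measurable D -> (forall r, posfun (L r)) ->
  (forall h, nnm h -> measurable_fun D (fun r => L r h)) ->
  posfun (fun h => (\int[mu]_(r in D) L r h)%E).
Proof.
move=> mD PL mL; split.
- by move=> h mh; apply: integral_ge0 => r _; exact: pf_ge0.
- move=> h k mh mk; under eq_integral do rewrite pfD//.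
  rewrite ge0_integralD//; try (by move=> r _; exact: pf_ge0); exact: mL.
- move=> c h c0 mh; under eq_integral do rewrite pfZ//.
  rewrite ge0_integralZl//; [exact: mL|by move=> r _; exact: pf_ge0].
- move=> hn h mhn nd mh ch.
  have := @cvg_monotone_convergence _ _ _ mu D mD (fun n r => L r (hn n)) _ _ _.
  rewrite (_ : (\int[mu]_(r in D) L r h)%E =
    (\int[mu]_(r in D) limn ((fun n r => L r (hn n)) ^~ r))%E); last first.
    apply: eq_integral => r _; apply/esym/cvg_lim => //; exact: (pf_mct (PL r)).
  apply.
  + by move=> n; exact: mL.
  + by move=> n r _; exact: pf_ge0.
  + by move=> r _ m n mn; apply: pf_le => // x; exact: nd.
Qed.


Section SigmaFiniteTonelli.
Context d1 d2 (T1 : measurableType d1) (T2 : measurableType d2) (R : realType).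
Variables (m1 : {sigma_finite_measure set T1 -> \bar R})
  (m2 : {sigma_finite_measure set T2 -> \bar R}).

Lemma sf_prod_tonelli1 (f : T1 * T2 -> R) : nnm f ->
  (\int[sf_prod m1 m2]_z (f z)%:E = \int[m1]_x \int[m2]_y (f (x, y))%:E)%E.
Proof.
move=> [mf f0]; rewrite /sf_prod (fubini_tonelli1 (EFin \o f))//.
exact/measurable_EFinP.
Qed.

Lemma sf_prod_tonelli2 (f : T1 * T2 -> R) : nnm f ->
  (\int[sf_prod m1 m2]_z (f z)%:E = \int[m2]_y \int[m1]_x (f (x, y))%:E)%E.
Proof.
move=> [mf f0]; rewrite /sf_prod (fubini_tonelli2 (EFin \o f))//.
exact/measurable_EFinP.
Qed.

Lemma measurable_tonelli1 (f : T1 * T2 -> R) : nnm f ->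
  measurable_fun setT (fun x => \int[m2]_y (f (x, y))%:E)%E.
Proof.
move=> [mf f0]; apply: (measurable_fun_fubini_tonelli_F (EFin \o f)) => //.
exact/measurable_EFinP.
Qed.

Lemma measurable_tonelli2 (f : T1 * T2 -> R) : nnm f ->
  measurable_fun setT (fun y => \int[m1]_x (f (x, y))%:E)%E.
Proof.
move=> [mf f0]; apply: (measurable_fun_fubini_tonelli_G (EFin \o f)) => //.
exact/measurable_EFinP.
Qed.

End SigmaFiniteTonelli.

Lemma nnm_comp d1 d2 (T1 : measurableType d1) (T2 : measurableType d2)
  (R : realType) (f : T2 -> R) (X : T1 -> T2) :
  nnm f -> measurable_fun setT X -> nnm (f \o X).
Proof. by move=> [mf f0] mX; split=> [|x]; [exact: measurableT_comp|exact: f0]. Qed.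

Lemma posfun_mul d d' (S : measurableType d) (T : measurableType d') (R : realType)
  (L : (S -> R) -> \bar R) (w : S -> R) (X : S -> T) :
  posfun L -> nnm w -> measurable_fun setT X ->
  posfun (fun h : T -> R => L (fun x => w x * h (X x))).
Proof.
move=> PL mw mX.
have nX h : nnm h -> nnm (fun x => w x * h (X x)).
  by move=> mh; apply: nnmM => //; exact: (nnm_comp mh).
split.
- by move=> h mh; apply: pf_ge0 => //; exact: nX.
- move=> h k mh mk; rewrite -(pfD PL)//; [|exact: nX|exact: nX].
  by congr L; apply/funext => x; rewrite mulrDr.
- move=> c h c0 mh; rewrite -(pfZ PL)//; last exact: nX.
  by congr L; apply/funext => x; rewrite mulrCA.
- move=> hn h mhn nd mh ch; apply: (pf_mct PL).
  + by move=> n; exact: nX.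
  + by move=> x m n mn; rewrite ler_wpM2l ?(nnm_ge0 _ mw)// nd.
  + exact: nX.
  + by move=> x; apply: cvgMr; exact: ch.
Qed.

(** * Determination of functionals by rays and boxes *)

Section RayUniqueness.
Variable R : realType.

Lemma posfun_unique_rays (L1 L2 : (R -> R) -> \bar R) : posfun L1 -> posfun L2 ->
  (forall a, L1 \1_(`]a, +oo[%classic) = L2 \1_(`]a, +oo[%classic)) ->
  (L1 (fun=> 1%R) < +oo)%E -> forall h, nnm h -> L1 h = L2 h.
Proof.
move=> P1 P2 L12; apply: (@posfun_unique _ R R (RGenOInfty.G (R := R))
  (fun k => `](- k%:R : R), +oo[%classic)) => //.
- exact: RGenOInfty.measurableE.
- move=> _ _ [a ->] [b ->]; exists (Num.max a b); apply/seteqP; split=> x /=;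
    rewrite !in_itv/= !andbT gt_max; first by move=> [-> ->].
  by move=> /andP[].
- by move=> i; eexists.
- apply/seteqP; split=> // x _; exists (Num.bound `|x|) => //=; rewrite in_itv/= andbT ltrNl.
  by apply: le_lt_trans (archi_boundP (normr_ge0 x)); rewrite -normrN ler_norm.
- by move=> A [a ->].
Qed.

Lemma posfun_unique_prod d1 d2 (T1 : measurableType d1) (T2 : measurableType d2)
  (L1 L2 : (T1 * T2 -> R) -> \bar R) : posfun L1 -> posfun L2 ->
  (forall A B, measurable A -> measurable B ->
    L1 (fun x => \1_B x.2 * \1_A x.1) = L2 (fun x => \1_B x.2 * \1_A x.1)) ->
  (L1 (fun=> 1%R) < +oo)%E -> forall h, nnm h -> L1 h = L2 h.
Proof.
move=> P1 P2 L12; apply: (@posfun_unique _ (T1 * T2)%type R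
  [set A `*` B | A in measurable & B in measurable] (fun=> setT)) => //.
- exact: measurable_prod_measurableType.
- move=> _ _ [A mA [B mB <-]] [C mC [D mD <-]].
  exists (A `&` C); first exact: measurableI.
  by exists (B `&` D); [exact: measurableI|rewrite setXI].
- by move=> i; exists setT => //; exists setT => //; rewrite setXTT.
- by rewrite bigcup_const//; exists 0%N.
- move=> _ [A mA [B mB <-]].
  have -> : \1_(A `*` B) = (fun x => \1_B x.2 * \1_A x.1) :> (T1 * T2 -> R).
    by apply/funext => x; rewrite !indicE in_setX -natrM mulnb andbC.
  exact: L12.
Qed.

(** One coordinate at a time is released from rays to Borel sets: the indicators of the other two
    coordinates are absorbed as a weight by [posfun_mul], which leaves a functional on the line.
    Unbounded boxes suffice because rays generate the Borel sets and are stable under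
    intersection. *)
Lemma posfun_unique_boxes (L1 L2 : (vec R -> R) -> \bar R) : posfun L1 -> posfun L2 ->
  (forall a b c,
    let h v := \1_(`]a, +oo[%classic) v.1.1 * (\1_(`]b, +oo[%classic) v.1.2 *
               \1_(`]c, +oo[%classic) v.2) in L1 h = L2 h) ->
  (L1 (fun=> 1%R) < +oo)%E -> forall h, nnm h -> L1 h = L2 h.
Proof.
move=> P1 P2 L12 fin.
pose ray (a : R) := `]a, +oo[%classic.
have n1 (A : set R) (p : vec R -> R) : measurable A -> measurable_fun setT p ->
  nnm (fun v : vec R => \1_A (p v) : R).
  by move=> mA mp; exact: (nnm_comp (nnm_indic R mA) mp).
have m11 : measurable_fun setT (fun v : vec R => v.1.1) by exact: measurableT_comp.
have m12 : measurable_fun setT (fun v : vec R => v.1.2) by exact: measurableT_comp.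
have m2 : measurable_fun setT (fun v : vec R => v.2) by exact: measurable_snd.
have small (w : vec R -> R) : nnm w -> (forall v, w v <= 1) ->
    (L1 (fun v : vec R => w v * 1)%R < +oo)%E.
  move=> mw w1; apply: le_lt_trans fin; apply: pf_le => //.
  - by apply: nnmM => //; exact: nnm_cst.
  - by move=> v; rewrite mulr1.
have le1 (A B : set R) x y : \1_A x * \1_B y <= 1 :> R.
  by rewrite mulr_ile1// indicE; case: (_ \in _).
have step1 A b c : measurable A ->
    L1 (fun v => \1_(ray b) v.1.2 * \1_(ray c) v.2 * \1_A v.1.1)
    = L2 (fun v => \1_(ray b) v.1.2 * \1_(ray c) v.2 * \1_A v.1.1).
  move=> mA.
  have nw : nnm (fun v : vec R => \1_(ray b) v.1.2 * \1_(ray c) v.2 : R).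
    by apply: nnmM; apply: n1 => //; exact: measurable_itv.
  apply: (posfun_unique_rays (posfun_mul P1 nw m11) (posfun_mul P2 nw m11)).
  - move=> a; transitivity (L1 (fun v => \1_(ray a) v.1.1 * (\1_(ray b) v.1.2 * \1_(ray c) v.2)));
      [|rewrite (L12 a b c)]; by congr (_ _); apply/funext => v /=; ring.
  - by apply: small => // v; exact: le1.
  - exact: nnm_indic.
have step2 A B c : measurable A -> measurable B ->
    L1 (fun v => \1_A v.1.1 * \1_(ray c) v.2 * \1_B v.1.2)
    = L2 (fun v => \1_A v.1.1 * \1_(ray c) v.2 * \1_B v.1.2).
  move=> mA mB.
  have nw : nnm (fun v : vec R => \1_A v.1.1 * \1_(ray c) v.2 : R).
    by apply: nnmM; apply: n1 => //; exact: measurable_itv.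
  apply: (posfun_unique_rays (posfun_mul P1 nw m12) (posfun_mul P2 nw m12)).
  - move=> b; transitivity (L1 (fun v => \1_(ray b) v.1.2 * \1_(ray c) v.2 * \1_A v.1.1));
      [|rewrite step1//]; by congr (_ _); apply/funext => v /=; ring.
  - by apply: small => // v; exact: le1.
  - exact: nnm_indic.
have step3 A B C : measurable A -> measurable B -> measurable C ->
    L1 (fun v => \1_A v.1.1 * \1_B v.1.2 * \1_C v.2)
    = L2 (fun v => \1_A v.1.1 * \1_B v.1.2 * \1_C v.2).
  move=> mA mB mC.
  have nw : nnm (fun v : vec R => \1_A v.1.1 * \1_B v.1.2 : R).
    by apply: nnmM; apply: n1.
  apply: (posfun_unique_rays (posfun_mul P1 nw m2) (posfun_mul P2 nw m2)).
  - move=> c; transitivity (L1 (fun v => \1_A v.1.1 * \1_(ray c) v.2 * \1_B v.1.2));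
      [|rewrite step2//]; by congr (_ _); apply/funext => v /=; ring.
  - by apply: small => // v; exact: le1.
  - exact: nnm_indic.
apply: posfun_unique_prod => // D C mD mC.
have nw : nnm (fun v : vec R => \1_C v.2 : R) by exact: n1.
have m1 : measurable_fun setT (fun v : vec R => v.1) by exact: measurable_fst.
apply: (posfun_unique_prod (posfun_mul P1 nw m1) (posfun_mul P2 nw m1)) => [A B mA mB| |].
- transitivity (L1 (fun v => \1_A v.1.1 * \1_B v.1.2 * \1_C v.2));
    [|rewrite step3//]; by congr (_ _); apply/funext => v /=; ring.
- by apply: small => // v; rewrite indicE; case: (_ \in _).
- exact: nnm_indic.
Qed.

End RayUniqueness.

Section AffineChange.
Variable R : realType.
Local Notation leb := (@lebesgue_measure R).

(** The left side defines a measure; on half-open intervals the factor a compensates the scaling of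
    lengths, so it is Lebesgue measure. *)
Lemma nint_affine (a b : R) (h : R -> R) : 0 < a -> nnm h ->
  (a%:E * \int[leb]_x (h (a * x + b))%:E = \int[leb]_x (h x)%:E)%E.
Proof.
move=> a0 mh.
have mX : measurable_fun setT (fun x : R => a * x + b).
  by apply: measurable_funD => //; exact: measurable_funM.
rewrite -nintZ ?(ltW a0)//; last exact: (nnm_comp mh mX).
have P1 := @posfun_int _ _ (measurableTypeR R) (measurableTypeR R) R leb (fun=> a) _ (nnm_cst _ (ltW a0)) mX.
have P2 := @posfun_int _ _ (measurableTypeR R) (measurableTypeR R) R leb (fun=> 1) id (nnm_cst _ ler01)
  (@measurable_id _ _ setT).
transitivity (\int[leb]_x (1 * h x)%:E)%E; last by under eq_integral do rewrite mul1r.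
apply: (posfun_ext P1 P2) => // A mA.
rewrite -[LHS](pf_measureE P1 mA); symmetry.
under eq_integral do rewrite mul1r.
rewrite integral_indic// setIT.
apply: (@lebesgue_measure_unique R (pf_measure P1)) => // X oX.
have mocX : measurable X by apply: sub_sigma_algebra.
rewrite [RHS]pf_measureE// nintZ ?(ltW a0)//; last exact: (nnm_comp (nnm_indic R mocX) mX).
case: oX => -[c e] /= _ <-.
have -> : (fun x => (\1_(`]c, e]%classic) (a * x + b))%:E) =
  EFin \o \1_(`](c - b) / a, (e - b) / a]%classic) :> (R -> \bar R).
  apply/funext => x /=; rewrite !indicE; congr ((nat_of_bool _)%:R%:E).
  apply/idP/idP; rewrite !inE /= !in_itv/= ltr_pdivrMr// ler_pdivlMr// => /andP[h1 h2];
    apply/andP; split; lra.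
rewrite integral_indic// setIT lebesgue_measure_itv/= lte_fin.
rewrite lebesgue_measure_itv/= lte_fin ltr_pM2r ?invr_gt0// ltrD2r; case: ifPn => _; last by rewrite mule0.
by rewrite -!EFinD -EFinM; congr EFin; field; rewrite gt_eqF.
Qed.

End AffineChange.


(** * Shears and the measure on collisions *)

Section Shears.
Variable R : realType.
Local Notation leb := (@lebesgue_measure R).

(** For a fixed second component the map is affine in the first, so Tonelli reduces the claim to
    [nint_affine] with a shift that depends on the parameter. *)
Lemma nint_shear1 d (T : measurableType d) (m : {sigma_finite_measure set T -> \bar R})
  (a : R) (c : T -> R) (F : measurableTypeR R * T -> R) : 0 < a ->
  measurable_fun setT c -> nnm F ->
  (a%:E * \int[sf_prod leb m]_z (F (a * z.1 + c z.2, z.2))%:E =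
   \int[sf_prod leb m]_z (F z)%:E)%E.
Proof.
move=> a0 mc mF.
have mX : measurable_fun setT (fun z : measurableTypeR R * T => (a * z.1 + c z.2, z.2)).
  apply: measurable_fun_pair; last exact: measurable_snd.
  apply: measurable_funD; last exact: (measurableT_comp mc (@measurable_snd _ _ (measurableTypeR R) T)).
  by apply: measurable_funM => //; exact: (@measurable_fst _ _ (measurableTypeR R) T).
have mFX := nnm_comp mF mX.
rewrite (sf_prod_tonelli2 leb m mFX) (sf_prod_tonelli2 leb m mF).
rewrite -ge0_integralZl//; last 3 first.
- exact: (measurable_tonelli2 leb mFX).
- by move=> y _; apply: nint_ge0 => x; exact: (nnm_ge0 _ mFX).
- by rewrite lee_fin ltW.
apply: eq_integral => y _ /=.
have mFy : nnm (fun x : measurableTypeR R => F (x, y)).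
  by apply: (nnm_comp mF); exact: measurable_pair2.
exact: (nint_affine (c y) a0 mFy).
Qed.

Lemma nint_shear2 d (T : measurableType d) (m : {sigma_finite_measure set T -> \bar R})
  (a : R) (c : T -> R) (F : T * measurableTypeR R -> R) : 0 < a ->
  measurable_fun setT c -> nnm F ->
  (a%:E * \int[sf_prod m leb]_z (F (z.1, a * z.2 + c z.1))%:E =
   \int[sf_prod m leb]_z (F z)%:E)%E.
Proof.
move=> a0 mc mF.
have mX : measurable_fun setT (fun z : T * measurableTypeR R => (z.1, a * z.2 + c z.1)).
  apply: measurable_fun_pair; first exact: measurable_fst.
  apply: measurable_funD; last exact: (measurableT_comp mc (@measurable_fst _ _ T (measurableTypeR R))).
  by apply: measurable_funM => //; exact: (@measurable_snd _ _ T (measurableTypeR R)).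
have mFX := nnm_comp mF mX.
rewrite (sf_prod_tonelli1 m leb mFX) (sf_prod_tonelli1 m leb mF).
rewrite -ge0_integralZl//; last 3 first.
- exact: (measurable_tonelli1 leb mFX).
- by move=> y _; apply: nint_ge0 => x; exact: (nnm_ge0 _ mFX).
- by rewrite lee_fin ltW.
apply: eq_integral => y _ /=.
have mFy : nnm (fun x : measurableTypeR R => F (y, x)).
  by apply: (nnm_comp mF); exact: measurable_pair1.
exact: (nint_affine (c y) a0 mFy).
Qed.

Lemma measurable_x : measurable_fun setT (fun v : vec R => v.1.1).
Proof. by apply: measurableT_comp; exact: measurable_fst. Qed.

Lemma measurable_y : measurable_fun setT (fun v : vec R => v.1.2).
Proof. by apply: measurableT_comp; [exact: measurable_snd|exact: measurable_fst]. Qed.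

Lemma measurable_z : measurable_fun setT (fun v : vec R => v.2).
Proof. exact: measurable_snd. Qed.

Lemma measurable_vec d (T : measurableType d) (f1 f2 f3 : T -> R) :
  measurable_fun setT f1 -> measurable_fun setT f2 -> measurable_fun setT f3 ->
  measurable_fun setT (fun x => (f1 x, f2 x, f3 x) : vec R).
Proof. by move=> m1 m2 m3; do 2! apply: measurable_fun_pair => //. Qed.

Lemma measurable_dot d (T : measurableType d) (f g : T -> vec R) :
  measurable_fun setT f -> measurable_fun setT g ->
  measurable_fun setT (fun x => dot (f x) (g x)).
Proof.
move=> mf mg; have [[mx my] mz] := (measurable_x, measurable_y, measurable_z).
have mM (p : vec R -> R) : measurable_fun setT p ->
    measurable_fun setT (fun x => p (f x) * p (g x)).
  by move=> mp; apply: measurable_funM; exact: measurableT_comp.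
exact: (measurable_funD (measurable_funD (mM _ mx) (mM _ my)) (mM _ mz)).
Qed.

Lemma measurable_vecD d (T : measurableType d) (f g : T -> vec R) :
  measurable_fun setT f -> measurable_fun setT g ->
  measurable_fun setT (fun x => f x + g x).
Proof.
move=> mf mg; have [[mx my] mz] := (measurable_x, measurable_y, measurable_z).
have mM (p : vec R -> R) : measurable_fun setT p ->
    measurable_fun setT (fun x => p (f x) + p (g x)).
  by move=> mp; apply: measurable_funD; exact: measurableT_comp.
exact: (measurable_vec (mM _ mx) (mM _ my) (mM _ mz)).
Qed.

Lemma measurable_vecZ d (T : measurableType d) (c : T -> R) (f : T -> vec R) :
  measurable_fun setT c -> measurable_fun setT f ->
  measurable_fun setT (fun x => c x *: f x).
Proof.
move=> mc mf; have [[mx my] mz] := (measurable_x, measurable_y, measurable_z).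
have mM (p : vec R -> R) : measurable_fun setT p ->
    measurable_fun setT (fun x => c x * p (f x)).
  by move=> mp; apply: measurable_funM => //; exact: measurableT_comp.
exact: (measurable_vec (mM _ mx) (mM _ my) (mM _ mz)).
Qed.

Lemma measurable_vecB d (T : measurableType d) (f g : T -> vec R) :
  measurable_fun setT f -> measurable_fun setT g ->
  measurable_fun setT (fun x => f x - g x).
Proof.
move=> mf mg; apply: measurable_vecD => //.
by under eq_fun do rewrite -scaleN1r; apply: measurable_vecZ.
Qed.

Lemma leb3_tonelli (F : vec R -> R) : nnm F ->
  (\int[leb3]_v (F v)%:E = \int[leb]_z \int[sf_prod leb leb]_p (F (p, z))%:E)%E.
Proof. by move=> mF; apply: (sf_prod_tonelli2 (sf_prod leb leb) leb). Qed.

Variables (w n : vec R).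

(* [post] adds to one coordinate at a time the multiple of [dot (v - w) n]
   that the reflection law prescribes. *)
Definition kick1 (k : R) (v : vec R) : vec R :=
  (v.1.1 - k * dot (v - w) n * n.1.1, v.1.2, v.2).
Definition kick2 (k : R) (v : vec R) : vec R :=
  (v.1.1, v.1.2 - k * dot (v - w) n * n.1.2, v.2).
Definition kick3 (k : R) (v : vec R) : vec R :=
  (v.1.1, v.1.2, v.2 - k * dot (v - w) n * n.2).

Let measurable_proj : measurable_fun setT (fun v : vec R => dot (v - w) n).
Proof. by apply: measurable_dot => //; apply: measurable_vecB. Qed.

Lemma measurable_kick1 k : measurable_fun setT (kick1 k).
Proof.
have [[mx my] mz] := (measurable_x, measurable_y, measurable_z).
apply: measurable_vec; [|exact: my|exact: mz].
by apply: measurable_funB; [exact: mx|apply: measurable_funM => //; exact: measurable_funM].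
Qed.

Lemma measurable_kick2 k : measurable_fun setT (kick2 k).
Proof.
have [[mx my] mz] := (measurable_x, measurable_y, measurable_z).
apply: measurable_vec; [exact: mx| |exact: mz].
by apply: measurable_funB; [exact: my|apply: measurable_funM => //; exact: measurable_funM].
Qed.

Lemma measurable_kick3 k : measurable_fun setT (kick3 k).
Proof.
have [[mx my] mz] := (measurable_x, measurable_y, measurable_z).
apply: measurable_vec; [exact: mx|exact: my|].
by apply: measurable_funB; [exact: mz|apply: measurable_funM => //; exact: measurable_funM].
Qed.

(** The moved coordinate enters [dot (v - w) n] with coefficient n1, so the kick is affine in it
    with slope 1 - k n1^2; the rest is the shift c. *)
Lemma nint_kick1 (k : R) (F : vec R -> R) : 0 < 1 - k * n.1.1 ^+ 2 -> nnm F ->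
  ((1 - k * n.1.1 ^+ 2)%:E * \int[leb3]_v (F (kick1 k v))%:E = \int[leb3]_v (F v)%:E)%E.
Proof.
move=> k0 mF.
pose a := 1 - k * n.1.1 ^+ 2.
pose c z y := k * n.1.1 * (w.1.1 * n.1.1 - (y - w.1.2) * n.1.2 - (z - w.2) * n.2).
have cM z : measurable_fun setT (c z).
  apply: measurable_funM => //; apply: measurable_funB => //.
  apply: measurable_funB => //; apply: measurable_funM => //.
  exact: measurable_funB.
have kE v : kick1 k v = (a * v.1.1 + c v.2 v.1.2, v.1.2, v.2).
  by rewrite /kick1 /a /c /dot /=; congr (_, _, _); ring.
have mFK := nnm_comp mF (measurable_kick1 k).
rewrite (leb3_tonelli mFK) (leb3_tonelli mF).
rewrite -ge0_integralZl//; last 3 first.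
- exact: (measurable_tonelli2 (sf_prod leb leb) mFK).
- by move=> y _; apply: nint_ge0 => x; exact: (nnm_ge0 _ mFK).
- by rewrite lee_fin ltW.
apply: eq_integral => z _ /=.
have mFz : nnm (fun p : measurableTypeR R * measurableTypeR R => F (p, z)).
  by apply: (nnm_comp mF); exact: measurable_pair2.
rewrite -(nint_shear1 leb k0 (cM z) mFz); congr (_ * _)%E.
by apply: eq_integral => p _; rewrite /= kE.
Qed.

Lemma nint_kick2 (k : R) (F : vec R -> R) : 0 < 1 - k * n.1.2 ^+ 2 -> nnm F ->
  ((1 - k * n.1.2 ^+ 2)%:E * \int[leb3]_v (F (kick2 k v))%:E = \int[leb3]_v (F v)%:E)%E.
Proof.
move=> k0 mF.
pose a := 1 - k * n.1.2 ^+ 2.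
pose c z x := k * n.1.2 * (w.1.2 * n.1.2 - (x - w.1.1) * n.1.1 - (z - w.2) * n.2).
have cM z : measurable_fun setT (c z).
  apply: measurable_funM => //; apply: measurable_funB => //.
  apply: measurable_funB => //; apply: measurable_funM => //.
  exact: measurable_funB.
have kE v : kick2 k v = (v.1.1, a * v.1.2 + c v.2 v.1.1, v.2).
  by rewrite /kick2 /a /c /dot /=; congr (_, _, _); ring.
have mFK := nnm_comp mF (measurable_kick2 k).
rewrite (leb3_tonelli mFK) (leb3_tonelli mF).
rewrite -ge0_integralZl//; last 3 first.
- exact: (measurable_tonelli2 (sf_prod leb leb) mFK).
- by move=> y _; apply: nint_ge0 => x; exact: (nnm_ge0 _ mFK).
- by rewrite lee_fin ltW.
apply: eq_integral => z _ /=.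
have mFz : nnm (fun p : measurableTypeR R * measurableTypeR R => F (p, z)).
  by apply: (nnm_comp mF); exact: measurable_pair2.
rewrite -(nint_shear2 leb k0 (cM z) mFz); congr (_ * _)%E.
by apply: eq_integral => p _; rewrite /= kE.
Qed.

Lemma nint_kick3 (k : R) (F : vec R -> R) : 0 < 1 - k * n.2 ^+ 2 -> nnm F ->
  ((1 - k * n.2 ^+ 2)%:E * \int[leb3]_v (F (kick3 k v))%:E = \int[leb3]_v (F v)%:E)%E.
Proof.
move=> k0 mF.
pose c (p : measurableTypeR R * measurableTypeR R) :=
  k * n.2 * (w.2 * n.2 - (p.1 - w.1.1) * n.1.1 - (p.2 - w.1.2) * n.1.2).
have cM : measurable_fun setT c.
  apply: measurable_funM => //; apply: measurable_funB => //.
    apply: measurable_funB => //; apply: measurable_funM => //.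
    by apply: measurable_funB => //; exact: (@measurable_fst _ _ (measurableTypeR R) (measurableTypeR R)).
  apply: measurable_funM => //.
  by apply: measurable_funB => //; exact: (@measurable_snd _ _ (measurableTypeR R) (measurableTypeR R)).
rewrite -(nint_shear2 (sf_prod leb leb) k0 cM mF); congr (_ * _)%E.
apply: eq_integral => v _; congr (EFin (F _)).
by rewrite /kick3 /c /dot [in RHS](surjective_pairing v.1) /=; congr (_, _, _); ring.
Qed.

Hypothesis n1 : dot n n = 1.

Let nE : n.1.1 ^+ 2 + n.1.2 ^+ 2 + n.2 ^+ 2 = 1.
Proof. by rewrite -n1 /dot; ring. Qed.

(* LU factorisation of [1 - k n n^T]: the pivots are [1 - k n1^2] and
   [1 - k (n1^2 + n2^2)]. *)
Lemma nint_reflect (k : R) (F : vec R -> R) : 0 < k < 1 -> nnm F ->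
  ((1 - k)%:E * \int[leb3]_v (F (v - (k * dot (v - w) n) *: n))%:E
   = \int[leb3]_v (F v)%:E)%E.
Proof.
move=> /andP[k0 k1] mF.
pose p1 := 1 - k * n.1.1 ^+ 2; pose p2 := 1 - k * (n.1.1 ^+ 2 + n.1.2 ^+ 2).
have [x0 y0 z0] : [/\ 0 <= n.1.1 ^+ 2, 0 <= n.1.2 ^+ 2 & 0 <= n.2 ^+ 2].
  by rewrite !sqr_ge0.
have kp (q : R) : q <= 1 -> 0 < 1 - k * q.
  by move=> q1; have : 0 <= k * (1 - q); [apply: mulr_ge0; lra|lra].
have p10 : 0 < p1 by apply: kp; have := nE; lra.
have p20 : 0 < p2 by apply: kp; have := nE; lra.
have p1n : p1 != 0 by rewrite gt_eqF.
have p2n : p2 != 0 by rewrite gt_eqF.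
have e2 : 1 - k / p1 * n.1.2 ^+ 2 = p2 / p1.
  by rewrite /p2 -[X in X - _](@mulfV _ p1)// -mulrA (mulrC p1^-1) mulrA -mulrBl /p1; congr (_ / _); ring.
have e3 : 1 - k / p2 * n.2 ^+ 2 = (1 - k) / p2.
  rewrite -[X in X - _](@mulfV _ p2)// -mulrA (mulrC p2^-1) mulrA -mulrBl; congr (_ / _).
  by rewrite /p2 -[in RHS](mulr1 k) -nE; ring.
have h2 : 0 < 1 - k / p1 * n.1.2 ^+ 2 by rewrite e2 divr_gt0.
have h3 : 0 < 1 - k / p2 * n.2 ^+ 2 by rewrite e3 divr_gt0// subr_gt0.
have F3 := nnm_comp mF (measurable_kick3 (k / p2)).
have F23 := nnm_comp F3 (measurable_kick2 (k / p1)).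
rewrite -(nint_kick3 h3 mF) -(nint_kick2 h2 F3) -(nint_kick1 p10 F23) !muleA.
rewrite e2 e3 -!EFinM; congr (_ * _)%E; first by congr EFin; rewrite -/p1; field; rewrite p1n p2n.
apply: eq_integral => v _; congr EFin.
pose s := dot (v - w) n.
(* Each kick shrinks the projection on n, from s to p1 s and then to p2 s. Dividing the coefficient
   by the current pivot restores the common displacement k s. *)
have d1 : dot (kick1 k v - w) n = p1 * s by rewrite /kick1 /s /p1 /dot /=; ring.
have ks1 : k / p1 * (p1 * s) = k * s by field.
have ks2 : k / p2 * (p2 * s) = k * s by field.
have K2 : kick2 (k / p1) (kick1 k v) =
    (v.1.1 - k * s * n.1.1, v.1.2 - k * s * n.1.2, v.2).
  by rewrite {1}/kick2 d1 ks1.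
have d2 : dot (kick2 (k / p1) (kick1 k v) - w) n = p2 * s.
  by rewrite K2 /s /p2 /dot /=; ring.
have -> : ((F \o kick3 (k / p2)) \o kick2 (k / p1)) (kick1 k v) =
  F (kick3 (k / p2) (kick2 (k / p1) (kick1 k v))) by [].
by rewrite /kick3 d2 ks2 K2; congr F; case: (v) => -[].
Qed.

End Shears.


(** * Euclidean geometry and the space of collisions *)

Notation mvec R := (measurableTypeR R * measurableTypeR R * measurableTypeR R)%type.
Notation collisions R :=
  (mvec R * mvec R * (measurableTypeR R * measurableTypeR R))%type.

Section EuclideanSpace.
Variable R : realType.
Implicit Types (v w n : vec R).

Lemma dotC v w : dot v w = dot w v.
Proof. by rewrite /dot mulrC [X in _ + X + _]mulrC [X in _ + X]mulrC. Qed.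

Lemma dotDl u v w : dot (u + v) w = dot u w + dot v w.
Proof. by rewrite /dot /=; ring. Qed.

Lemma dotNl v w : dot (- v) w = - dot v w.
Proof. by rewrite /dot /=; ring. Qed.

Lemma dotBl u v w : dot (u - v) w = dot u w - dot v w.
Proof. by rewrite dotDl dotNl. Qed.

Lemma dotZl (a : R) v w : dot (a *: v) w = a * dot v w.
Proof. by rewrite /dot /= /GRing.scale /=; ring. Qed.

Lemma dot_ge0 v : 0 <= dot v v.
Proof. by rewrite /dot -!expr2 !addr_ge0// sqr_ge0. Qed.

Lemma enorm_ge0 v : 0 <= enorm v. Proof. exact: sqrtr_ge0. Qed.

Lemma enorm_sqr v : enorm v ^+ 2 = dot v v.
Proof. by rewrite sqr_sqrtr// dot_ge0. Qed.

Lemma dot_unit_le v n : dot n n = 1 -> `|dot v n| <= enorm v.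
Proof.
move=> n1; rewrite -(@ler_pXn2r _ 2)// ?nnegrE ?enorm_ge0// enorm_sqr real_normK ?num_real//.
rewrite -[leRHS]mulr1 -n1 -subr_ge0.
have -> : dot v v * dot n n - dot v n ^+ 2 =
  (v.1.1 * n.1.2 - v.1.2 * n.1.1) ^+ 2 + (v.1.1 * n.2 - v.2 * n.1.1) ^+ 2
  + (v.1.2 * n.2 - v.2 * n.1.2) ^+ 2 by rewrite /dot; ring.
by rewrite !addr_ge0// sqr_ge0.
Qed.

Lemma dot_sph (q : R * R) : dot (sph q.1 q.2) (sph q.1 q.2) = 1.
Proof.
have -> : dot (sph q.1 q.2) (sph q.1 q.2) =
    cos q.1 ^+ 2 + sin q.1 ^+ 2 * (cos q.2 ^+ 2 + sin q.2 ^+ 2).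
  by rewrite /dot /sph /=; ring.
by rewrite cos2Dsin2 mulr1 cos2Dsin2.
Qed.

Lemma measurable_enorm : measurable_fun setT (@enorm R).
Proof.
have ms : measurable_fun setT (@Num.sqrt R).
  by apply: continuous_measurable_fun; exact: sqrt_continuous.
exact: (measurableT_comp ms (measurable_dot (@measurable_id _ _ setT) (@measurable_id _ _ setT))).
Qed.

Lemma nnm_enorm : nnm (@enorm R).
Proof. by split; [exact: measurable_enorm|exact: enorm_ge0]. Qed.

Definition weight2 v : R := 1 + enorm v ^+ 2.

Lemma nnm_weight2 : nnm weight2.
Proof. by apply: nnmD; [exact: nnm_cst|apply: nnmX; exact: nnm_enorm]. Qed.

Lemma weight2_ge1 v : 1 <= weight2 v.
Proof. by rewrite lerDl exprn_ge0// enorm_ge0. Qed.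

(** The product form of the bound lets [mX_prod] split a collision integral into a product of second
    moments. *)
Lemma enormD_le_weight2 v w : enorm v + enorm w <= weight2 v * weight2 w.
Proof.
rewrite /weight2; have := enorm_ge0 v; have := enorm_ge0 w; set x := enorm v; set y := enorm w => y0 x0.
have := sqr_ge0 (x - 1); have := sqr_ge0 (y - 1); have := sqr_ge0 (x * y).
rewrite !expr2; nra.
Qed.

End EuclideanSpace.

Section CollisionMeasure.
Variable R : realType.
Local Notation leb := (@lebesgue_measure R).
Implicit Types (a b : vec R -> R).

Definition mX : {sigma_finite_measure set (collisions R) -> \bar R} :=
  sf_prod (sf_prod leb3 leb3) (sf_prod leb leb).

Definition angles : set (R * R) := `[0, pi] `*` `[0, 2 * pi].

(* [|sin theta|], not [sin theta], keeps the weight nonnegative everywhere. *)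
Definition wsph (q : R * R) : R := (2 * pi)^-1 * (`|sin q.1| * \1_angles q).

Definition ndir (z : collisions R) : vec R := sph z.2.1 z.2.2.

(** The kernel |u.n| dn / (2 pi) in spherical angles; the normalisation and the surface density are
    in [wsph]. *)
Definition ker (z : collisions R) : R := wsph z.2 * `|dot (z.1.1 - z.1.2) (ndir z)|.

Lemma measurable_angles : measurable angles.
Proof. by apply: measurableX; exact: measurable_itv. Qed.

Lemma measurable_sin : measurable_fun setT (@sin R).
Proof. by apply: continuous_measurable_fun; exact: continuous_sin. Qed.

Lemma measurable_cos : measurable_fun setT (@cos R).
Proof. by apply: continuous_measurable_fun; exact: continuous_cos. Qed.

Lemma measurable_sph : measurable_fun setT (fun q : R * R => sph q.1 q.2).
Proof.
have s1 := measurableT_comp measurable_sin (@measurable_fst _ _ R R).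
have s2 := measurableT_comp measurable_sin (@measurable_snd _ _ R R).
have c1 := measurableT_comp measurable_cos (@measurable_fst _ _ R R).
have c2 := measurableT_comp measurable_cos (@measurable_snd _ _ R R).
by apply: measurable_vec => //; exact: measurable_funM.
Qed.

Lemma nnm_wsph : nnm wsph.
Proof.
apply: nnmZ; first by rewrite invr_ge0 mulr_ge0// pi_ge0.
apply: nnmM; last exact: nnm_indic measurable_angles.
by apply: nnm_norm; exact: (measurableT_comp measurable_sin (@measurable_fst _ _ R R)).
Qed.

Lemma measurable_zv : measurable_fun setT (fun z : collisions R => z.1.1 : mvec R).
Proof. exact: measurableT_comp. Qed.

Lemma measurable_zw : measurable_fun setT (fun z : collisions R => z.1.2 : mvec R).
Proof. exact: measurableT_comp. Qed.

Lemma measurable_zq : measurable_fun setT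
  (fun z : collisions R => z.2 : measurableTypeR R * measurableTypeR R).
Proof. exact: measurable_snd. Qed.

Lemma measurable_ndir : measurable_fun setT (ndir : collisions R -> mvec R).
Proof. exact: (measurableT_comp measurable_sph measurable_zq). Qed.

Lemma nnm_ker : nnm ker.
Proof.
apply: nnmM; first exact: (nnm_comp nnm_wsph measurable_zq).
apply: nnm_norm; apply: measurable_dot; last exact: measurable_ndir.
by apply: measurable_vecB; [exact: measurable_zv|exact: measurable_zw].
Qed.

Lemma ker_le z : ker z <= wsph z.2 * (enorm z.1.1 + enorm z.1.2).
Proof.
apply: ler_wpM2l; first exact: nnm_ge0 nnm_wsph.
rewrite dotBl (le_trans (ler_normB _ _))// lerD// dot_unit_le//; exact: dot_sph.
Qed.

Lemma measurable_post1 (e : R) : measurable_fun setT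
  (fun z : collisions R => post1 e z.1.1 z.1.2 (ndir z) : mvec R).
Proof.
apply: measurable_vecB; first exact: measurable_zv.
apply: measurable_vecZ; last exact: measurable_ndir.
apply: measurable_funM => //; apply: measurable_dot; last exact: measurable_ndir.
by apply: measurable_vecB; [exact: measurable_zv|exact: measurable_zw].
Qed.

Lemma measurable_post2 (e : R) : measurable_fun setT
  (fun z : collisions R => post2 e z.1.1 z.1.2 (ndir z) : mvec R).
Proof.
apply: measurable_vecD; first exact: measurable_zw.
apply: measurable_vecZ; last exact: measurable_ndir.
apply: measurable_funM => //; apply: measurable_dot; last exact: measurable_ndir.
by apply: measurable_vecB; [exact: measurable_zv|exact: measurable_zw].
Qed.

(** The two densities are kept apart because the estimates are bilinear: differences of solutions
    and solutions at two different times occur in the two slots. *)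
Definition coll a b (F : collisions R -> R) : \bar R :=
  (\int[mX]_z (ker z * (a z.1.1 * b z.1.2) * F z)%:E)%E.

Lemma nnm_coll a b F : nnm a -> nnm b -> nnm F ->
  nnm (fun z : collisions R => ker z * (a z.1.1 * b z.1.2) * F z).
Proof.
move=> ma mb mF; apply: nnmM => //; apply: nnmM; first exact: nnm_ker.
by apply: nnmM; [exact: (nnm_comp ma measurable_zv)|exact: (nnm_comp mb measurable_zw)].
Qed.

Lemma mX_sphere (G : collisions R -> R) : nnm G ->
  (\int[mX]_z (G z)%:E = \int[sf_prod leb3 leb3]_p \int[sf_prod leb leb]_q (G (p, q))%:E)%E.
Proof. by move=> mG; exact: (sf_prod_tonelli1 (sf_prod leb3 leb3) (sf_prod leb leb)). Qed.

Lemma mX_velocities (G : collisions R -> R) : nnm G ->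
  (\int[mX]_z (G z)%:E = \int[sf_prod leb leb]_q \int[leb3]_w \int[leb3]_v (G ((v, w), q))%:E)%E.
Proof.
move=> mG; rewrite (sf_prod_tonelli2 (sf_prod leb3 leb3) (sf_prod leb leb))//.
apply: eq_integral => q _.
have mGq : nnm (fun p : mvec R * mvec R => G (p, q)).
  by apply: (nnm_comp mG); exact: measurable_pair2.
by rewrite (sf_prod_tonelli2 leb3 leb3 mGq).
Qed.

Lemma mX_swap (G : collisions R -> R) : nnm G ->
  (\int[mX]_z (G z)%:E = \int[mX]_z (G ((z.1.2, z.1.1), z.2))%:E)%E.
Proof.
move=> mG.
have mS : measurable_fun setT (fun z : collisions R => ((z.1.2, z.1.1), z.2) : collisions R).
  apply: measurable_fun_pair; last exact: measurable_zq.
  by apply: measurable_fun_pair; [exact: measurable_zw|exact: measurable_zv].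
rewrite (mX_velocities mG).
rewrite (sf_prod_tonelli2 (sf_prod leb3 leb3) (sf_prod leb leb) (nnm_comp mG mS)).
apply: eq_integral => q _.
have mGq : nnm (fun p : mvec R * mvec R => G ((p.2, p.1), q)).
  have mp : measurable_fun setT (fun p : mvec R * mvec R => ((p, q) : collisions R)).
    exact: measurable_pair2.
  exact: (nnm_comp (nnm_comp mG mS) mp).
by rewrite (sf_prod_tonelli1 leb3 leb3 mGq).
Qed.

Lemma mX_prod (w : R * R -> R) a b : nnm w -> nnm a -> nnm b ->
  (\int[mX]_z (w z.2 * (a z.1.1 * b z.1.2))%:E =
   (\int[sf_prod leb leb]_q (w q)%:E) * (\int[leb3]_v (a v)%:E * \int[leb3]_v (b v)%:E))%E.
Proof.
move=> mw ma mb.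
have mG : nnm (fun z : collisions R => w z.2 * (a z.1.1 * b z.1.2)).
  apply: nnmM; first exact: (nnm_comp mw measurable_zq).
  by apply: nnmM; [exact: (nnm_comp ma measurable_zv)|exact: (nnm_comp mb measurable_zw)].
rewrite mX_velocities//.
have ia0 : (0 <= \int[leb3]_v (a v)%:E)%E by apply: nint_ge0 => x; exact: nnm_ge0.
have ib0 : (0 <= \int[leb3]_v (b v)%:E)%E by apply: nint_ge0 => x; exact: nnm_ge0.
transitivity (\int[sf_prod leb leb]_q
   ((w q)%:E * (\int[leb3]_v (a v)%:E * \int[leb3]_v (b v)%:E)))%E.
  apply: eq_integral => q _ /=.
  transitivity (\int[leb3]_y (((w q)%:E * \int[leb3]_v (a v)%:E) * (b y)%:E))%E.
    apply: eq_integral => v _.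
    rewrite -muleA [X in (_ * X)%E]muleC.
    rewrite -(nintZ leb3 (nnm_ge0 v mb) ma) -(nintZ leb3 (nnm_ge0 q mw)); last first.
      exact: nnmZ (nnm_ge0 v mb) ma.
    by apply: eq_integral => x _; rewrite (mulrC (a x)).
  rewrite ge0_integralZl//; first by rewrite muleA.
  - by apply/measurable_EFinP; case: mb.
  - by move=> x _; rewrite lee_fin nnm_ge0.
  - by rewrite mule_ge0// lee_fin nnm_ge0.
rewrite ge0_integralZr//.
- by apply/measurable_EFinP; case: mw.
- by move=> x _; rewrite lee_fin nnm_ge0.
- exact: mule_ge0.
Qed.

End CollisionMeasure.


(** * Test functions *)

Section SmoothFunctions.
Variable R : realType.
Implicit Types (x h : R) (n : nat) (psi : vec R -> R).

(** The classical function exp(-1/x), flat at 0, times a power of 1/x; the powers make the family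
    closed under differentiation. *)
Definition flat n x : R := if 0 < x then x^-1 ^+ n * expR (- x^-1) else 0.

Lemma flat_ge0 n x : 0 <= flat n x.
Proof.
rewrite /flat; case: ifPn => // x0.
by rewrite mulr_ge0 ?expR_ge0// exprn_ge0// invr_ge0 ltW.
Qed.

(** From exp(y) >= y^(n+2) / (n+2)! at y = 1/x. The quadratic bound is what makes the derivative at
    the origin vanish. *)
Lemma flat_le_sqr n x : flat n x <= (n.+2)`!%:R * x ^+ 2.
Proof.
rewrite /flat; case: ifPn => x0; last by rewrite mulr_ge0// sqr_ge0.
have y0 : 0 < x^-1 by rewrite invr_gt0.
have f0 : 0 < (n.+2)`!%:R :> R by rewrite ltr0n fact_gt0.
have /(le_trans _) : x^-1 ^+ n.+2 <= (n.+2)`!%:R * expR x^-1.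
  rewrite -ler_pdivrMl// mulrC; apply: le_trans (expR_ge1Dxn n.+1 (ltW y0)).
  by rewrite lerDr.
move=> /(_ _ (lexx _)) H; rewrite expRN ler_pdivrMr ?expR_gt0//.
have -> : x^-1 ^+ n = x ^+ 2 * x^-1 ^+ n.+2.
  by rewrite expr2 !exprS; field; rewrite gt_eqF.
have -> : (n.+2)`!%:R * x ^+ 2 * expR x^-1 = x ^+ 2 * ((n.+2)`!%:R * expR x^-1) by ring.
exact: ler_wpM2l (sqr_ge0 x) _ _ H.
Qed.

Lemma is_derive_flat n x :
  is_derive x 1 (flat n) (- n%:R * flat n.+1 x + flat n.+2 x).
Proof.
have [x0|x0|->] := ltgtP x 0.
- have -> : - n%:R * flat n.+1 x + flat n.+2 x = 0.
    by rewrite /flat ltNge (ltW x0)/= mulr0 addr0.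
  apply: (@near_eq_is_derive _ _ _ (cst 0)).
  by near=> y; rewrite /flat ifF//; apply/negbTE; rewrite -leNgt ltW//; near: y; exact: lt_nbhsl.
- have xn : x != 0 by rewrite gt_eqF.
  have dV : is_derive x 1 (fun y : R => y^-1) (- x ^- 2).
    by have := @is_deriveV _ id x 1 1 xn (is_derive_id x 1); rewrite scaler1.
  have dE : is_derive x 1 (expR \o (fun y : R => - y^-1)) (expR (- x^-1) * x ^- 2).
    by apply: is_derive1_comp; rewrite -[x ^- 2]opprK; exact: is_deriveN.
  have dM := is_deriveM (is_deriveX n dV) dE.
  have E : \near x, ((GRing.inv : R -> R) ^+ n * (expR \o (fun y : R => - y^-1))) x = flat n x.
    by near=> y; rewrite !fctE /flat ifT//; near: y; exact: lt_nbhsr.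
  apply: (is_derive_eq (near_eq_is_derive E dM)).
  rewrite /flat x0 /GRing.scale /=.
  case: n {dM E} => [|n].
    by rewrite mulr0n !(mul0r,mulr0,expr0,mul1r,oppr0,add0r,addr0) mulrC exprVn.
  have -> : ((GRing.inv : R -> R) ^+ n.+1) x = x^-1 ^+ n.+1 by rewrite !fctE.
  by rewrite !exprS !exprVn /=; field; rewrite xn expf_neq0.
- have -> : - n%:R * flat n.+1 0 + flat n.+2 0 = 0 by rewrite /flat ltxx mulr0 addr0.
  suff H : (fun h => h^-1 *: (flat n (h *: 1 + 0) - flat n 0)) @ 0^' --> (0 : R).
    by apply: DeriveDef; [apply/cvg_ex; exists 0|apply/cvg_lim].
  apply/cvgr0Pnorm_le => e e0; near=> h.
  rewrite /flat ltxx subr0 -/(flat n _) addr0 scaler1.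
  have hn : h != 0 by near: h; exact: nbhs_dnbhs_neq.
  rewrite normrZ normfV ler_pdivrMl ?normr_gt0// ger0_norm ?flat_ge0//.
  apply: le_trans (flat_le_sqr _ _) _.
  rewrite -[h ^+ 2]real_normK ?num_real// expr2 mulrCA ler_wpM2l//.
  rewrite -ler_pdivlMl ?ltr0n ?fact_gt0//.
  near: h; apply: dnbhs0_le.
  by rewrite mulr_gt0// invr_gt0 ltr0n fact_gt0.
Unshelve. all: by end_near. Qed.

Lemma flat_continuous n : continuous (flat n).
Proof.
move=> x; apply/differentiable_continuous/derivable1_diffP.
by have [] := is_derive_flat n x.
Qed.

Lemma flat0_homo : {homo flat 0 : x y / x <= y}.
Proof.
move=> x y xy; rewrite /flat; case: ifPn => x0; last by case: ifPn => // _; rewrite mulr_ge0// expR_ge0.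
have y0 := lt_le_trans x0 xy.
by rewrite y0 !expr0 !mul1r ler_expR lerN2 lef_pV2.
Qed.

Lemma flat0_le1 x : flat 0 x <= 1.
Proof.
rewrite /flat; case: ifPn => // x0; rewrite expr0 mul1r -expR0 ler_expR.
by rewrite oppr_le0 invr_ge0 ltW.
Qed.

Lemma flat0_cvg (u : nat -> R) : u n @[n --> \oo] --> +oo ->
  flat 0 (u n) @[n --> \oo] --> (1 : R).
Proof.
move=> uoo; have upos : \forall n \near \oo, 0 < u n by move/cvgryPgt : uoo; exact.
have : expR (- (u n)^-1) @[n --> \oo] --> expR (- 0).
  apply: continuous_cvg; first exact: continuous_expR.
  by apply: cvgN; apply/gtr0_cvgV0.
rewrite oppr0 expR0; apply: cvg_trans; apply: near_eq_cvg; near=> n.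
by rewrite /flat ifT ?mul1r//; near: n.
Unshelve. all: by end_near. Qed.

(** A class of continuous functions closed under directional derivatives: all iterated derivatives
    then stay in it, and smoothness follows by induction on the list of directions. *)
Inductive elementary : (vec R -> R) -> Prop :=
| el_cst c : elementary (fun=> c)
| el_flat n (u : vec R) b : elementary (fun v => flat n (dot v u + b))
| el_add f g : elementary f -> elementary g -> elementary (fun v => f v + g v)
| el_mul f g : elementary f -> elementary g -> elementary (fun v => f v * g v).

Lemma continuous_dot (u : vec R) : continuous (fun v => dot v u).
Proof.
have c1 : continuous (fun v : vec R => v.1.1).
  by move=> v; apply: (@continuous_comp _ _ _ fst fst); exact: cvg_fst.
have c2 : continuous (fun v : vec R => v.1.2).
  by move=> v; apply: (@continuous_comp _ _ _ fst snd); [exact: cvg_fst|exact: cvg_snd].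
have c3 : continuous (fun v : vec R => v.2) by move=> v; exact: cvg_snd.
by move=> v; apply: cvgD; [apply: cvgD|]; apply: cvgMl; [exact: c1|exact: c2|exact: c3].
Qed.

Lemma elementary_continuous psi : elementary psi -> continuous psi.
Proof.
elim=> [c|n u b|f g _ cf _ cg|f g _ cf _ cg] v.
- exact: cvg_cst.
- apply: (@continuous_comp _ _ _ (fun v => dot v u + b) (flat n)).
    by apply: cvgD; [exact: continuous_dot|exact: cvg_cst].
  exact: flat_continuous.
- by apply: cvgD; [exact: cf|exact: cg].
- by apply: cvgM; [exact: cf|exact: cg].
Qed.

Lemma elementary_derive psi (w : vec R) : elementary psi ->
  exists2 psi', elementary psi' & forall v, is_derive v w psi (psi' v).
Proof.
elim=> [c|n u b|f g ef [f' ef' df] eg [g' eg' dg]|f g ef [f' ef' df] eg [g' eg' dg]].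
- by exists (fun=> 0); [exact: el_cst|move=> v; exact: is_derive_cst].
- exists (fun v => dot w u * (- n%:R * flat n.+1 (dot v u + b) + flat n.+2 (dot v u + b))).
    apply: el_mul; first exact: el_cst.
    apply: el_add; last exact: el_flat.
    by apply: el_mul; [exact: el_cst|exact: el_flat].
  move=> v; set s := dot v u + b; set a := dot w u.
  have dl : is_derive (0 : R) 1 (fun h : R => a * h + s) a.
    have := is_deriveD (is_deriveZ a (is_derive_id (0 : R) 1)) (is_derive_cst s (0 : R) 1).
    by move=> /is_derive_eq; apply; rewrite addr0 [_ *: 1]mulr1.
  have := @is_derive1_comp _ (flat n) (fun h : R => a * h + s) 0 _ _ (is_derive_flat n _) dl.
  rewrite mulr0 add0r => -[dc vc].
  (* The difference quotient in direction w is that of a one-variable function restricted to the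
     line v + h w, on which the argument of [flat] is affine with slope [dot w u]. *)
  have E : (fun h : R => h^-1 *: ((flat n \o (fun h => a * h + s)) (h *: 1 + 0)
      - (flat n \o (fun h => a * h + s)) 0)) =
    (fun h : R => h^-1 *: (flat n (dot (h *: w + v) u + b) - flat n (dot v u + b))).
    apply/funext => h; congr (_ *: (flat n _ - flat n _)); last by rewrite mulr0 add0r.
    by rewrite dotDl dotZl addr0 scaler1 -addrA -/s -/a mulrC.
  apply: DeriveDef; first by rewrite /derivable -E.
  by rewrite /derive -E mulrC.
- exists (fun v => f' v + g' v); first exact: el_add.
  by move=> v; exact: is_deriveD.
- exists (fun v => f v * g' v + g v * f' v).
    by apply: el_add; apply: el_mul.
  by move=> v; exact: is_deriveM.
Qed.

Lemma elementary_smooth psi : elementary psi -> smooth psi.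
Proof.
move=> epsi ws.
suff [f ef ->] : exists2 f, elementary f & iter_derive ws psi = f.
  split; first exact: elementary_continuous.
  by move=> v w; have [f' _ /(_ v)[]] := elementary_derive w ef.
elim: ws => [|w ws [f ef IH]]; first by exists psi.
have [f' ef' df] := elementary_derive w ef.
exists f' => //; rewrite /= IH; apply/funext => v.
by have [_ ->] := df v.
Qed.

(** The first factor rises from 0 at a, ever more steeply with n; the second cuts off at n. The
    bumps thus have bounded support and increase to the indicator of the ray, as monotone
    convergence requires. *)
Definition bump1 (n : nat) (a x : R) : R :=
  flat 0 (n%:R * (x - a)) * flat 0 (n%:R * (n%:R - x)).

Definition bump (n : nat) (a b c : R) (v : vec R) : R :=
  bump1 n a v.1.1 * (bump1 n b v.1.2 * bump1 n c v.2).

Lemma bump1_ge0 n a x : 0 <= bump1 n a x.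
Proof. by rewrite mulr_ge0// flat_ge0. Qed.

Lemma bump1_le1 n a x : bump1 n a x <= 1.
Proof. by apply: mulr_ile1; rewrite ?flat_ge0 ?flat0_le1. Qed.

Lemma bump_ge0 n a b c v : 0 <= bump n a b c v.
Proof. by do ! apply: mulr_ge0; exact: flat_ge0. Qed.

Lemma bump_le1 n a b c v : bump n a b c v <= 1.
Proof.
have b0 d x := bump1_ge0 n d x; have b1 d x := bump1_le1 n d x.
by apply: mulr_ile1 => //; [exact: mulr_ge0|exact: mulr_ile1].
Qed.

Lemma elementary_bump n a b c : elementary (bump n a b c).
Proof.
have e1 (u : vec R) d k : elementary (fun v => flat 0 (k * (dot v u - d))).
  have -> : (fun v => flat 0 (k * (dot v u - d))) = (fun v => flat 0 (dot v (k *: u) + - (k * d))).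
    by apply/funext => v; rewrite (dotC v (k *: u)) dotZl (dotC u) mulrBr.
  exact: el_flat.
have e2 (u : vec R) d k : elementary (fun v => flat 0 (k * (d - dot v u))).
  have -> : (fun v => flat 0 (k * (d - dot v u))) = (fun v => flat 0 (- k * (dot v u - d))).
    by apply/funext => v; rewrite mulNr -mulrN opprB.
  exact: e1.
have H (u : vec R) d : elementary (fun v => bump1 n d (dot v u)).
  by apply: el_mul; [exact: e1|exact: e2].
have := el_mul (H (1, 0, 0) a) (el_mul (H (0, 1, 0) b) (H (0, 0, 1) c)).
congr elementary; apply/funext => v; rewrite /bump /dot /=.
by rewrite !mulr1 !mulr0 !addr0 !add0r.
Qed.

Lemma bump_test_function n a b c : test_function (bump n a b c).
Proof.
split; first exact/elementary_smooth/elementary_bump.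
pose M := `|a| + `|b| + `|c| + n%:R.
(* Where the bump does not vanish, each coordinate lies between its threshold a, b or c and n, so
   its absolute value is at most M. *)
exists (Num.sqrt (3 * M ^+ 2)) => v.
apply: contraPP => /eqP; rewrite !mulf_eq0 !negb_or => /andP[/andP[a1 a2] /andP[/andP[b1 b2] /andP[c1 c2]]].
apply/negP; rewrite -leNgt; apply: ler_wsqrtr.
have pos x : flat 0 (n%:R * x) != 0 -> 0 < x.
  rewrite /flat; case: ifPn; last by rewrite eqxx.
  by case: (n) => [|m]; [rewrite mul0r ltxx|rewrite pmulr_rgt0// ltr0n].
have bd d x : `|d| <= M - n%:R -> flat 0 (n%:R * (x - d)) != 0 ->
    flat 0 (n%:R * (n%:R - x)) != 0 -> x * x <= M ^+ 2.
  move=> dM /pos + /pos; rewrite !subr_gt0 => xd xn.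
  have : 0 <= M - n%:R by exact: le_trans dM.
  have := ler_norm (- d); rewrite normrN => nd M0; have n0 := ler0n R n.
  rewrite -subr_ge0 (_ : _ - _ = (M - x) * (M + x)); last by ring.
  by apply: mulr_ge0; lra.
have Mn : M - n%:R = `|a| + `|b| + `|c| by rewrite /M addrK.
rewrite Mn in bd; have := normr_ge0 a; have := normr_ge0 b; have := normr_ge0 c => h1 h2 h3.
have := bd a v.1.1 _ a1 a2; have := bd b v.1.2 _ b1 b2; have := bd c v.2 _ c1 c2.
rewrite /dot => /(_ ltac:(lra)) + /(_ ltac:(lra)) + /(_ ltac:(lra)); lra.
Qed.

(** For a < x < m both arguments of [flat 0] grow from m to n; elsewhere the smaller bump
    vanishes. *)
Lemma bump1_nd a x : nondecreasing_seq (fun n => bump1 n a x).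
Proof.
move=> m n mn; have mnR : m%:R <= n%:R :> R by rewrite ler_nat.
have m0 : 0 <= m%:R :> R by [].
rewrite /bump1; have [xa|xa] := leP x a.
  rewrite [leLHS](_ : _ = 0) ?mulr_ge0 ?flat_ge0//.
  by rewrite /flat ifF ?mul0r//; apply/negbTE; rewrite -leNgt mulr_ge0_le0// subr_le0.
have [mx|mx] := leP m%:R x.
  rewrite [leLHS](_ : _ = 0) ?mulr_ge0 ?flat_ge0//.
  by rewrite mulrC /flat ifF ?mul0r//; apply/negbTE; rewrite -leNgt mulr_ge0_le0// subr_le0.
by apply: ler_pM; rewrite ?flat_ge0//; apply: flat0_homo; nra.
Qed.

Lemma bump1_cvg a x : bump1 n a x @[n --> \oo] --> (\1_(`]a, +oo[%classic) x : R).
Proof.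
rewrite indicE; have [xa|xa] := leP x a.
  rewrite memNset/= ?in_itv/= ?andbT; last by apply/negP; rewrite -leNgt.
  apply: cvg_near_cst; apply: nearW => n.
  by rewrite /bump1 /flat ifF ?mul0r//; apply/negbTE; rewrite -leNgt mulr_ge0_le0// subr_le0.
rewrite mem_set/= ?in_itv/= ?andbT// -[X in _ --> X]mulr1.
apply: cvgM; apply: flat0_cvg.
  have xa0 : 0 < x - a by rewrite subr_gt0.
  apply/cvgryPge => A; near=> n; rewrite -ler_pdivrMr//.
  by near: n; exact: nbhs_infty_ger.
apply/cvgryPge => A; near=> n.
have n1 : 1 <= n%:R :> R by near: n; exact: nbhs_infty_ger.
have nA : x + `|A| <= n%:R by near: n; exact: nbhs_infty_ger.
apply: le_trans (ler_norm A) _; apply: le_trans (_ : 1 * (n%:R - x) <= _); first lra.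
by rewrite ler_wpM2r//; have := normr_ge0 A; lra.
Unshelve. all: by end_near. Qed.

Lemma bump_nd a b c v : nondecreasing_seq (fun n => bump n a b c v).
Proof.
move=> m n mn; have nd d x : bump1 m d x <= bump1 n d x by exact: bump1_nd.
have b0 d x := bump1_ge0 m d x.
by apply: ler_pM => //; [exact: mulr_ge0|exact: ler_pM].
Qed.

Lemma bump_cvg a b c v : bump n a b c v @[n --> \oo] -->
  (\1_(`]a, +oo[%classic) v.1.1 * (\1_(`]b, +oo[%classic) v.1.2 *
   \1_(`]c, +oo[%classic) v.2) : R).
Proof. by do ! apply: cvgM; exact: bump1_cvg. Qed.

Lemma measurable_flat n : measurable_fun setT (flat n).
Proof. by apply: continuous_measurable_fun; exact: flat_continuous. Qed.

Lemma nnm_bump n a b c : nnm (bump n a b c).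
Proof.
split; last by move=> v; exact: bump_ge0.
have mb d : measurable_fun setT (bump1 n d).
  apply: measurable_funM; apply: (measurableT_comp (measurable_flat 0));
    by apply: measurable_funM => //; exact: measurable_funB.
have [[mx my] mz] := (@measurable_x R, @measurable_y R, @measurable_z R).
apply: measurable_funM; first exact: (measurableT_comp (mb a) mx).
by apply: measurable_funM; [exact: (measurableT_comp (mb b) my)|exact: (measurableT_comp (mb c) mz)].
Qed.

End SmoothFunctions.


(** * The collision form, split into gain and loss *)

Section Integrability.
Context d (T : measurableType d) (R : realType) (mu : {measure set T -> \bar R}).

Lemma nnm_integrable (f : T -> R) : nnm f -> (\int[mu]_x (f x)%:E < +oo)%E ->
  mu.-integrable setT (EFin \o f).
Proof.
move=> [mf f0] fi; apply/integrableP; split; first exact/measurable_EFinP.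
by under eq_integral do rewrite /= ger0_norm//.
Qed.

Lemma le_nnm_integrable (f g : T -> R) : measurable_fun setT f -> nnm g ->
  (forall x, `|f x| <= g x) -> (\int[mu]_x (g x)%:E < +oo)%E ->
  mu.-integrable setT (EFin \o f).
Proof.
move=> mf mg fg gi; apply: (le_integrable measurableT _ _ (nnm_integrable mg gi)).
  exact/measurable_EFinP.
by move=> x _ /=; rewrite lee_fin (le_trans (fg x))// ler_norm.
Qed.

End Integrability.

(** The real integral is the finite part of the extended one, so the inner integrals can be replaced
    pointwise only if every section is integrable, not just almost every one. *)
Lemma Rintegral_fubini d1 d2 (T1 : measurableType d1) (T2 : measurableType d2)
  (R : realType) (m1 : {sigma_finite_measure set T1 -> \bar R})
  (m2 : {sigma_finite_measure set T2 -> \bar R}) (F : T1 * T2 -> R) :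
  (sf_prod m1 m2).-integrable setT (EFin \o F) ->
  (forall x, m2.-integrable setT (fun y => (F (x, y))%:E)) ->
  \int[m1]_x \int[m2]_y F (x, y) = \int[sf_prod m1 m2]_z F z.
Proof.
move=> iF iFx; rewrite /Rintegral -(integral12_prod_meas1 iF); congr fine.
by apply: eq_integral => x _; rewrite fineK//; apply: integrable_fin_num.
Qed.

Section CollisionForm.
Variable R : realType.
Local Notation leb := (@lebesgue_measure R).
Implicit Types (a b : vec R -> R) (F : collisions R -> R).

Definition mom2 a : \bar R := (\int[leb3]_v (a v * weight2 v)%:E)%E.

(** The total mass 4 pi / (2 pi) = 2 of the angular weight. Its finiteness suffices for the bounds
    of this section; the value is computed in [csphE]. *)
Definition csph : \bar R := (\int[sf_prod leb leb]_q (wsph q)%:E)%E.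

Let pi2_gt0 : 0 < 2 * pi :> R. Proof. by rewrite mulr_gt0// pi_gt0. Qed.

Lemma wsph_le q : wsph q <= (2 * pi)^-1 * (\1_(`[0, pi]%classic) q.1 * \1_(`[0, (2 * pi)]%classic) q.2 : R).
Proof.
apply: ler_wpM2l; first by rewrite invr_ge0 ltW.
rewrite -[leRHS]mul1r (_ : \1_(@angles R) q = \1_(`[0, pi]%classic) q.1 * \1_(`[0, (2 * pi)]%classic) q.2 :> R).
  apply: ler_wpM2r; first by rewrite !indicE mulr_ge0.
  by rewrite ler_norml sin_geN1 sin_le1.
by rewrite !indicE in_setX -natrM mulnb.
Qed.

Lemma indic_itv_lty (a b : R) : (\int[leb]_x (\1_(`[a, b]%classic) x)%:E < +oo)%E.
Proof.
by rewrite integral_indic// setIT /= lebesgue_measure_itv/=; case: ifP => _; rewrite ltry.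
Qed.

Lemma csph_fin : csph \is a fin_num.
Proof.
rewrite ge0_fin_numE; last by apply: nint_ge0 => q; exact: nnm_ge0 (nnm_wsph R).
have mi (b : R) : nnm (\1_(`[0, b]%classic) : measurableTypeR R -> R).
  by apply: nnm_indic; exact: measurable_itv.
have mG : nnm (fun q : measurableTypeR R * measurableTypeR R =>
    \1_(`[0, pi]%classic) q.1 * \1_(`[0, (2 * pi)]%classic) q.2 : R).
  by apply: nnmM; [exact: (nnm_comp (mi pi) measurable_fst)|exact: (nnm_comp (mi (2 * pi)) measurable_snd)].
have c0 : 0 <= (2 * pi)^-1 :> R by rewrite invr_ge0 ltW.
apply: le_lt_trans (nint_le (sf_prod leb leb) (nnm_wsph R) (nnmZ c0 mG) wsph_le) _.
rewrite nintZ// (sf_prod_tonelli1 leb leb mG) lte_mul_pinfty//.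
under eq_integral => x _ do rewrite /= (nintZ leb (nnm_ge0 x (mi pi)) (mi (2 * pi))).
rewrite ge0_integralZr//.
- by rewrite lte_mul_pinfty ?indic_itv_lty ?nint_ge0// fin_numElt (lt_le_trans _ (nint_ge0 _ _)) ?indic_itv_lty.
- by apply/measurable_EFinP; case: (mi pi).
- by apply: nint_ge0.
Qed.

Lemma mom2_ge0 a : nnm a -> (0 <= mom2 a)%E.
Proof. by move=> ma; apply: nint_ge0 => v; exact: nnm_ge0 (nnmM ma (nnm_weight2 R)). Qed.

Lemma le_coll a b F F' : nnm a -> nnm b -> nnm F -> nnm F' ->
  (forall z, F z <= F' z) -> (coll a b F <= coll a b F')%E.
Proof.
move=> ma mb mF mF' FF'; apply: nint_le; [exact: nnm_coll|exact: nnm_coll|move=> z].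
apply: ler_wpM2l => //; apply: mulr_ge0; first exact: nnm_ge0 (nnm_ker R).
by apply: mulr_ge0; exact: nnm_ge0.
Qed.

Lemma coll_le_mom2 a b F (M : R) : nnm a -> nnm b -> nnm F -> (forall z, F z <= M) ->
  (coll a b F <= M%:E * (csph * (mom2 a * mom2 b)))%E.
Proof.
move=> ma mb mF FM.
have M0 : 0 <= M by apply: le_trans (FM (0, 0)); exact: nnm_ge0.
have maw := nnmM ma (nnm_weight2 R); have mbw := nnmM mb (nnm_weight2 R).
rewrite -(mX_prod (nnm_wsph R) maw mbw) -nintZ//; last first.
  apply: nnmM; first exact: (nnm_comp (nnm_wsph R) (@measurable_zq R)).
  by apply: nnmM; [exact: (nnm_comp maw (@measurable_zv R))|exact: (nnm_comp mbw (@measurable_zw R))].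
apply: nint_le.
- exact: nnm_coll.
- apply: nnmZ => //; apply: nnmM; first exact: (nnm_comp (nnm_wsph R) (@measurable_zq R)).
  by apply: nnmM; [exact: (nnm_comp maw (@measurable_zv R))|exact: (nnm_comp mbw (@measurable_zw R))].
move=> z; have a0 := nnm_ge0 z.1.1 ma; have b0 := nnm_ge0 z.1.2 mb.
have w0 := nnm_ge0 z.2 (nnm_wsph R); have k0 := nnm_ge0 z (nnm_ker R).
rewrite mulrC; apply: ler_pM => //; [exact: nnm_ge0|by apply: mulr_ge0 => //; exact: mulr_ge0|].
have -> : wsph z.2 * (a z.1.1 * weight2 z.1.1 * (b z.1.2 * weight2 z.1.2)) =
  wsph z.2 * (weight2 z.1.1 * weight2 z.1.2) * (a z.1.1 * b z.1.2) by ring.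
apply: ler_wpM2r; first exact: mulr_ge0.
by apply: le_trans (ker_le z) _; apply: ler_wpM2l => //; exact: enormD_le_weight2.
Qed.

Lemma coll_fin a b F (M : R) : nnm a -> nnm b -> nnm F -> (forall z, F z <= M) ->
  (mom2 a < +oo)%E -> (mom2 b < +oo)%E -> coll a b F \is a fin_num.
Proof.
move=> ma mb mF FM ai bi; rewrite ge0_fin_numE; last first.
  by apply: nint_ge0 => z; exact: nnm_ge0 (nnm_coll ma mb mF).
apply: le_lt_trans (coll_le_mom2 ma mb mF FM) _.
have fa : mom2 a \is a fin_num by rewrite ge0_fin_numE// mom2_ge0.
have fb : mom2 b \is a fin_num by rewrite ge0_fin_numE// mom2_ge0.
by rewrite ltey_eq !fin_numM// csph_fin.
Qed.

Lemma nnm_dist a b : nnm a -> nnm b -> nnm (fun v => `|a v - b v|).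
Proof. by move=> [ma _] [mb _]; apply: nnm_norm; exact: measurable_funB. Qed.

(** From the pointwise splitting a(v) a(w) - b(v) b(w) = (a - b)(v) a(w) + b(v) (a - b)(w), with
    absolute values and sums only, so that no infinite terms are subtracted. *)
Lemma coll_dist a b F (M : R) : nnm a -> nnm b -> nnm F -> (forall z, F z <= M) ->
  (coll a a F <= coll b b F + M%:E * (csph *
     (mom2 (fun v => `|a v - b v|)%R * (mom2 a + mom2 b))))%E.
Proof.
move=> ma mb mF FM; have md := nnm_dist ma mb.
apply: (@le_trans _ _ (coll b b F + (coll (fun v => `|a v - b v|)%R a F +
   coll b (fun v => `|a v - b v|)%R F)))%E.
  have m1 := nnm_coll mb mb mF; have m2 := nnm_coll md ma mF; have m3 := nnm_coll mb md mF.
  rewrite /coll -(nintD _ m2 m3) -(nintD _ m1 (nnmD m2 m3)).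
  apply: nint_le; [exact: nnm_coll|exact: nnmD m1 (nnmD m2 m3)|].
  move=> z; set k := ker z; set x := a z.1.1; set y := a z.1.2; set x' := b z.1.1; set y' := b z.1.2.
  have y0 : 0 <= y by exact: nnm_ge0.
  have x'0 : 0 <= x' by exact: nnm_ge0.
  rewrite -!mulrDl -!mulrDr; apply: ler_wpM2r; first exact: nnm_ge0.
  apply: ler_wpM2l; first exact: nnm_ge0 (nnm_ker R).
  have -> : x * y = x' * y' + ((x - x') * y + x' * (y - y')) by ring.
  rewrite lerD2l lerD//; first by rewrite ler_wpM2r// ler_norm.
  by rewrite ler_wpM2l// ler_norm.
apply: leeD => //; rewrite ge0_muleDr ?mom2_ge0//.
have M0 : 0 <= M by apply: le_trans (FM (0, 0)); exact: nnm_ge0.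
have c0 : (0 <= csph)%E by apply: nint_ge0 => q; exact: nnm_ge0 (nnm_wsph R).
rewrite ge0_muleDr ?mule_ge0 ?mom2_ge0// ge0_muleDr ?mule_ge0 ?mom2_ge0//.
apply: leeD; first exact: coll_le_mom2.
by rewrite [X in (csph * X)%E]muleC; exact: coll_le_mom2.
Qed.

Lemma sf_prod_bounded_integrable (F : measurableTypeR R * measurableTypeR R -> R) (M : R) : measurable_fun setT F ->
  (forall q, `|F q| <= M * wsph q) -> (sf_prod leb leb).-integrable setT (EFin \o F).
Proof.
move=> mF FM; apply: (@le_nnm_integrable _ _ _ (sf_prod leb leb) F (fun q => `|M| * wsph q) mF).
- by apply: nnmZ => //; exact: nnm_wsph.
- move=> q; apply: le_trans (FM q) _; apply: ler_wpM2r; first exact: nnm_ge0 (nnm_wsph R).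
  exact: ler_norm.
- rewrite nintZ//; last exact: nnm_wsph.
  by rewrite ltey_eq fin_numM// csph_fin.
Qed.

(** A bounded psi and a finite second moment make the integrand absolutely integrable, so the nested
    integrals over velocities and angles become one integral over collisions, which then splits into
    two finite nonnegative ones. *)
Lemma collision_weakE (e : R) a (psi : vec R -> R) (M : R) : nnm a -> (mom2 a < +oo)%E -> nnm psi ->
  (forall v, psi v <= M) ->
  collision_weak e a psi =
    fine (coll a a (fun z => psi (post1 e z.1.1 z.1.2 (ndir z)) + psi (post2 e z.1.1 z.1.2 (ndir z))))
  - fine (coll a a (fun z => psi z.1.1 + psi z.1.2)).
Proof.
move=> ma ai mpsi psiM.
pose G (z : collisions R) := psi (post1 e z.1.1 z.1.2 (ndir z)) + psi (post2 e z.1.1 z.1.2 (ndir z)).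
pose L (z : collisions R) := psi z.1.1 + psi z.1.2.
have mG : nnm G.
  by apply: nnmD; [exact: (nnm_comp mpsi (measurable_post1 e))|exact: (nnm_comp mpsi (measurable_post2 e))].
have mL : nnm L.
  by apply: nnmD; [exact: (nnm_comp mpsi (@measurable_zv R))|exact: (nnm_comp mpsi (@measurable_zw R))].
have GM z : G z <= 2 * M by rewrite /G mulr2n mulrDl mul1r lerD.
have LM z : L z <= 2 * M by rewrite /L mulr2n mulrDl mul1r lerD.
have iG : (mX R).-integrable setT (EFin \o fun z => ker z * (a z.1.1 * a z.1.2) * G z).
  apply: nnm_integrable; first exact: nnm_coll.
  have := coll_fin ma ma mG GM ai ai; rewrite ge0_fin_numE//.
  by apply: nint_ge0 => z; exact: nnm_ge0 (nnm_coll ma ma mG).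
have iL : (mX R).-integrable setT (EFin \o fun z => ker z * (a z.1.1 * a z.1.2) * L z).
  apply: nnm_integrable; first exact: nnm_coll.
  have := coll_fin ma ma mL LM ai ai; rewrite ge0_fin_numE//.
  by apply: nint_ge0 => z; exact: nnm_ge0 (nnm_coll ma ma mL).
transitivity (\int[mX R]_z (ker z * (a z.1.1 * a z.1.2) * G z - ker z * (a z.1.1 * a z.1.2) * L z)); last first.
  by rewrite RintegralB.
(* The factor 2 pi undoes the one inside [wsph], since [collision_weak] has it in front of the
   integral. *)
pose H z := (2 * pi) * (ker z * (a z.1.1 * a z.1.2) * (G z - L z)).
have iH : (mX R).-integrable setT (EFin \o H).
  pose g1 z := ker z * (a z.1.1 * a z.1.2) * G z; pose g2 z := ker z * (a z.1.1 * a z.1.2) * L z.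
  rewrite (_ : EFin \o H = fun z => ((2 * pi)%:E * ((EFin \o g1) z - (EFin \o g2) z))%E).
    by apply: integrableZl => //; exact: integrableB.
  by apply/funext => z; rewrite /H /= -EFinB -EFinM -mulrBr.
have mH : measurable_fun setT H by apply/measurable_EFinP; exact: measurable_int iH.
have Hle z : `|H z| <= (2 * pi) * ((enorm z.1.1 + enorm z.1.2) * (a z.1.1 * a z.1.2) * (2 * M)) * wsph z.2.
  rewrite /H normrM (ger0_norm (ltW pi2_gt0)) -[leRHS]mulrA.
  apply: ler_wpM2l; first exact: ltW.
  rewrite (normrM (ker z * _)) (normrM (ker z)) (normrM (a _)) (ger0_norm (nnm_ge0 z (nnm_ker R))) !(ger0_norm (nnm_ge0 _ ma)).
  have -> : (enorm z.1.1 + enorm z.1.2) * (a z.1.1 * a z.1.2) * (2 * M) * wsph z.2 =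
    (wsph z.2 * (enorm z.1.1 + enorm z.1.2)) * (a z.1.1 * a z.1.2) * (2 * M) by ring.
  have a1 := nnm_ge0 z.1.1 ma; have a2 := nnm_ge0 z.1.2 ma; have k0 := nnm_ge0 z (nnm_ker R).
  apply: ler_pM => //; first by apply: mulr_ge0 => //; exact: mulr_ge0.
    by apply: ler_wpM2r; [exact: mulr_ge0|exact: ker_le].
  have := nnm_ge0 z mG; have := nnm_ge0 z mL; have := GM z; have := LM z.
  by rewrite ler_norml => h1 h2 h3 h4; apply/andP; split; lra.
transitivity ((2 * pi)^-1 * \int[mX R]_z H z); last first.
  rewrite -RintegralZl//; apply: eq_Rintegral => z _.
  by rewrite /H mulrA mulVf ?gt_eqF// mul1r mulrBr.
rewrite /collision_weak; congr (_ * _).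
have mHp p : measurable_fun setT (fun q : measurableTypeR R * measurableTypeR R => H (p, q)).
  by apply: (measurableT_comp mH); exact: measurable_pair1.
have iHp p : (sf_prod leb leb).-integrable setT (fun q => (H (p, q))%:E).
  apply: (sf_prod_bounded_integrable (mHp p)
    (M := 2 * pi * ((enorm p.1 + enorm p.2) * (a p.1 * a p.2) * (2 * M)))) => q.
  exact: (Hle (p, q)).
rewrite -(Rintegral_fubini iH iHp); apply: eq_Rintegral => p _.
have iHpt p1 t : leb.-integrable setT (fun f => (H (p1, (t, f)))%:E).
  pose C := (2 * pi) * ((enorm p1.1 + enorm p1.2) * (a p1.1 * a p1.2) * (2 * M)).
  have M0 : 0 <= M by apply: le_trans (psiM 0); exact: nnm_ge0.
  have C0 : 0 <= C.
    apply: mulr_ge0; first exact: ltW.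
    apply: mulr_ge0; last exact: mulr_ge0.
    by apply: mulr_ge0; [apply: addr_ge0; exact: enorm_ge0|apply: mulr_ge0; exact: nnm_ge0].
  have i0 : 0 <= (2 * pi)^-1 :> R by rewrite invr_ge0 ltW.
  have mi : nnm (\1_(`[0, (2 * pi)]%classic) : measurableTypeR R -> R).
    by apply: nnm_indic; exact: measurable_itv.
  apply: (@le_nnm_integrable _ (measurableTypeR R) R leb (fun f => H (p1, (t, f)))
    (fun f => C * (2 * pi)^-1 * \1_(`[0, (2 * pi)]%classic) f)).
  - by apply: (measurableT_comp (mHp p1)); exact: measurable_pair1.
  - by apply: nnmZ => //; exact: mulr_ge0.
  - move=> f; apply: le_trans (Hle (p1, (t, f)) : _ <= C * _) _; rewrite -mulrA; apply: ler_wpM2l => //.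
    apply: le_trans (wsph_le _) _; apply: ler_wpM2l => //=.
    by rewrite -[leRHS]mul1r ler_wpM2r.
  - have c0 : 0 <= C * (2 * pi)^-1 by exact: mulr_ge0.
    by rewrite (nintZ leb c0 mi) lte_mul_pinfty ?lee_fin//; exact: indic_itv_lty.
rewrite -(Rintegral_fubini (iHp p) (iHpt p)) /sphere_int Rintegral_mkcond.
apply: eq_Rintegral => t _; rewrite patchE; case: ifPn => t0; last first.
  rewrite /Rintegral integral0_eq// => y _.
  by rewrite /H /ker /wsph /= indicE in_setX (negbTE t0)/= !(mulr0,mul0r).
rewrite Rintegral_mkcond; apply: eq_Rintegral => f _; rewrite patchE.
rewrite /H /ker /wsph /= indicE in_setX /= t0/=; case: ifPn => f0; last by rewrite !(mulr0,mul0r).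
(* On [0, pi] the sine is nonnegative, so the absolute value in [wsph] agrees with the surface
   density. *)
have st : 0 <= sin t by apply: sin_ge0_pi; move: t0; rewrite inE/= in_itv.
rewrite (ger0_norm st) /G /L /ndir /=.
have : (pi : R) != 0 by rewrite gt_eqF ?pi_gt0.
by move: (pi : R) => c cn; field.
Qed.

End CollisionForm.


(** * Tests by nonnegative functions *)

Section Moments.
Variable R : realType.
Implicit Types (a b psi : vec R -> R).

Definition moment a psi : \bar R := (\int[leb3]_v (a v * psi v)%:E)%E.

Lemma le_weight2_ge0 psi (M : R) : nnm psi -> (forall v, psi v <= M * weight2 v) -> 0 <= M.
Proof.
move=> mp pM; have := le_trans (nnm_ge0 (0 : vec R) mp) (pM 0).
by rewrite pmulr_lge0//; exact: lt_le_trans (weight2_ge1 _).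
Qed.

Lemma moment_ge0 a psi : nnm a -> nnm psi -> (0 <= moment a psi)%E.
Proof. by move=> ma mp; apply: nint_ge0 => v; exact: nnm_ge0 (nnmM ma mp). Qed.

Lemma momentD a psi phi : nnm a -> nnm psi -> nnm phi ->
  moment a (fun v => psi v + phi v) = (moment a psi + moment a phi)%E.
Proof.
move=> ma mp mq; rewrite /moment; under eq_integral do rewrite mulrDr.
by rewrite nintD//; exact: nnmM.
Qed.

Lemma momentZ a (c : R) psi : 0 <= c -> nnm a -> nnm psi ->
  moment a (fun v => c * psi v) = (c%:E * moment a psi)%E.
Proof.
move=> c0 ma mp; rewrite /moment; under eq_integral do rewrite mulrCA.
by rewrite nintZ//; exact: nnmM.
Qed.

Lemma le_moment a psi phi : nnm a -> nnm psi -> nnm phi ->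
  (forall v, psi v <= phi v) -> (moment a psi <= moment a phi)%E.
Proof.
move=> ma mp mq pq; apply: nint_le; [exact: nnmM|exact: nnmM|move=> v].
by apply: ler_wpM2l => //; exact: nnm_ge0.
Qed.

Lemma le_moment_mom2 a psi (M : R) : 0 <= M -> nnm a -> nnm psi ->
  (forall v, psi v <= M * weight2 v) -> (moment a psi <= M%:E * mom2 a)%E.
Proof.
move=> M0 ma mp pM; rewrite -[mom2 a]/(moment a (@weight2 R)) -momentZ//; last exact: nnm_weight2.
by apply: le_moment => //; apply: nnmZ => //; exact: nnm_weight2.
Qed.

Lemma moment_fin a psi (M : R) : nnm a -> nnm psi -> (mom2 a < +oo)%E ->
  (forall v, psi v <= M * weight2 v) -> moment a psi \is a fin_num.
Proof.
move=> ma mp ai pM.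
have M0 := le_weight2_ge0 mp pM.
rewrite ge0_fin_numE ?moment_ge0//; apply: le_lt_trans (le_moment_mom2 M0 ma mp pM) _.
by rewrite lte_mul_pinfty.
Qed.

Lemma moment_dist a b psi (M : R) : nnm a -> nnm b -> nnm psi ->
  (forall v, psi v <= M * weight2 v) ->
  (moment a psi <= moment b psi + M%:E * mom2 (fun v => `|a v - b v|)%R)%E.
Proof.
move=> ma mb mp pM; have md := nnm_dist ma mb.
have M0 := le_weight2_ge0 mp pM.
apply: le_trans (leeD (lexx _) (le_moment_mom2 M0 md mp pM)).
rewrite /moment -nintD//; [|exact: nnmM|exact: nnmM].
apply: nint_le; [exact: nnmM|by apply: nnmD; exact: nnmM|move=> v].
rewrite -mulrDl; apply: ler_wpM2r; first exact: nnm_ge0.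
by rewrite -lerBlDl ler_norm.
Qed.

Lemma mom2_triangle a b : nnm a -> nnm b ->
  (mom2 a <= mom2 b + mom2 (fun v => `|a v - b v|)%R)%E.
Proof.
move=> ma mb; have := @moment_dist a b (@weight2 R) 1 ma mb (nnm_weight2 R).
by rewrite mul1e; apply => v; rewrite mul1r.
Qed.

End Moments.

Section KineticFlow.
Variable R : realType.

(** The part of the notion of solution on which the evolution of moments rests. Regularity is asked
    at all real times, so that continuity is two-sided also at 0, and the equation at positive
    times. *)
Record kflow (e : R) (g : R -> vec R -> R) : Prop := {
  kf_nnm : forall r, nnm (g r) ;
  kf_mom : forall r, (mom2 (g r) < +oo)%E ;
  kf_cont : forall r0, mom2 (fun v => `|g r v - g r0 v|)%R @[r --> r0] --> 0%E ;
  kf_eqn : forall psi : vec R -> R, test_function psi -> forall t : R, 0 < t ->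
    is_derive t 1 (fun s => \int[leb3]_v (g s v * psi v)) (collision_weak e (g t) psi) }.

Variables (e : R) (g : R -> vec R -> R).
Hypothesis gP : kflow e g.

Let ng := kf_nnm gP.
Let gi := kf_mom gP.

(** The distance between two times in L^1 with weight 1 + |v|^2. *)
Definition dist2 (r r0 : R) : R := fine (mom2 (fun v => `|g r v - g r0 v|)%R).

Lemma dist2_fin r r0 : mom2 (fun v => `|g r v - g r0 v|)%R \is a fin_num.
Proof.
have md := nnm_dist (ng r) (ng r0).
rewrite ge0_fin_numE ?mom2_ge0//.
apply: (@le_lt_trans _ _ (mom2 (g r) + mom2 (g r0))%E); last by rewrite lte_add_pinfty.
rewrite /mom2 -nintD; [|exact: nnmM (ng r) (nnm_weight2 R)|exact: nnmM (ng r0) (nnm_weight2 R)].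
apply: nint_le; first exact: nnmM md (nnm_weight2 R).
  by apply: nnmD; exact: nnmM (ng _) (nnm_weight2 R).
move=> v; rewrite -mulrDl; apply: ler_wpM2r; first exact: nnm_ge0 (nnm_weight2 R).
by rewrite (le_trans (ler_normB _ _))// !ger0_norm ?(nnm_ge0 _ (ng _)).
Qed.

Lemma dist2_ge0 r r0 : 0 <= dist2 r r0.
Proof. by apply: fine_ge0; apply: mom2_ge0; exact: nnm_dist. Qed.

Lemma mom2_fin r : mom2 (g r) \is a fin_num.
Proof. by rewrite ge0_fin_numE// mom2_ge0. Qed.

Lemma dist2_cvg r0 : dist2 r r0 @[r --> r0] --> (0 : R).
Proof. exact: fine_cvg (kf_cont gP r0). Qed.

(** The quadratic term is there for collision integrals, which are quadratic in the solution. *)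
Lemma dist2_continuous (phi : R -> R) :
  (forall r0, exists2 K, 0 <= K & forall r, `|phi r - phi r0| <= K * (dist2 r r0 + dist2 r r0 ^+ 2)) ->
  continuous phi.
Proof.
move=> H r0; have [K K0 HK] := H r0.
apply/cvgrPdist_lt => eps eps0.
have c0 : K * (dist2 r r0 + dist2 r r0 ^+ 2) @[r --> r0] --> K * (0 + 0 ^+ 2).
  apply: cvgMr; apply: cvgD; first exact: dist2_cvg.
  by rewrite expr2; under eq_fun do rewrite expr2; apply: cvgM; exact: dist2_cvg.
rewrite expr0n/= addr0 mulr0 in c0.
near=> r; rewrite distrC; apply: le_lt_trans (HK r) _.
apply: le_lt_trans (ler_norm _) _.
by near: r; move/cvgr0Pnorm_lt : c0; apply.
Unshelve. all: by end_near. Qed.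

Lemma dist2C r r0 : dist2 r r0 = dist2 r0 r.
Proof.
by rewrite /dist2; congr (fine (mom2 _)); apply/funext => v; rewrite distrC.
Qed.

Lemma moment_continuous psi (M : R) : nnm psi -> (forall v, psi v <= M * weight2 v) ->
  continuous (fun r => fine (moment (g r) psi)).
Proof.
move=> mp pM; apply: dist2_continuous => r0.
have M0 := le_weight2_ge0 mp pM.
exists M => // r.
have step r1 r2 : fine (moment (g r1) psi) <= fine (moment (g r2) psi) + M * dist2 r1 r2.
  have := moment_dist (ng r1) (ng r2) mp pM.
  have f1 := moment_fin (ng r1) mp (gi r1) pM; have f2 := moment_fin (ng r2) mp (gi r2) pM.
  by rewrite -(fineK f1) -(fineK f2) -(fineK (dist2_fin r1 r2)) -EFinM -EFinD lee_fin.
have h1 := step r r0; have h2 := step r0 r; rewrite (dist2C r0 r) in h2.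
have h3 : 0 <= M * dist2 r r0 ^+ 2 by rewrite mulr_ge0// sqr_ge0.
by rewrite ler_norml mulrDr; apply/andP; split; lra.
Qed.

Lemma coll_continuous F (M : R) : nnm F -> (forall z, F z <= M) ->
  continuous (fun r => fine (coll (g r) (g r) F)).
Proof.
move=> mF FM; apply: dist2_continuous => r0.
have M0 : 0 <= M by apply: le_trans (FM (0, 0)); exact: nnm_ge0.
pose c := fine (csph R); pose m r := fine (mom2 (g r)).
have c0 : 0 <= c by apply: fine_ge0; apply: nint_ge0 => q; exact: nnm_ge0 (nnm_wsph R).
have m0 r : 0 <= m r by apply: fine_ge0; exact: mom2_ge0.
have tri r1 r2 : m r1 <= m r2 + dist2 r1 r2.
  have := mom2_triangle (ng r1) (ng r2).
  by rewrite -(fineK (mom2_fin r1)) -(fineK (mom2_fin r2)) -(fineK (dist2_fin r1 r2)) -EFinD lee_fin.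
have step r1 r2 : fine (coll (g r1) (g r1) F) <=
    fine (coll (g r2) (g r2) F) + M * (c * (dist2 r1 r2 * (m r1 + m r2))).
  have := coll_dist (ng r1) (ng r2) mF FM.
  have f1 := coll_fin (ng r1) (ng r1) mF FM (gi r1) (gi r1).
  have f2 := coll_fin (ng r2) (ng r2) mF FM (gi r2) (gi r2).
  rewrite -(fineK f1) -(fineK f2) -(fineK (dist2_fin r1 r2)) -(fineK (mom2_fin r1)).
  by rewrite -(fineK (mom2_fin r2)) -(fineK (csph_fin R)) -!(EFinM,EFinD) lee_fin.
(* With D the distance, m r <= m r0 + D gives D (m r + m r0) <= 2 m r0 D + D^2, which is at most (2
   m r0 + 1)(D + D^2). *)
exists (M * (c * (2 * m r0 + 1))); first by rewrite !mulr_ge0// addr_ge0// mulr_ge0.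
move=> r; have h1 := step r r0; have h2 := step r0 r; rewrite (dist2C r0 r) (addrC (m r0)) in h2.
have d0 := dist2_ge0 r r0; set D := dist2 r r0 in d0 h1 h2 *.
have B : M * (c * (D * (m r + m r0))) <= M * (c * (2 * m r0 + 1)) * (D + D ^+ 2).
  rewrite -!mulrA; do 2! apply: ler_wpM2l => //.
  apply: (@le_trans _ _ (D * (2 * m r0 + D))).
    by apply: ler_wpM2l => //; have := tri r r0; rewrite -/D; lra.
  rewrite -subr_ge0 (_ : _ - _ = D + 2 * m r0 * D ^+ 2); last by ring.
  by rewrite addr_ge0// mulr_ge0 ?sqr_ge0// mulr_ge0.
by rewrite ler_norml; apply/andP; split; lra.
Qed.

End KineticFlow.


Section Balance.
Variable R : realType.
Local Notation leb := (@lebesgue_measure R).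
Variables (e : R) (g : R -> vec R -> R).
Hypothesis gP : kflow e g.

Let ng := kf_nnm gP.
Let gi := kf_mom gP.

Definition loss r (h : vec R -> R) : \bar R :=
  (coll (g r) (g r) (fun z => h z.1.1) + coll (g r) (g r) (fun z => h z.1.2))%E.

Definition gain r (h : vec R -> R) : \bar R :=
  (coll (g r) (g r) (fun z => h (post1 e z.1.1 z.1.2 (ndir z))) +
   coll (g r) (g r) (fun z => h (post2 e z.1.1 z.1.2 (ndir z))))%E.

Lemma posfun_coll (X : collisions R -> vec R) r :
  measurable_fun setT (X : collisions R -> mvec R) ->
  posfun (fun h : vec R -> R => coll (g r) (g r) (fun z => h (X z))).
Proof.
move=> mX; apply: posfun_int => //; apply: nnmM; first exact: nnm_ker.
by apply: nnmM; [exact: (nnm_comp (ng r) (@measurable_zv R))|exact: (nnm_comp (ng r) (@measurable_zw R))].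
Qed.

Lemma posfun_loss r : posfun (loss r).
Proof.
by apply: posfun_add; apply: posfun_coll; [exact: (@measurable_zv R)|exact: (@measurable_zw R)].
Qed.

Lemma posfun_gain r : posfun (gain r).
Proof.
by apply: posfun_add; apply: posfun_coll; [exact: measurable_post1|exact: measurable_post2].
Qed.

(** For the truncations of h at level n the collision integral is continuous in time; their
    increasing limit is then measurable, even where it is infinite. *)
Lemma coll_time_measurable (X : collisions R -> vec R) (D : set R) (h : vec R -> R) :
  measurable_fun setT (X : collisions R -> mvec R) -> measurable D -> nnm h ->
  measurable_fun D (fun r => coll (g r) (g r) (fun z => h (X z))).
Proof.
move=> mX mD mh.
have mhn n : nnm (fun v => Num.min (h v) n%:R) by exact: nnm_min.
have nhn n : nnm (fun z : collisions R => Num.min (h (X z)) n%:R) by exact: (nnm_comp (mhn n) mX).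
have hle n z : Num.min (h (X z)) n%:R <= n%:R by rewrite ge_min lexx orbT.
apply: (emeasurable_fun_cvg (fun n r => coll (g r) (g r) (fun z => Num.min (h (X z)) n%:R))).
  move=> n; apply: (eq_measurable_fun (EFin \o fun r => fine (coll (g r) (g r) (fun z => Num.min (h (X z)) n%:R)))).
    by move=> r _ /=; rewrite fineK//; exact: (coll_fin (ng r) (ng r) (nhn n) (hle n) (gi r) (gi r)).
  apply/measurable_EFinP; apply: measurable_funTS; apply: continuous_measurable_fun.
  exact: (coll_continuous gP (nhn n) (hle n)).
move=> r _; apply: (pf_mct (posfun_coll r mX) mhn) => // v.
  by move=> m n mn; rewrite le_min !ge_min lexx/= ler_nat mn orbT.
apply: cvg_near_cst; near=> n; apply/min_idPl.
by near: n; exact: nbhs_infty_ger.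
Unshelve. all: by end_near. Qed.

Lemma measurable_loss (D : set R) h : measurable D -> nnm h ->
  measurable_fun D (fun r => loss r h).
Proof.
move=> mD mh; apply: emeasurable_funD; apply: coll_time_measurable => //.
  exact: (@measurable_zv R).
exact: (@measurable_zw R).
Qed.

Lemma measurable_gain (D : set R) h : measurable D -> nnm h ->
  measurable_fun D (fun r => gain r h).
Proof.
move=> mD mh; apply: emeasurable_funD; apply: coll_time_measurable => //.
  exact: measurable_post1.
exact: measurable_post2.
Qed.

Lemma gain_fin h (M : R) r : nnm h -> (forall v, h v <= M) -> gain r h \is a fin_num.
Proof.
move=> mh hM; rewrite fin_numD; apply/andP; split.
- by apply: (coll_fin (ng r) (ng r) (nnm_comp mh (measurable_post1 e)) _ (gi r) (gi r)) => z; exact: hM.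
- by apply: (coll_fin (ng r) (ng r) (nnm_comp mh (measurable_post2 e)) _ (gi r) (gi r)) => z; exact: hM.
Qed.

Lemma loss_fin h (M : R) r : nnm h -> (forall v, h v <= M) -> loss r h \is a fin_num.
Proof.
move=> mh hM; rewrite fin_numD; apply/andP; split.
- by apply: (coll_fin (ng r) (ng r) (nnm_comp mh (@measurable_zv R)) _ (gi r) (gi r)) => z; exact: hM.
- by apply: (coll_fin (ng r) (ng r) (nnm_comp mh (@measurable_zw R)) _ (gi r) (gi r)) => z; exact: hM.
Qed.

Lemma gain_continuous h (M : R) : nnm h -> (forall v, h v <= M) ->
  continuous (fun r => fine (gain r h)).
Proof.
move=> mh hM; have n1 := nnm_comp mh (measurable_post1 e); have n2 := nnm_comp mh (measurable_post2 e).
have h1 z := hM (post1 e z.1.1 z.1.2 (ndir z)); have h2 z := hM (post2 e z.1.1 z.1.2 (ndir z)).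
rewrite (_ : (fun r => _) = fun r =>
  fine (coll (g r) (g r) (fun z => h (post1 e z.1.1 z.1.2 (ndir z)))) +
  fine (coll (g r) (g r) (fun z => h (post2 e z.1.1 z.1.2 (ndir z))))).
  by move=> r; apply: cvgD; [exact: (coll_continuous gP n1 h1)|exact: (coll_continuous gP n2 h2)].
apply/funext => r; rewrite fineD//.
  exact: (coll_fin (ng r) (ng r) n1 h1 (gi r) (gi r)).
exact: (coll_fin (ng r) (ng r) n2 h2 (gi r) (gi r)).
Qed.

Lemma loss_continuous h (M : R) : nnm h -> (forall v, h v <= M) ->
  continuous (fun r => fine (loss r h)).
Proof.
move=> mh hM; have n1 := nnm_comp mh (@measurable_zv R); have n2 := nnm_comp mh (@measurable_zw R).
have h1 (z : collisions R) := hM z.1.1; have h2 (z : collisions R) := hM z.1.2.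
rewrite (_ : (fun r => _) = fun r =>
  fine (coll (g r) (g r) (fun z => h z.1.1)) + fine (coll (g r) (g r) (fun z => h z.1.2))).
  by move=> r; apply: cvgD; [exact: (coll_continuous gP n1 h1)|exact: (coll_continuous gP n2 h2)].
apply/funext => r; rewrite fineD//.
  exact: (coll_fin (ng r) (ng r) n1 h1 (gi r) (gi r)).
exact: (coll_fin (ng r) (ng r) n2 h2 (gi r) (gi r)).
Qed.

Lemma continuous_itv_integrable (phi : R -> R) (s t : R) : continuous phi ->
  leb.-integrable `[s, t] (EFin \o phi).
Proof.
move=> cphi; apply: continuous_compact_integrable; first exact: segment_compact.
exact: continuous_subspaceT.
Qed.

Lemma continuous_itv_fin (phi : R -> R) (s t : R) : continuous phi ->
  (\int[leb]_(r in `[s, t]) (phi r)%:E)%E \is a fin_num.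
Proof.
move=> cphi; apply: (@integrable_fin_num _ (measurableTypeR R) R leb `[s, t]%classic _ (EFin \o phi)).
  exact: measurable_itv.
exact: continuous_itv_integrable.
Qed.

(** The fundamental theorem of calculus applies because the collision term is continuous in time;
    continuity of the moment at s covers s = 0, where no derivative is given. The form with sums
    only still makes sense for infinite terms. *)
Lemma balance_test psi (M s t : R) : test_function psi -> nnm psi -> (forall v, psi v <= M) ->
  0 <= s -> s < t ->
  (moment (g t) psi + \int[leb]_(r in `[s, t]) loss r psi =
   moment (g s) psi + \int[leb]_(r in `[s, t]) gain r psi)%E.
Proof.
move=> tp mp pM s0 st.
have M0 : 0 <= M by apply: le_trans (pM 0); exact: (nnm_ge0 (0 : vec R)).
have pM2 v : psi v <= M * weight2 v.
  by apply: le_trans (pM v) _; rewrite ler_peMr// weight2_ge1.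
pose F r := fine (moment (g r) psi).
have cF : continuous F by exact: (moment_continuous gP mp pM2).
have cG := gain_continuous mp pM; have cL := loss_continuous mp pM.
pose J r := fine (gain r psi) - fine (loss r psi).
have cJ : continuous J by move=> r; apply: cvgB; [exact: cG|exact: cL].
have FE r : F r = \int[leb3]_v (g r v * psi v) by [].
have JE r : collision_weak e (g r) psi = J r.
  rewrite (collision_weakE e (ng r) (gi r) mp pM) /J /gain /loss /coll.
  have n1 := nnm_comp mp (measurable_post1 e); have n2 := nnm_comp mp (measurable_post2 e).
  have n3 := nnm_comp mp (@measurable_zv R); have n4 := nnm_comp mp (@measurable_zw R).
  congr (fine _ - fine _).
    rewrite -nintD; [|exact: nnm_coll|exact: nnm_coll].
    by apply: eq_integral => z _; rewrite mulrDr.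
  rewrite -nintD; [|exact: nnm_coll|exact: nnm_coll].
  by apply: eq_integral => z _; rewrite mulrDr.
have dF (r : R) : 0 < r -> is_derive r 1 F (J r).
  by move=> r0; rewrite -JE; exact: (kf_eqn gP tp r0).
have FTC : (\int[leb]_(r in `[s, t]) (J r)%:E = (F t)%:E - (F s)%:E)%E.
  apply: continuous_FTC2 => //; first exact: continuous_subspaceT.
    split.
    - move=> r; rewrite in_itv/= => /andP[sr _].
      by have [] := dF r (le_lt_trans s0 sr).
    - exact: cvg_at_right_filter (cF s).
    - exact: cvg_at_left_filter (cF t).
  move=> r; rewrite in_itv/= => /andP[sr _]; rewrite derive1E.
  by have [_ ->] := dF r (le_lt_trans s0 sr).
have iG := continuous_itv_integrable s t cG; have iL := continuous_itv_integrable s t cL.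
have EG : (\int[leb]_(r in `[s, t]) gain r psi = \int[leb]_(r in `[s, t]) (fine (gain r psi))%:E)%E.
  by apply: eq_integral => r _; rewrite fineK//; exact: (gain_fin r mp pM).
have EL : (\int[leb]_(r in `[s, t]) loss r psi = \int[leb]_(r in `[s, t]) (fine (loss r psi))%:E)%E.
  by apply: eq_integral => r _; rewrite fineK//; exact: (loss_fin r mp pM).
have fG := continuous_itv_fin s t cG.
have fL := continuous_itv_fin s t cL.
rewrite EG EL -(fineK (moment_fin (ng t) mp (gi t) pM2)) -(fineK (moment_fin (ng s) mp (gi s) pM2)).
have : (\int[leb]_(r in `[s, t]) (J r)%:E = \int[leb]_(r in `[s, t]) (fine (gain r psi))%:E
   - \int[leb]_(r in `[s, t]) (fine (loss r psi))%:E)%E.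
  by rewrite -integralB_EFin.
have arith (x y z w : R) : y - x = z - w -> y + w = x + z by move=> ?; lra.
by rewrite FTC -(fineK fG) -(fineK fL) -!EFinD => -[] /arith ->.
Qed.

(** It is used for the constant 1, for parts of linear functions, for the energy, and for the
    truncated logarithm of the solution at time t, which has no smoothness at all. *)
Lemma balance h (s t : R) : nnm h -> 0 <= s -> s < t ->
  (moment (g t) h + \int[leb]_(r in `[s, t]) loss r h =
   moment (g s) h + \int[leb]_(r in `[s, t]) gain r h)%E.
Proof.
move=> mh s0 st.
have mst : measurable `[s, t]%classic by exact: measurable_itv.
have mid : measurable_fun setT (fun v : mvec R => v : vec R) by exact: measurable_id.
have pm r : posfun (moment (g r)).
  by apply: posfun_int; [exact: ng|exact: mid].
have P1 : posfun (fun h => moment (g t) h + \int[leb]_(r in `[s, t]) loss r h)%E.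
  apply: posfun_add => //; apply: (posfun_family leb mst posfun_loss) => k mk.
  exact: measurable_loss.
have P2 : posfun (fun h => moment (g s) h + \int[leb]_(r in `[s, t]) gain r h)%E.
  apply: posfun_add => //; apply: (posfun_family leb mst posfun_gain) => k mk.
  exact: measurable_gain.
have boxes (a b c : R) (k := fun v : vec R => \1_(`]a, +oo[%classic) v.1.1 *
      (\1_(`]b, +oo[%classic) v.1.2 * \1_(`]c, +oo[%classic) v.2) : R) :
    (moment (g t) k + \int[leb]_(r in `[s, t]) loss r k =
     moment (g s) k + \int[leb]_(r in `[s, t]) gain r k)%E.
  rewrite /k {k}.
  have mb : nnm (fun v : vec R => \1_(`]a, +oo[%classic) v.1.1 *
      (\1_(`]b, +oo[%classic) v.1.2 * \1_(`]c, +oo[%classic) v.2) : R).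
    have m1 x : nnm (\1_(`]x, +oo[%classic) : R -> R) by apply: nnm_indic; exact: measurable_itv.
    apply: nnmM; first exact: (nnm_comp (m1 a) (@measurable_x R)).
    by apply: nnmM; [exact: (nnm_comp (m1 b) (@measurable_y R))|exact: (nnm_comp (m1 c) (@measurable_z R))].
  (* The bumps increase to the indicator of the box, so the identity for test functions passes to
     the limit on both sides. *)
  have nb n := nnm_bump n a b c.
  have c1 := pf_mct P1 nb (@bump_nd R a b c) mb (@bump_cvg R a b c).
  have c2 := pf_mct P2 nb (@bump_nd R a b c) mb (@bump_cvg R a b c).
  suff E : (fun n => (moment (g t) (bump n a b c) + \int[leb]_(r in `[s, t]) loss r (bump n a b c))%E)
    = (fun n => (moment (g s) (bump n a b c) + \int[leb]_(r in `[s, t]) gain r (bump n a b c))%E).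
    by rewrite E in c1; exact: cvg_unique c1 c2.
  apply/funext => n.
  exact: (balance_test (bump_test_function n a b c) (nb n) (@bump_le1 _ n a b c)).
have m1 : nnm ((fun=> 1) : vec R -> R) by exact: nnm_cst.
apply: (posfun_unique_boxes P1 P2 boxes _ mh).
apply: lte_add_pinfty.
  have w1 (v : vec R) : 1 <= 1 * weight2 v :> R by rewrite mul1r weight2_ge1.
  by have := moment_fin (ng t) m1 (gi t) w1; rewrite ge0_fin_numE ?moment_ge0.
have L1 (v : vec R) : 1 <= 1 :> R by [].
have fL := continuous_itv_fin s t (loss_continuous m1 L1).
rewrite (_ : (\int[leb]_(r in _) _ = \int[leb]_(r in `[s, t]) (fine (loss r (fun=> 1%R)))%:E)%E).
  by move: fL; rewrite fin_numElt => /andP[].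
by apply: eq_integral => r _; rewrite fineK//; exact: (loss_fin r m1 L1).
Qed.

End Balance.


(** * Conservation laws and Haff's upper bound *)

Section SphereQuadratics.
Variable R : realType.
Local Notation leb := (@lebesgue_measure R).

Lemma itv_FTC2 (F phi : R -> R) (a b : R) : a < b -> continuous phi ->
  (forall x : R, is_derive x 1 F (phi x)) ->
  (\int[leb]_(x in `[a, b]) (phi x)%:E = (F b - F a)%:E)%E.
Proof.
move=> ab cphi dF.
have cF : continuous F.
  by move=> x; apply/differentiable_continuous/derivable1_diffP; have [] := dF x.
apply: continuous_FTC2 => //; first exact: continuous_subspaceT.
  split; [by move=> x _; have [] := dF x|exact: cvg_at_right_filter (cF a)|].
  exact: cvg_at_left_filter (cF b).
by move=> x _; rewrite derive1E; have [_ ->] := dF x.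
Qed.

Lemma integral_azimuth (A B C : R) :
  (\int[leb]_(x in `[0%R, (2 * pi)%R]) ((A * cos x + B * sin x + C) ^+ 2)%:E =
   (pi * (A ^+ 2 + B ^+ 2) + 2 * pi * C ^+ 2)%:E)%E.
Proof.
(* Expanding the square, cos^2 and sin^2 have antiderivatives (x + sin cos)/2 and (x - sin cos)/2,
   and 2 sin cos has sin^2. *)
pose F : R -> R := (A ^+ 2 / 2) *: (id + sin * cos) + (B ^+ 2 / 2) *: (id - sin * cos)
  + C ^+ 2 *: id + (A * B) *: (sin * sin) + (2 * A * C) *: sin - (2 * B * C) *: cos.
have pi2 : 0 < 2 * pi :> R by rewrite mulr_gt0// pi_gt0.
have c2pi : cos (2 * pi) = 1 :> R by rewrite mulr_natl cos2pi.
have s2pi : sin (2 * pi) = 0 :> R by rewrite mulr_natl sin2pi.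
have cphi : continuous (fun x => (A * cos x + B * sin x + C) ^+ 2).
  move=> x; apply: (@continuous_comp _ _ _ (fun x => A * cos x + B * sin x + C) (fun y => y ^+ 2)); last exact: exprn_continuous.
  apply: cvgD; last exact: cvg_cst.
  by apply: cvgD; apply: cvgMr; [exact: continuous_cos|exact: continuous_sin].
have dF (x : R) : is_derive x 1 F ((A * cos x + B * sin x + C) ^+ 2).
  have ds := is_derive_sin x; have dc := is_derive_cos x; have di := is_derive_id x (1 : R).
  have dsc := is_deriveM ds dc.
  have D := is_deriveB (is_deriveD (is_deriveD (is_deriveD (is_deriveD
      (is_deriveZ (A ^+ 2 / 2) (is_deriveD di dsc)) (is_deriveZ (B ^+ 2 / 2) (is_deriveB di dsc)))
      (is_deriveZ (C ^+ 2) di)) (is_deriveZ (A * B) (is_deriveM ds ds)))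
      (is_deriveZ (2 * A * C) ds)) (is_deriveZ (2 * B * C) dc).
  apply: (is_derive_eq D); rewrite /GRing.scale /=.
  by have := cos2Dsin2 x; set c := cos x; set s := sin x => h;
    rewrite -[X in (A ^+ 2 / 2) * (X + _)]h -[X in (B ^+ 2 / 2) * (X - _)]h; field.
rewrite (itv_FTC2 pi2 cphi dF); congr EFin; rewrite /F !fctE c2pi s2pi cos0 sin0 /GRing.scale /=.
by move: (pi : R) => p; field.
Qed.

Lemma integral_polar (P Q : R) :
  (\int[leb]_(x in `[0%R, pi]) (sin x * (P * sin x ^+ 2 + Q * cos x ^+ 2))%:E =
   (P * (4 / 3) + Q * (2 / 3))%:E)%E.
Proof.
(* sin^3 has antiderivative cos^3/3 - cos, and sin cos^2 has - cos^3/3. *)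
pose F : R -> R := P *: (3^-1 *: (cos * cos * cos) - cos) - (Q / 3) *: (cos * cos * cos).
have cphi : continuous (fun x => sin x * (P * sin x ^+ 2 + Q * cos x ^+ 2)).
  move=> x; apply: cvgM; first exact: continuous_sin.
  apply: cvgD; apply: cvgMr.
    by apply: (@continuous_comp _ _ _ sin (fun y => y ^+ 2)); [exact: continuous_sin|exact: exprn_continuous].
  by apply: (@continuous_comp _ _ _ cos (fun y => y ^+ 2)); [exact: continuous_cos|exact: exprn_continuous].
have dF (x : R) : is_derive x 1 F (sin x * (P * sin x ^+ 2 + Q * cos x ^+ 2)).
  have dc := is_derive_cos x; have d3 := is_deriveM (is_deriveM dc dc) dc.
  have D := is_deriveB (is_deriveZ P (is_deriveB (is_deriveZ 3^-1 d3) dc)) (is_deriveZ (Q / 3) d3).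
  apply: (is_derive_eq D); rewrite !fctE /GRing.scale /=.
  have h := cos2Dsin2 x.
  have -> : sin x ^+ 2 = 1 - cos x ^+ 2 by rewrite -h addrAC subrr add0r.
  by field.
rewrite (itv_FTC2 (pi_gt0 R) cphi dF).
by congr EFin; rewrite /F !fctE cospi cos0 /GRing.scale /=; field.
Qed.

(** The mean of (u.n)^2 over the sphere is |u|^2/3, and the angular weight has mass 2. In the
    azimuth the integrand is a trigonometric polynomial, to which [integral_azimuth] applies. *)
Lemma sphere_quadratic (u : vec R) :
  (\int[sf_prod leb leb]_q (wsph q * dot u (sph q.1 q.2) ^+ 2)%:E = (2 / 3 * dot u u)%:E)%E.
Proof.
have mS : measurable_fun setT (fun q : measurableTypeR R * measurableTypeR R => sph q.1 q.2 : vec R).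
  exact: measurable_sph.
have mG : nnm (fun q : measurableTypeR R * measurableTypeR R => wsph q * dot u (sph q.1 q.2) ^+ 2).
  apply: nnmM; first exact: nnm_wsph; split=> [|q]; last exact: sqr_ge0.
  by apply: measurable_funX; apply: measurable_dot.
have pi0 := pi_gt0 R; have pi2 : 0 < 2 * pi :> R by rewrite mulr_gt0.
rewrite (sf_prod_tonelli1 leb leb mG).
transitivity (\int[leb]_(t in `[0%R, pi]) (sin t * (((u.1.1 ^+ 2 + u.1.2 ^+ 2) / 2) * sin t ^+ 2
    + u.2 ^+ 2 * cos t ^+ 2))%:E)%E; last first.
  by rewrite integral_polar; congr EFin; rewrite /dot; field.
rewrite [RHS]integral_mkcond; apply: eq_integral => t _; rewrite patchE.
case: ifPn => t0; last first.
  rewrite integral0_eq// => f _.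
  by rewrite /wsph /= indicE in_setX (negbTE t0)/= !(mulr0,mul0r).
have st : 0 <= sin t by apply: sin_ge0_pi; move: t0; rewrite inE/= in_itv.
pose w := (2 * pi)^-1 * sin t.
transitivity (\int[leb]_(f in `[0%R, (2 * pi)%R]) (w%:E * ((u.1.1 * sin t * cos f + u.1.2 * sin t * sin f
   + u.2 * cos t) ^+ 2)%:E))%E.
  rewrite [RHS]integral_mkcond; apply: eq_integral => f _; rewrite patchE.
  rewrite /wsph /= indicE in_setX /= t0/=; case: ifPn => f0; last by rewrite !(mulr0,mul0r).
  by rewrite (ger0_norm st) mulr1 -EFinM /w /dot /sph /= !mulrA.
have mq : measurable_fun setT (fun f : measurableTypeR R =>
   (u.1.1 * sin t * cos f + u.1.2 * sin t * sin f + u.2 * cos t) ^+ 2).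
  apply: measurable_funX; apply: measurable_funD => //; apply: measurable_funD;
    apply: measurable_funM => //; [exact: measurable_cos|exact: measurable_sin].
rewrite ge0_integralZl//.
- rewrite integral_azimuth -EFinM; congr EFin; rewrite /w.
  have : (pi : R) != 0 by rewrite gt_eqF.
  by move: (pi : R) => p p0; field.
- by apply: measurable_funTS; exact/measurable_EFinP.
- by move=> f _; rewrite lee_fin sqr_ge0.
- by rewrite lee_fin mulr_ge0// invr_ge0 ltW.
Qed.

(** 1 = |n|^2 is the sum of the squares of the three coordinates of n, each of which contributes
    2/3. *)
Lemma csphE : csph R = 2%:E.
Proof.
have ne (i : vec R) : nnm (fun q : measurableTypeR R * measurableTypeR R => wsph q * dot i (sph q.1 q.2) ^+ 2).
  apply: nnmM; first exact: nnm_wsph; split=> [|q]; last exact: sqr_ge0.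
  by apply: measurable_funX; apply: measurable_dot => //; exact: measurable_sph.
transitivity (\int[sf_prod leb leb]_q (wsph q * dot (1, 0, 0) (sph q.1 q.2) ^+ 2
  + (wsph q * dot (0, 1, 0) (sph q.1 q.2) ^+ 2 + wsph q * dot (0, 0, 1) (sph q.1 q.2) ^+ 2))%:E)%E.
  apply: eq_integral => q _; congr EFin; rewrite -[LHS]mulr1 -[in LHS](dot_sph q) -!mulrDr.
  by congr (_ * _); rewrite /dot /=; ring.
rewrite nintD//; last by apply: nnmD.
rewrite nintD// !sphere_quadratic -!EFinD; congr EFin; rewrite /dot /=; by field.
Qed.

End SphereQuadratics.


Lemma addIe_fin (R : realType) (x y c : \bar R) : c \is a fin_num ->
  (x + c = y + c -> x = y)%E.
Proof. by move=> fc H; rewrite -(addeK x fc) H addeK. Qed.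

Section CollisionAlgebra.
Variable R : realType.
Implicit Types (a b : vec R -> R) (F G : collisions R -> R).

Lemma collD a b F G : nnm a -> nnm b -> nnm F -> nnm G ->
  coll a b (fun z => F z + G z) = (coll a b F + coll a b G)%E.
Proof.
move=> ma mb mF mG; rewrite /coll; under eq_integral do rewrite mulrDr.
by rewrite nintD//; exact: nnm_coll.
Qed.

Lemma collZ a b (c : R) F : 0 <= c -> nnm a -> nnm b -> nnm F ->
  coll a b (fun z => c * F z) = (c%:E * coll a b F)%E.
Proof.
move=> c0 ma mb mF; rewrite /coll; under eq_integral do rewrite mulrCA.
by rewrite nintZ//; exact: nnm_coll.
Qed.

Lemma eq_coll a b F G : (forall z, F z = G z) -> coll a b F = coll a b G.
Proof. by move=> FG; congr coll; apply/funext. Qed.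

Lemma nnm_pair a b : nnm a -> nnm b -> nnm (fun p : mvec R * mvec R => a p.1 * b p.2).
Proof.
by move=> ma mb; apply: nnmM; [exact: (nnm_comp ma measurable_fst)|exact: (nnm_comp mb measurable_snd)].
Qed.

Lemma nint_pair a b : nnm a -> nnm b ->
  (\int[sf_prod leb3 leb3]_p (a p.1 * b p.2)%:E =
   \int[leb3]_v (a v)%:E * \int[leb3]_v (b v)%:E)%E.
Proof.
move=> ma mb; rewrite (sf_prod_tonelli1 leb3 leb3 (nnm_pair ma mb)) /=.
under eq_integral => v _ do rewrite (nintZ leb3 (nnm_ge0 v ma) mb).
rewrite ge0_integralZr//.
- by apply/measurable_EFinP; case: ma.
- by move=> v _; rewrite lee_fin; exact: nnm_ge0.
- by apply: nint_ge0 => v; exact: nnm_ge0.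
Qed.

Definition reldot (z : collisions R) : R := dot (z.1.1 - z.1.2) (ndir z).

Lemma measurable_reldot : measurable_fun setT reldot.
Proof.
apply: measurable_dot; last exact: measurable_ndir.
by apply: measurable_vecB; [exact: measurable_zv|exact: measurable_zw].
Qed.

Lemma nnm_reldot2 : nnm (fun z => reldot z ^+ 2).
Proof. by split=> [|z]; [apply: measurable_funX; exact: measurable_reldot|exact: sqr_ge0]. Qed.

Definition sqn (v : vec R) : R := enorm v ^+ 2.

Lemma nnm_sqn : nnm sqn. Proof. by apply: nnmX; exact: nnm_enorm. Qed.

Lemma post_energy (e : R) (v w n : vec R) : dot n n = 1 ->
  sqn (post1 e v w n) + sqn (post2 e v w n) + (1 - e ^+ 2) / 2 * dot (v - w) n ^+ 2 = sqn v + sqn w.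
Proof.
move=> n1; rewrite /sqn !enorm_sqr.
pose k := (1 + e) / 2 * dot (v - w) n.
have -> : dot (post1 e v w n) (post1 e v w n) = dot v v - 2 * k * dot v n + k ^+ 2 * dot n n.
  by rewrite /post1 -/k /dot /= /GRing.scale /=; ring.
have -> : dot (post2 e v w n) (post2 e v w n) = dot w w + 2 * k * dot w n + k ^+ 2 * dot n n.
  by rewrite /post2 -/k /dot /= /GRing.scale /=; ring.
by rewrite n1 /k dotBl; field.
Qed.

Lemma post_momentum (e : R) (v w n u : vec R) :
  dot (post1 e v w n) u + dot (post2 e v w n) u = dot v u + dot w u.
Proof. by rewrite /post1 /post2 /dot /= /GRing.scale /=; ring. Qed.

(** Momentum is signed while the balance holds for nonnegative functions; the component along u is
    therefore tested by its two parts. *)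
Definition ppart (u v : vec R) : R := Num.max (dot v u) 0.
Definition npart (u v : vec R) : R := Num.max (- dot v u) 0.

Lemma nnm_ppart u : nnm (ppart u).
Proof.
split; last by move=> v; rewrite le_max lexx orbT.
by apply: measurable_maxr => //; exact: measurable_dot.
Qed.

Lemma nnm_npart u : nnm (npart u).
Proof.
split; last by move=> v; rewrite le_max lexx orbT.
by apply: measurable_maxr => //; apply: measurable_funN; exact: measurable_dot.
Qed.

Lemma parts_sub u v : ppart u v - npart u v = dot v u.
Proof. by rewrite /ppart /npart /Num.max; do ! case: ifPn; lra. Qed.

Lemma parts_sqr u v : ppart u v ^+ 2 + npart u v ^+ 2 = dot v u ^+ 2 /\ ppart u v * npart u v = 0.
Proof.
rewrite /ppart /npart; have [h|/ltW h] := lerP 0 (dot v u).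
  have -> : Num.max (- dot v u) 0 = 0 by apply/max_r; rewrite oppr_le0.
  by rewrite expr0n addr0 mulr0.
have -> : Num.max (- dot v u) 0 = - dot v u by apply/max_l; rewrite oppr_ge0.
by rewrite expr0n add0r mul0r sqrrN.
Qed.

Lemma ppart_le_weight2 u v : dot u u = 1 -> ppart u v <= weight2 v.
Proof.
move=> u1; rewrite ge_max (le_trans ler01 (weight2_ge1 v)) andbT.
apply: le_trans (ler_norm _) _; apply: le_trans (dot_unit_le v u1) _.
by rewrite /weight2; have := sqr_ge0 (enorm v - 1); rewrite sqrrB1; have := enorm_ge0 v; lra.
Qed.

Lemma npart_le_weight2 u v : dot u u = 1 -> npart u v <= weight2 v.
Proof.
move=> u1; rewrite ge_max (le_trans ler01 (weight2_ge1 v)) andbT.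
apply: le_trans (ler_norm _) _; rewrite normrN; apply: le_trans (dot_unit_le v u1) _.
by rewrite /weight2; have := sqr_ge0 (enorm v - 1); rewrite sqrrB1; have := enorm_ge0 v; lra.
Qed.

Definition cube (v : vec R) : R := enorm v ^+ 3.

Lemma nnm_cube : nnm cube. Proof. by apply: nnmX; exact: nnm_enorm. Qed.

(** Collisions cost one power of the velocity, so the loss of energy is controlled by the cubic
    moment. The bound is arranged as two products so that [mX_prod] evaluates it. *)
Lemma coll_weight2_le a : nnm a ->
  (coll a a (fun z => weight2 z.1.1 + weight2 z.1.2)%R <=
   csph R * (4%:E * (moment a (fun=> 1%R) + moment a cube) * moment a (fun=> 1%R)
           + moment a (fun=> 1%R) * (4%:E * moment a cube)))%E.
Proof.
move=> ma.
have m1 : nnm ((fun=> 1) : vec R -> R) by exact: nnm_cst.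
have mc := nnm_cube.
pose A v := 4 * (a v * 1 + a v * cube v); pose B v := a v * 1; pose C v := 4 * (a v * cube v).
have mA : nnm A by apply: nnmZ => //; apply: nnmD; exact: nnmM.
have mB : nnm B by exact: nnmM.
have mC : nnm C by apply: nnmZ => //; exact: nnmM.
have EA : (\int[leb3]_v (A v)%:E = 4%:E * (moment a (fun=> 1%R) + moment a cube))%E.
  by rewrite /A nintZ//; [rewrite nintD//; exact: nnmM|apply: nnmD; exact: nnmM].
have EC : (\int[leb3]_v (C v)%:E = 4%:E * moment a cube)%E.
  by rewrite /C nintZ//; exact: nnmM.
have c0 : (0 <= csph R)%E by apply: nint_ge0 => q; exact: nnm_ge0 (nnm_wsph R).
rewrite -EA -EC ge0_muleDr; last 2 first.
- by apply: mule_ge0; [apply: nint_ge0 => v; exact: nnm_ge0|exact: moment_ge0].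
- by apply: mule_ge0; [exact: moment_ge0|apply: nint_ge0 => v; exact: nnm_ge0].
rewrite -(mX_prod (nnm_wsph R) mA mB) -(mX_prod (nnm_wsph R) mB mC).
have nn (f h : vec R -> R) : nnm f -> nnm h -> nnm (fun z : collisions R => wsph z.2 * (f z.1.1 * h z.1.2)).
  move=> mf mh; apply: nnmM; first exact: (nnm_comp (nnm_wsph R) (@measurable_zq R)).
  by apply: nnmM; [exact: (nnm_comp mf (@measurable_zv R))|exact: (nnm_comp mh (@measurable_zw R))].
rewrite -nintD; [|exact: nn|exact: nn].
have mW : nnm (fun z : collisions R => weight2 z.1.1 + weight2 z.1.2).
  by apply: nnmD; [exact: (nnm_comp (nnm_weight2 R) (@measurable_zv R))|exact: (nnm_comp (nnm_weight2 R) (@measurable_zw R))].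
apply: nint_le; [exact: nnm_coll|by apply: nnmD; exact: nn|move=> z].
have a1 := nnm_ge0 z.1.1 ma; have a2 := nnm_ge0 z.1.2 ma; have w0 := nnm_ge0 z.2 (nnm_wsph R).
set x := enorm z.1.1; set y := enorm z.1.2.
have x0 : 0 <= x by exact: enorm_ge0.
have y0 : 0 <= y by exact: enorm_ge0.
apply: (@le_trans _ _ (wsph z.2 * (x + y) * (a z.1.1 * a z.1.2) * (weight2 z.1.1 + weight2 z.1.2))).
  apply: ler_wpM2r; first exact: nnm_ge0 mW.
  by apply: ler_wpM2r; [exact: mulr_ge0|exact: ker_le].
rewrite /weight2 /A /B /C /cube -/x -/y.
rewrite [leRHS](_ : _ = wsph z.2 * (a z.1.1 * a z.1.2) * (4 * (1 + x ^+ 3 + y ^+ 3))); last by ring.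
rewrite [leLHS](_ : _ = wsph z.2 * (a z.1.1 * a z.1.2) * ((x + y) * (1 + x ^+ 2 + (1 + y ^+ 2)))); last by ring.
apply: ler_wpM2l; first by apply: mulr_ge0 => //; exact: mulr_ge0.
(* With t <= 1 + t^3 and xy(x + y) <= x^3 + y^3, the product (x + y)(2 + x^2 + y^2) is at most 4 (1
   + x^3 + y^3). *)
have h1 (t : R) : 0 <= t -> t <= 1 + t ^+ 3.
  move=> t0; have : 0 <= (t + 1) * (t - 1) ^+ 2 by rewrite mulr_ge0 ?sqr_ge0 ?addr_ge0.
  have : 0 <= t ^+ 2 by exact: sqr_ge0.
  by rewrite !exprS !expr0; nra.
have := h1 x x0; have := h1 y y0.
have : 0 <= (x + y) * (x - y) ^+ 2 by rewrite mulr_ge0 ?sqr_ge0 ?addr_ge0.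
rewrite !exprS !expr0 !mulr1; nra.
Qed.

Lemma coll_swap a F : nnm a -> nnm F ->
  coll a a F = coll a a (fun z => F ((z.1.2, z.1.1), z.2)).
Proof.
move=> ma mF; rewrite /coll (mX_swap (nnm_coll ma ma mF)).
apply: eq_integral => z _ /=; congr EFin; rewrite [in LHS](mulrC (a _)); congr (_ * _ * _).
by rewrite /ker /ndir /= !dotBl -normrN opprB.
Qed.

End CollisionAlgebra.


Lemma balance_cancel (R : realType) (x y z G G' L L' : \bar R) :
  x \is a fin_num -> y \is a fin_num -> z \is a fin_num ->
  G \is a fin_num -> G' \is a fin_num -> L \is a fin_num -> L' \is a fin_num ->
  (x + L = z + G -> y + L' = z + G' -> G + L' = G' + L -> x = y)%E.
Proof.
move=> fx fy fz fG fG' fL fL'.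
rewrite -(fineK fx) -(fineK fy) -(fineK fz) -(fineK fG) -(fineK fG') -(fineK fL) -(fineK fL').
by rewrite -!EFinD => -[h1] [h2] [h3]; congr EFin; lra.
Qed.

Section EnergyDecay.
Variable R : realType.
Local Notation leb := (@lebesgue_measure R).

Record normalized (g : R -> vec R -> R) : Prop := {
  nz_mass : moment (g 0) (fun=> 1%R) = 1%E ;
  nz_momentum : forall u, dot u u = 1 -> moment (g 0) (ppart u) = moment (g 0) (npart u) ;
  nz_cube : forall T : R, 0 <= T -> (\int[leb]_(r in `[0%R, T]) moment (g r) (@cube R) < +oo)%E }.

Variables (e : R) (g : R -> vec R -> R).
Hypotheses (e0 : 0 < e) (e1 : e < 1) (gP : kflow e g) (gN : normalized g).

Let ng := kf_nnm gP.
Let gi := kf_mom gP.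

Let m1 : nnm ((fun=> 1) : vec R -> R). Proof. exact: nnm_cst. Qed.

Let post1M (h : vec R -> R) : nnm h -> nnm (fun z : collisions R => h (post1 e z.1.1 z.1.2 (ndir z))).
Proof. by move=> mh; exact: (nnm_comp mh (measurable_post1 e)). Qed.

Let post2M (h : vec R -> R) : nnm h -> nnm (fun z : collisions R => h (post2 e z.1.1 z.1.2 (ndir z))).
Proof. by move=> mh; exact: (nnm_comp mh (measurable_post2 e)). Qed.

Let vM (h : vec R -> R) : nnm h -> nnm (fun z : collisions R => h z.1.1).
Proof. by move=> mh; exact: (nnm_comp mh (@measurable_zv R)). Qed.

Let wM (h : vec R -> R) : nnm h -> nnm (fun z : collisions R => h z.1.2).
Proof. by move=> mh; exact: (nnm_comp mh (@measurable_zw R)). Qed.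

Lemma gainE (r : R) (h : vec R -> R) : nnm h -> gain e g r h = coll (g r) (g r)
  (fun z => h (post1 e z.1.1 z.1.2 (ndir z)) + h (post2 e z.1.1 z.1.2 (ndir z))).
Proof. by move=> mh; rewrite collD//; [exact: post1M|exact: post2M]. Qed.

Lemma lossE (r : R) (h : vec R -> R) : nnm h -> loss g r h = coll (g r) (g r) (fun z => h z.1.1 + h z.1.2).
Proof. by move=> mh; rewrite collD//; [exact: vM|exact: wM]. Qed.

Lemma gain_ge0 (r : R) (h : vec R -> R) : nnm h -> (0 <= gain e g r h)%E.
Proof. by move=> mh; exact: (pf_ge0 (posfun_gain gP r) mh). Qed.

Lemma loss_ge0 (r : R) (h : vec R -> R) : nnm h -> (0 <= loss g r h)%E.
Proof. by move=> mh; exact: (pf_ge0 (posfun_loss gP r) mh). Qed.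

(** For the constant 1 gain and loss are the same expression, with a finite integral over time, and
    cancel. *)
Lemma massE (t : R) : 0 <= t -> moment (g t) (fun=> 1%R) = 1%E.
Proof.
rewrite le_eqVlt => /predU1P[<-|t0]; first exact: nz_mass gN.
have := balance gP m1 (lexx 0) t0; rewrite (nz_mass gN).
have L1 (v : vec R) : 1 <= 1 :> R by [].
have fL := continuous_itv_fin 0 t (loss_continuous gP m1 L1).
have EL : (\int[leb]_(r in `[0%R, t]) loss g r (fun=> 1%R) =
    \int[leb]_(r in `[0%R, t]) (fine (loss g r (fun=> 1%R)))%:E)%E.
  by apply: eq_integral => r _; rewrite fineK//; exact: (loss_fin gP r m1 L1).
by apply: addIe_fin; rewrite EL.
Qed.

Lemma moment_time_measurable (D : set R) (h : vec R -> R) : measurable D -> nnm h ->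
  measurable_fun D (fun r => moment (g r) h).
Proof.
move=> mD mh.
have mhn n : nnm (fun v => Num.min (h v) n%:R) by exact: nnm_min.
have hle n v : Num.min (h v) n%:R <= n%:R * weight2 v.
  by rewrite ge_min; apply/orP; right; rewrite ler_peMr// weight2_ge1.
have mid : measurable_fun setT (fun v : mvec R => v : vec R) by exact: measurable_id.
apply: (emeasurable_fun_cvg (fun n r => moment (g r) (fun v => Num.min (h v) n%:R))).
  move=> n; apply: (eq_measurable_fun (EFin \o fun r => fine (moment (g r) (fun v => Num.min (h v) n%:R)))).
    by move=> r _ /=; rewrite fineK//; exact: (moment_fin (ng r) (mhn n) (gi r) (hle n)).
  apply/measurable_EFinP; apply: measurable_funTS; apply: continuous_measurable_fun.
  exact: (moment_continuous gP (mhn n) (hle n)).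
move=> r _; apply: (pf_mct (@posfun_int _ _ _ _ _ leb3 _ _ (ng r) mid) mhn) => // v.
  by move=> m n mn; rewrite le_min !ge_min lexx/= ler_nat mn orbT.
apply: cvg_near_cst; near=> n; apply/min_idPl.
by near: n; exact: nbhs_infty_ger.
Unshelve. all: by end_near. Qed.

Lemma itv_integralD (D : set R) (f1 f2 : R -> \bar R) : measurable D ->
  (forall r, 0 <= f1 r)%E -> (forall r, 0 <= f2 r)%E ->
  measurable_fun D f1 -> measurable_fun D f2 ->
  (\int[leb]_(r in D) (f1 r + f2 r) = \int[leb]_(r in D) f1 r + \int[leb]_(r in D) f2 r)%E.
Proof.
move=> mD f10 f20 mf1 mf2.
by apply: (@ge0_integralD _ (measurableTypeR R) R leb D mD f1 f2).
Qed.

(** The cubic moment is integrable in time. The result makes the loss and gain of every function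
    bounded by [weight2] finite, which allows cancelling them in the conservation laws. *)
Lemma loss_weight2_lty (s t : R) : 0 <= s -> 0 <= t ->
  (\int[leb]_(r in `[s, t]) loss g r (@weight2 R) < +oo)%E.
Proof.
move=> s0 t0.
have mC := @nnm_cube R.
have cge r : (0 <= moment (g r) (@cube R))%E by apply: moment_ge0.
(* With unit mass and [csph] = 2, the bound of [coll_weight2_le] reads 2 (4 (1 + m) + 4 m) = 8 + 16
   m, m being the cubic moment. *)
have mlin (D : set R) : measurable D ->
    measurable_fun D (fun r => 8%:E + 16%:E * moment (g r) (@cube R))%E.
  move=> mD; have mm := moment_time_measurable mD mC.
  exact: (emeasurable_funD (measurable_cst _) (emeasurable_funM (measurable_cst _) mm)).
apply: (@le_lt_trans _ _ (\int[leb]_(r in `[0%R, t]) (8%:E + 16%:E * moment (g r) (@cube R)))%E).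
  apply: (@le_trans _ _ (\int[leb]_(r in `[s, t]) (8%:E + 16%:E * moment (g r) (@cube R)))%E).
    apply: ge0_le_integral.
    - exact: measurable_itv.
    - by move=> r _; apply: loss_ge0; exact: nnm_weight2.
    - by apply: (measurable_loss gP); [exact: measurable_itv|exact: nnm_weight2].
    - by apply: mlin; exact: measurable_itv.
    - move=> r; rewrite /= in_itv/= => /andP[sr _].
      rewrite lossE; last exact: nnm_weight2.
      apply: le_trans (coll_weight2_le (ng r)) _.
      rewrite (massE (le_trans s0 sr)) csphE mule1 mul1e.
      case: (moment (g r) (@cube R)) (cge r) => [x _|_|//].
        by rewrite -!(EFinD,EFinM) lee_fin; lra.
      have -> : (8%:E + 16%:E * +oo = +oo :> \bar R)%E by rewrite gt0_muley ?lte_fin.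
      by rewrite leey.
  apply: ge0_subset_integral; [exact: measurable_itv|exact: measurable_itv| | |].
  - by apply: mlin; exact: measurable_itv.
  - by move=> r _; rewrite adde_ge0// mule_ge0.
  - by apply: subset_itvr; rewrite bnd_simp.
have mm : measurable_fun `[0%R, t]%classic (fun r => moment (g r) (@cube R)).
  by apply: moment_time_measurable => //; exact: measurable_itv.
have m0t : measurable (`[0%R, t]%classic : set R) by exact: measurable_itv.
rewrite itv_integralD//; [|by move=> r; rewrite mule_ge0|exact: (emeasurable_funM (measurable_cst _) mm)].
rewrite ge0_integralZl//; apply: lte_add_pinfty.
  rewrite integral_cst//= lebesgue_measure_itv/=; case: ifP => _; last by rewrite mule0.
  by rewrite -EFinD -EFinM ltry.
by rewrite lte_mul_pinfty//; exact: (nz_cube gN t0).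
Qed.

(** The kernel contains one factor |u.n|, so this is the cubic quantity |u.n|^3 integrated over
    collisions. *)
Definition diss (r : R) : \bar R := coll (g r) (g r) (fun z => reldot z ^+ 2).

Lemma diss_ge0 r : (0 <= diss r)%E.
Proof. by apply: nint_ge0 => z; exact: nnm_ge0 (nnm_coll (ng r) (ng r) (@nnm_reldot2 R)). Qed.

Let ke : R := (1 - e ^+ 2) / 2.

Let ke0 : 0 < ke.
Proof.
rewrite /ke divr_gt0// (_ : 1 - e ^+ 2 = (1 - e) * (1 + e)); last by ring.
by apply: mulr_gt0; [rewrite subr_gt0|exact: addr_gt0].
Qed.

Lemma gain_sqn r : (gain e g r (@sqn R) + ke%:E * diss r = loss g r (@sqn R))%E.
Proof.
have ms := @nnm_sqn R.
rewrite gainE// lossE// /diss -collZ ?(ltW ke0)//; last exact: nnm_reldot2.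
rewrite -collD//; last 2 first.
- by apply: nnmD; [exact: post1M|exact: post2M].
- by apply: nnmZ; [exact: ltW|exact: nnm_reldot2].
by apply: eq_coll => z; exact: (post_energy e z.1.1 z.1.2 (dot_sph z.2)).
Qed.

Lemma gain_weight2_le r : (gain e g r (@weight2 R) <= loss g r (@weight2 R))%E.
Proof.
have mw := nnm_weight2 R.
rewrite gainE// lossE//; apply: le_coll => //.
- by apply: nnmD; [exact: post1M|exact: post2M].
- by apply: nnmD; [exact: vM|exact: wM].
move=> z; have := post_energy e z.1.1 z.1.2 (dot_sph z.2); rewrite -/(ndir z) /weight2 /sqn -/ke.
have : 0 <= ke * dot (z.1.1 - z.1.2) (ndir z) ^+ 2 by rewrite mulr_ge0 ?sqr_ge0 ?ltW.
by move=> h1 h2; lra.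
Qed.

Section BoundedByWeight.
Variables (h : vec R -> R).
Hypotheses (mh : nnm h) (hw : forall v, h v <= weight2 v).

Lemma loss_int_fin (s t : R) : 0 <= s -> 0 <= t ->
  (\int[leb]_(r in `[s, t]) loss g r h)%E \is a fin_num.
Proof.
move=> s0 t0; rewrite ge0_fin_numE; last by apply: integral_ge0 => r _; exact: loss_ge0.
apply: le_lt_trans (loss_weight2_lty s0 t0); apply: ge0_le_integral.
- exact: measurable_itv.
- by move=> r _; exact: loss_ge0.
- by apply: (measurable_loss gP) => //; exact: measurable_itv.
- by apply: (measurable_loss gP); [exact: measurable_itv|exact: nnm_weight2].
- by move=> r _; apply: (pf_le (posfun_loss gP r)) => //; exact: nnm_weight2.
Qed.

Lemma gain_int_fin (s t : R) : 0 <= s -> 0 <= t ->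
  (\int[leb]_(r in `[s, t]) gain e g r h)%E \is a fin_num.
Proof.
move=> s0 t0; rewrite ge0_fin_numE; last by apply: integral_ge0 => r _; exact: gain_ge0.
apply: le_lt_trans (loss_weight2_lty s0 t0); apply: ge0_le_integral.
- exact: measurable_itv.
- by move=> r _; exact: gain_ge0.
- by apply: (measurable_gain gP) => //; exact: measurable_itv.
- by apply: (measurable_loss gP); [exact: measurable_itv|exact: nnm_weight2].
- move=> r _; apply: le_trans (gain_weight2_le r).
  by apply: (pf_le (posfun_gain gP r)) => //; exact: nnm_weight2.
Qed.

Lemma moment_h_fin r : moment (g r) h \is a fin_num.
Proof. by apply: (moment_fin (ng r) mh (gi r) (M := 1)) => v; rewrite mul1r. Qed.

End BoundedByWeight.

Lemma sqn_le_weight2 v : @sqn R v <= weight2 v.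
Proof. by rewrite /sqn /weight2 lerDr. Qed.

Lemma diss_measurable (D : set R) : measurable D -> measurable_fun D diss.
Proof.
move=> mD; pose X (z : collisions R) : vec R := (reldot z, 0, 0).
have mX : measurable_fun setT (X : collisions R -> mvec R).
  by apply: measurable_vec => //; exact: measurable_reldot.
have mh : nnm (fun v : vec R => v.1.1 ^+ 2).
  by split=> [|v]; [apply: measurable_funX; exact: measurable_x|exact: sqr_ge0].
exact: (coll_time_measurable gP mX mD mh).
Qed.

(** The energy identity. Adding the finite gain to both sides turns it into the balance for |v|^2,
    since gain plus dissipation equals loss at each time. *)
Lemma diss_balance (s t : R) : 0 <= s -> s < t ->
  (moment (g t) (@sqn R) + \int[leb]_(r in `[s, t]) (ke%:E * diss r) = moment (g s) (@sqn R))%E.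
Proof.
move=> s0 st; have t0 := le_trans s0 (ltW st).
have ms := @nnm_sqn R; have mst : measurable (`[s, t]%classic : set R) by exact: measurable_itv.
apply: (addIe_fin (gain_int_fin ms sqn_le_weight2 s0 t0)).
rewrite -(balance gP ms s0 st) -addeA; congr (_ + _)%E.
have mdis := diss_measurable mst.
have mke : measurable_fun `[s, t]%classic (fun r => ke%:E * diss r)%E.
  exact: (emeasurable_funM (measurable_cst _) mdis).
have d0 r : (0 <= ke%:E * diss r)%E.
  by apply: mule_ge0; [rewrite lee_fin ltW|exact: diss_ge0].
have G0 r := gain_ge0 r ms.
rewrite -(itv_integralD mst d0 G0 mke (measurable_gain gP mst ms)).
by apply: eq_integral => r _; rewrite addeC gain_sqn.
Qed.

(** The difference of the two parts is linear, hence a collision invariant: the gain of one plus the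
    loss of the other is symmetric in the two parts, and the two balances can be compared. *)
Lemma momentum_conserved u (t : R) : dot u u = 1 -> 0 <= t ->
  moment (g t) (ppart u) = moment (g t) (npart u).
Proof.
move=> u1; rewrite le_eqVlt => /predU1P[<-|t0]; first exact: (nz_momentum gN u1).
have mp := nnm_ppart u; have mn := nnm_npart u.
have wp v := ppart_le_weight2 v u1; have wn v := npart_le_weight2 v u1.
have m0t : measurable (`[0%R, t]%classic : set R) by exact: measurable_itv.
have Bp := balance gP mp (lexx 0) t0; have Bn := balance gP mn (lexx 0) t0.
have GL : (\int[leb]_(r in `[0%R, t]) gain e g r (ppart u) + \int[leb]_(r in `[0%R, t]) loss g r (npart u)
  = \int[leb]_(r in `[0%R, t]) gain e g r (npart u) + \int[leb]_(r in `[0%R, t]) loss g r (ppart u))%E.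
  have D1 := itv_integralD m0t (fun r => gain_ge0 r mp) (fun r => loss_ge0 r mn)
    (measurable_gain gP m0t mp) (measurable_loss gP m0t mn).
  have D2 := itv_integralD m0t (fun r => gain_ge0 r mn) (fun r => loss_ge0 r mp)
    (measurable_gain gP m0t mn) (measurable_loss gP m0t mp).
  apply: (etrans (esym D1)); apply: (etrans _ D2).
  apply: eq_integral => r _.
  rewrite (gainE r mp) (gainE r mn) (lossE r mp) (lossE r mn).
  have nG (h : vec R -> R) : nnm h -> nnm (fun z : collisions R =>
      h (post1 e z.1.1 z.1.2 (ndir z)) + h (post2 e z.1.1 z.1.2 (ndir z))).
    by move=> mh; apply: nnmD; [exact: post1M|exact: post2M].
  have nL (h : vec R -> R) : nnm h -> nnm (fun z : collisions R => h z.1.1 + h z.1.2).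
    by move=> mh; apply: nnmD; [exact: vM|exact: wM].
  apply: (etrans (esym (collD (ng r) (ng r) (nG _ mp) (nL _ mn)))).
  apply: (etrans _ (collD (ng r) (ng r) (nG _ mn) (nL _ mp))).
  apply: eq_coll => z; have := post_momentum e z.1.1 z.1.2 (ndir z) u.
  by rewrite -!parts_sub; lra.
rewrite (nz_momentum gN u1) in Bp.
exact: (balance_cancel (moment_h_fin mp wp t) (moment_h_fin mn wn t) (moment_h_fin mn wn 0)
  (gain_int_fin mp wp (lexx 0) (ltW t0)) (gain_int_fin mn wn (lexx 0) (ltW t0))
  (loss_int_fin mp wp (lexx 0) (ltW t0)) (loss_int_fin mn wn (lexx 0) (ltW t0)) Bp Bn GL).
Qed.

End EnergyDecay.


Lemma itv_integral_cst (R : realType) (c s t : R) : s < t ->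
  (\int[@lebesgue_measure R]_(r in `[s, t]) (cst c%:E) r = (c * (t - s))%:E)%E.
Proof.
by move=> st; rewrite integral_cst//= lebesgue_measure_itv/= lte_fin st -EFinD -EFinM.
Qed.

Definition sqproj (R : realType) (u v : vec R) : R := dot v u ^+ 2.

Section HaffUpperBound.
Variable R : realType.
Local Notation leb := (@lebesgue_measure R).
Variables (e : R) (g : R -> vec R -> R).
Hypotheses (e0 : 0 < e) (e1 : e < 1) (gP : kflow e g) (gN : normalized g).

Let ng := kf_nnm gP.
Let gi := kf_mom gP.

Let m1 : nnm ((fun=> 1) : vec R -> R). Proof. exact: nnm_cst. Qed.

Let nnm_dot2 u : nnm (@sqproj R u).
Proof.
by split=> [|v]; [apply: measurable_funX; exact: measurable_dot|exact: sqr_ge0].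
Qed.

(* With [x = x+ - x-] the cross terms cancel because [x+] and [x-] have the same mean. *)
Lemma pair_variance (u : vec R) (r : R) : dot u u = 1 -> 0 <= r ->
  (\int[sf_prod leb3 leb3]_p (g r p.1 * g r p.2 * sqproj u (p.1 - p.2))%:E =
   2%:E * moment (g r) (sqproj u))%E.
Proof.
move=> u1 r0.
have mp := nnm_ppart u; have mn := nnm_npart u; have mg := ng r.
pose P v := g r v * ppart u v; pose N v := g r v * npart u v.
pose S v := g r v * sqproj u v; pose O v := g r v * 1.
have mP : nnm P by exact: nnmM.
have mN : nnm N by exact: nnmM.
have mS : nnm S by apply: nnmM => //; exact: nnm_dot2.
have mO : nnm O by exact: nnmM.
have mI : nnm (fun p : mvec R * mvec R => g r p.1 * g r p.2 * sqproj u (p.1 - p.2)).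
  apply: nnmM; first exact: nnm_pair.
  apply: (nnm_comp (nnm_dot2 u)); apply: measurable_vecB; first exact: measurable_fst.
  exact: measurable_snd.
have pp a b := @nint_pair R a b; have np a b := @nnm_pair R a b.
have fP : moment (g r) (ppart u) \is a fin_num.
  by apply: (moment_fin mg mp (gi r) (M := 1)) => v; rewrite mul1r ppart_le_weight2.
have EN : (\int[leb3]_v (N v)%:E = \int[leb3]_v (P v)%:E)%E.
  exact: (esym (momentum_conserved e0 e1 gP gN u1 r0)).
have EO : (\int[leb3]_v (O v)%:E = 1)%E by exact: (massE gP gN r0).
pose I := (\int[sf_prod leb3 leb3]_p (g r p.1 * g r p.2 * sqproj u (p.1 - p.2))%:E)%E.
pose q := moment (g r) (ppart u).
have fqq : (2%:E * (q * q + q * q) \is a fin_num)%E by rewrite fin_numM// fin_numD fin_numM.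
suff H : (I + 2%:E * (q * q + q * q) = 2%:E * moment (g r) (sqproj u) + 2%:E * (q * q + q * q))%E.
  exact: addIe_fin fqq H.
(* The same number is the integral of the products of like parts and of the products of unlike
   parts; adding it to both sides in these two forms leaves a pointwise identity between nonnegative
   integrands. *)
have E1 : (2%:E * (q * q + q * q) = \int[sf_prod leb3 leb3]_p (2 * (P p.1 * P p.2 + N p.1 * N p.2))%:E)%E.
  rewrite nintZ//; last by apply: nnmD; exact: nnm_pair.
  by rewrite nintD; [rewrite !pp// EN|exact: nnm_pair|exact: nnm_pair].
have E2 : (2%:E * (q * q + q * q) = \int[sf_prod leb3 leb3]_p (2 * (P p.1 * N p.2 + N p.1 * P p.2))%:E)%E.
  rewrite nintZ//; last by apply: nnmD; exact: nnm_pair.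
  by rewrite nintD; [rewrite !pp// EN|exact: nnm_pair|exact: nnm_pair].
have E3 : (2%:E * moment (g r) (sqproj u) =
    \int[sf_prod leb3 leb3]_p (S p.1 * O p.2 + O p.1 * S p.2)%:E)%E.
  rewrite nintD; [|exact: nnm_pair|exact: nnm_pair].
  by rewrite !pp// EO mule1 mul1e -[X in (_ = X + _)%E]mul1e -[X in (_ = _ + X)%E]mul1e -ge0_muleDl.
rewrite [in LHS]E1 E3 E2 /I -nintD//; last first.
  by apply: nnmZ => //; apply: nnmD; exact: nnm_pair.
rewrite -nintD; last 2 first.
- by apply: nnmD; exact: nnm_pair.
- by apply: nnmZ => //; apply: nnmD; exact: nnm_pair.
apply: eq_integral => p _; congr EFin; rewrite /P /N /S /O /sqproj dotBl -!parts_sub.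
have [h1 h2] := parts_sqr u p.1; have [h3 h4] := parts_sqr u p.2.
ring.
Qed.

(** The angular integral yields 2/3 |v - w|^2; by [pair_variance] in the three coordinate directions
    the integral of |v - w|^2 is twice the energy. *)
Lemma quadratic_collisions (r : R) : 0 <= r ->
  (\int[mX R]_z (wsph z.2 * (g r z.1.1 * g r z.1.2) * reldot z ^+ 2)%:E =
   (4 / 3)%:E * moment (g r) (@sqn R))%E.
Proof.
move=> r0; have mg := ng r.
have mG : nnm (fun z : collisions R => wsph z.2 * (g r z.1.1 * g r z.1.2) * reldot z ^+ 2).
  apply: nnmM; last exact: nnm_reldot2.
  apply: nnmM; first exact: (nnm_comp (nnm_wsph R) (@measurable_zq R)).
  by apply: nnmM; [exact: (nnm_comp mg (@measurable_zv R))|exact: (nnm_comp mg (@measurable_zw R))].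
rewrite mX_sphere//.
pose ei : seq (vec R) := [:: (1, 0, 0); (0, 1, 0); (0, 0, 1)].
pose T u (p : mvec R * mvec R) := g r p.1 * g r p.2 * sqproj u (p.1 - p.2).
have mT u : nnm (T u).
  apply: nnmM; first exact: nnm_pair.
  apply: (nnm_comp (nnm_dot2 u)); apply: measurable_vecB; first exact: measurable_fst.
  exact: measurable_snd.
transitivity (\int[sf_prod leb3 leb3]_p (2 / 3 * (T (1, 0, 0) p + (T (0, 1, 0) p + T (0, 0, 1) p)))%:E)%E.
  apply: eq_integral => p _.
  have mQ : nnm (fun q : measurableTypeR R * measurableTypeR R => wsph q * dot (p.1 - p.2) (sph q.1 q.2) ^+ 2).
    apply: nnmM; first exact: nnm_wsph; split=> [|q]; last exact: sqr_ge0.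
    by apply: measurable_funX; apply: measurable_dot => //; exact: measurable_sph.
  have gg0 : 0 <= g r p.1 * g r p.2 by apply: mulr_ge0; exact: nnm_ge0.
  transitivity (\int[sf_prod leb leb]_q (g r p.1 * g r p.2 * (wsph q * dot (p.1 - p.2) (sph q.1 q.2) ^+ 2))%:E)%E.
    apply: eq_integral => q _; congr EFin; rewrite /reldot /ndir /=; ring.
  rewrite nintZ// sphere_quadratic -EFinM; congr EFin.
  by rewrite /T /sqproj /dot /=; ring.
rewrite nintZ//; last by apply: nnmD => //; exact: nnmD.
rewrite nintD//; last exact: nnmD.
rewrite nintD// !pair_variance// ?/dot/=; try by ring.
rewrite -!momentZ//; do ?exact: nnm_dot2.
rewrite -!momentD//; do ?[exact: nnmZ|by apply: nnmD; exact: nnmZ].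
rewrite -!momentZ//; do ?[exact: nnm_sqn|by apply: nnmD; [|apply: nnmD]; exact: nnmZ].
- by apply: eq_integral => v _; congr EFin; rewrite /sqn enorm_sqr /sqproj /dot /=; field.
- exact: nnm_sqn.
Qed.

(** Jensen's inequality through its tangent line: s^3 >= (3/2) l s^2 - l^3/2 because the difference
    is (s - l)^2 (s + l/2). With l = sqrt(E), weight of total mass 2 and quadratic integral 4E/3,
    this gives 2 l E - l^3 = l E. *)
Lemma diss_lower (r : R) : 0 <= r ->
  ((fine (moment (g r) (@sqn R)) * Num.sqrt (fine (moment (g r) (@sqn R))))%:E <= diss g r)%E.
Proof.
move=> r0; have mg := ng r.
have fE : moment (g r) (@sqn R) \is a fin_num by exact: (moment_h_fin gP (@nnm_sqn R) (@sqn_le_weight2 R)).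
set E := fine _; have E0 : 0 <= E by apply: fine_ge0; apply: moment_ge0 => //; exact: nnm_sqn.
pose l := Num.sqrt E; have l0 : 0 <= l by exact: sqrtr_ge0.
have lE : l ^+ 2 = E by exact: sqr_sqrtr.
rewrite -/l.
pose W (z : collisions R) := wsph z.2 * (g r z.1.1 * g r z.1.2).
have mW : nnm W.
  apply: nnmM; first exact: (nnm_comp (nnm_wsph R) (@measurable_zq R)).
  by apply: nnmM; [exact: (nnm_comp mg (@measurable_zv R))|exact: (nnm_comp mg (@measurable_zw R))].
have mWr : nnm (fun z => W z * reldot z ^+ 2) by apply: nnmM => //; exact: nnm_reldot2.
have EW : (\int[mX R]_z (W z)%:E = 2%:E)%E.
  have mO : nnm (fun v => g r v * 1) by exact: nnmM.
  have := mX_prod (nnm_wsph R) mO mO; rewrite -/(csph R) csphE.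
  have -> : (\int[leb3]_v (g r v * 1)%:E = 1)%E by exact: (massE gP gN r0).
  by rewrite !mule1 => <-; apply: eq_integral => z _; rewrite /W !mulr1.
have key : (((3 * l / 2) * (4 / 3 * E))%:E <= diss g r + (l ^+ 3)%:E)%E.
  rewrite [(_ * (_ * E))%:E](_ : _ = ((3 * l / 2)%:E * \int[mX R]_z (W z * reldot z ^+ 2)%:E)%E); last first.
    by rewrite quadratic_collisions// -(fineK fE) -!EFinM.
  rewrite [(l ^+ 3)%:E](_ : _ = ((l ^+ 3 / 2)%:E * \int[mX R]_z (W z)%:E)%E); last first.
    by rewrite EW -EFinM; congr EFin; field.
  have l30 : 0 <= l ^+ 3 / 2 by rewrite mulr_ge0// exprn_ge0.
  have l10 : 0 <= 3 * l / 2 by rewrite mulr_ge0// mulr_ge0.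
  rewrite -!nintZ// /diss /coll -nintD; last 2 first.
  - by apply: nnm_coll => //; exact: nnm_reldot2.
  - exact: nnmZ.
  apply: nint_le; first exact: nnmZ.
    by apply: nnmD; [apply: nnm_coll => //; exact: nnm_reldot2|exact: nnmZ].
  move=> z; set s := `|reldot z|; have s0 : 0 <= s by exact: normr_ge0.
  have -> : reldot z ^+ 2 = s ^+ 2 by rewrite real_normK// num_real.
  have -> : ker z = wsph z.2 * s by [].
  rewrite -subr_ge0 (_ : _ - _ = W z * ((s - l) ^+ 2 * (s + l / 2))); last by rewrite /W; field.
  by rewrite mulr_ge0 ?(nnm_ge0 _ mW)// mulr_ge0 ?sqr_ge0// addr_ge0// mulr_ge0.
move: key (diss_ge0 gP r); case: (diss g r) => [d key _|_ _|//]; last by rewrite leey.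
move: key; rewrite -EFinD !lee_fin exprSr lE; lra.
Qed.

Definition En (r : R) : R := fine (moment (g r) (@sqn R)).

Lemma En_fin r : moment (g r) (@sqn R) \is a fin_num.
Proof. exact: (moment_h_fin gP (@nnm_sqn R) (@sqn_le_weight2 R)). Qed.

Lemma En_ge0 r : 0 <= En r.
Proof. by apply: fine_ge0; apply: moment_ge0 => //; exact: nnm_sqn. Qed.

Lemma En_continuous : continuous En.
Proof.
have w1 v : @sqn R v <= 1 * weight2 v by rewrite mul1r; exact: sqn_le_weight2.
exact: (moment_continuous gP (@nnm_sqn R) w1).
Qed.

Let ke : R := (1 - e ^+ 2) / 2.

Let ke0 : 0 < ke.
Proof.
rewrite /ke divr_gt0// (_ : 1 - e ^+ 2 = (1 - e) * (1 + e)); last by ring.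
by apply: mulr_gt0; [rewrite subr_gt0|exact: addr_gt0].
Qed.

Lemma En_nonincreasing (s t : R) : 0 <= s -> s <= t -> En t <= En s.
Proof.
move=> s0; rewrite le_eqVlt => /predU1P[->//|st].
rewrite -lee_fin !fineK ?En_fin// -(diss_balance e0 e1 gP gN s0 st) leeDl//.
by apply: integral_ge0 => r _; apply: mule_ge0; [rewrite lee_fin ltW|exact: (diss_ge0 gP)].
Qed.

(** The energy is nonincreasing, so on [s, t] the lower bound for the dissipation is smallest at
    t. *)
Lemma En_decay (s t : R) : 0 <= s -> s < t ->
  En t + ke * (t - s) * (En t * Num.sqrt (En t)) <= En s.
Proof.
move=> s0 st; pose c := ke * (En t * Num.sqrt (En t)).
have c0 : 0 <= c by rewrite mulr_ge0 ?(ltW ke0)// mulr_ge0 ?En_ge0 ?sqrtr_ge0.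
have mst : measurable (`[s, t]%classic : set R) by exact: measurable_itv.
have -> : ke * (t - s) * (En t * Num.sqrt (En t)) = c * (t - s) by rewrite /c; ring.
rewrite -lee_fin EFinD !fineK ?En_fin// -(diss_balance e0 e1 gP gN s0 st); apply: leeD => //.
rewrite -(itv_integral_cst c st).
apply: ge0_le_integral.
- exact: mst.
- by move=> r _; rewrite lee_fin.
- exact: measurable_cst.
- exact: (emeasurable_funM (measurable_cst _) (diss_measurable gP mst)).
- move=> r; rewrite /= in_itv/= => /andP[sr rt].
  rewrite EFinM; apply: lee_pmul.
  + by rewrite lee_fin ltW.
  + by rewrite lee_fin mulr_ge0 ?En_ge0 ?sqrtr_ge0.
  + by [].
  + apply: le_trans (diss_lower (le_trans s0 sr)); rewrite lee_fin -/(En r).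
    have h := En_nonincreasing (le_trans s0 sr) rt.
    by apply: ler_pM; [exact: En_ge0|exact: sqrtr_ge0|exact: h|exact: ler_wsqrtr].
Qed.

(* If [t^2 E(t) > k^2] with [k >= 8/ke] then the dissipation over [t/2, t] would
   exceed [E(t/2) <= 4 k^2 / t^2]. *)
Lemma En_upper : exists2 C : R, 0 <= C & forall t, 0 <= t -> (1 + t) ^+ 2 * En t <= C.
Proof.
(* The summand 8/ke serves the doubling step; En 0 + 1 gives k >= 1 and En 0 <= k^2 for times up to
   1. *)
pose k := 8 / ke + En 0 + 1.
have k80 : 0 <= 8 / ke by rewrite divr_ge0// ltW.
have E00 := En_ge0 0.
have k1 : 1 <= k by rewrite /k; lra.
have kE : En 0 <= k ^+ 2 by rewrite expr2; rewrite /k in k1 *; nra.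
have k8 : 8 <= ke * k by rewrite mulrC -ler_pdivrMr// /k; lra.
(* Induction over doublings: the bound at t/2 together with the dissipation on [t/2, t] yields the
   bound at t. *)
have dbl n : forall t, 0 <= t -> t <= 2 ^+ n -> t ^+ 2 * En t <= k ^+ 2.
  elim: n => [|n IH] t t0 tn.
    rewrite expr0 in tn; apply: le_trans kE; apply: le_trans (En_nonincreasing (lexx 0) t0).
    by rewrite ler_piMl ?En_ge0// expr_le1.
  have p1 : 1 <= 2 ^+ n :> R by rewrite exprn_ege1// ler1n.
  have [t1|t1] := lerP t 1; first exact: (IH _ t0 (le_trans t1 p1)).
  have h2 : t / 2 <= 2 ^+ n by rewrite ler_pdivrMr// -exprSr.
  have th : 0 <= t / 2 by rewrite divr_ge0.
  have tl : t / 2 < t by lra.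
  have D := En_decay th tl; have I := IH _ th h2.
  set x := Num.sqrt (En t) in D; have x0 : 0 <= x by exact: sqrtr_ge0.
  have xE : En t = x ^+ 2 by rewrite sqr_sqrtr// En_ge0.
  rewrite xE -exprMn; rewrite {}xE in D; set y := t * x.
  have y0 : 0 <= y by rewrite mulr_ge0.
  have D2 : ke * y ^+ 3 <= 8 * k ^+ 2.
    have -> : ke * y ^+ 3 = 2 * t ^+ 2 * (ke * (t - t / 2) * (x ^+ 2 * x)) by rewrite /y; field.
    apply: (@le_trans _ _ (2 * t ^+ 2 * En (t / 2))).
      by apply: ler_wpM2l; [rewrite mulr_ge0// sqr_ge0|have := sqr_ge0 x; lra].
    have -> : 2 * t ^+ 2 * En (t / 2) = 8 * ((t / 2) ^+ 2 * En (t / 2)) by field.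
    by rewrite ler_wpM2l.
  have k0 : 0 <= k by lra.
  rewrite ler_pXn2r ?nnegrE// leNgt; apply/negP => ky.
  have : ke * k * k ^+ 2 < ke * y ^+ 3.
    rewrite -mulrA -exprS ltr_pM2l//; rewrite ltr_pXn2r ?nnegrE//.
  have : 8 * k ^+ 2 <= ke * k * k ^+ 2 by rewrite ler_wpM2r ?sqr_ge0.
  by lra.
exists (2 * En 0 + 2 * k ^+ 2); first by rewrite addr_ge0// mulr_ge0// sqr_ge0.
move=> t t0.
have [n tn] : exists n, t <= 2 ^+ n.
  exists (Num.bound t); apply: le_trans (ltW (archi_boundP t0)) _.
  by rewrite -natrX ler_nat ltnW// ltn_expl.
have := dbl n t t0 tn; have := En_nonincreasing (lexx 0) t0; have := En_ge0 t.
have := sqr_ge0 (1 - t); rewrite -subr_ge0 => h1 h2 h3 h4.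
have : (1 + t) ^+ 2 * En t <= (2 + 2 * t ^+ 2) * En t.
  by apply: ler_wpM2r => //; rewrite -subr_ge0 (_ : _ - _ = (1 - t) ^+ 2) ?sqr_ge0//; ring.
by lra.
Qed.

End HaffUpperBound.


(** * Entropy *)

Section GainBound.
Variable R : realType.
Variables (e : R) (e0 : 0 < e) (e1 : e < 1).

Let k : R := (1 + e) / 2.

Let k01 : 0 < k < 1.
Proof. by rewrite /k; apply/andP; split; [rewrite divr_gt0// addr_gt0|rewrite ltr_pdivrMr//; have := e1; lra]. Qed.

(** For fixed w and n the map v -> v' has Jacobian 1 - k, and it multiplies (v - w).n by 1 - k as
    well; the Jacobian and the kernel contribute one factor each. *)
Lemma gain_change_of_variables (a b : vec R -> R) : nnm a -> nnm b ->
  (((1 - k) ^+ 2)%:E *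
   \int[mX R]_z (ker z * (b (post1 e z.1.1 z.1.2 (ndir z)) * a z.1.2))%:E =
   coll b a (fun=> 1%R))%E.
Proof.
move=> ma mb; have k10 : 0 < 1 - k by have /andP[] := k01; lra.
have m1 : nnm ((fun=> 1) : collisions R -> R) by exact: nnm_cst.
have mG : nnm (fun z : collisions R => ker z * (b (post1 e z.1.1 z.1.2 (ndir z)) * a z.1.2)).
  apply: nnmM; first exact: nnm_ker.
  by apply: nnmM; [exact: (nnm_comp mb (measurable_post1 e))|exact: (nnm_comp ma (@measurable_zw R))].
rewrite -nintZ ?sqr_ge0//.
have mG2 : nnm (fun z : collisions R => (1 - k) ^+ 2 * (ker z * (b (post1 e z.1.1 z.1.2 (ndir z)) * a z.1.2))).
  by apply: nnmZ => //; exact: sqr_ge0.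
rewrite /coll (mX_velocities mG2) (mX_velocities (nnm_coll mb ma m1)).
apply: eq_integral => q _; apply: eq_integral => w _.
pose n := sph q.1 q.2.
pose F v := `|dot (v - w) n| * b v.
have mF : nnm F.
  apply: nnmM => //; apply: nnm_norm; apply: measurable_dot => //.
  exact: measurable_vecB.
have c0 : 0 <= wsph q * a w by apply: mulr_ge0; [exact: nnm_ge0 (nnm_wsph R)|exact: nnm_ge0].
have n1 : dot n n = 1 by exact: dot_sph.
have mR : measurable_fun setT (fun v : mvec R => v - (k * dot (v - w) n) *: n : vec R).
  apply: measurable_vecB => //; apply: measurable_vecZ => //.
  by apply: measurable_funM => //; apply: measurable_dot => //; exact: measurable_vecB.
transitivity ((wsph q * a w)%:E * ((1 - k)%:E * \int[leb3]_v (F (v - (k * dot (v - w) n) *: n))%:E))%E.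
  have mFR := nnm_comp mF mR.
  rewrite -(nintZ leb3 (ltW k10) mFR) -(nintZ leb3 c0 (nnmZ (ltW k10) mFR)).
  apply: eq_integral => v _; congr EFin.
  rewrite /ker /ndir /post1 /= -/n -/k /F.
  have -> : dot (v - (k * dot (v - w) n) *: n - w) n = (1 - k) * dot (v - w) n.
    by rewrite !dotBl dotZl n1; ring.
  by rewrite normrM (ger0_norm (ltW k10)); ring.
rewrite (nint_reflect w n1 k01 mF) -(nintZ leb3 c0 mF).
by apply: eq_integral => v _; congr EFin; rewrite /ker /ndir /= -/n /F; ring.
Qed.

Lemma coll1_le (a b : vec R -> R) : nnm a -> nnm b ->
  (coll a b (fun=> 1%R) <= 2%:E * (moment a (@enorm R) * moment b (fun=> 1%R)
    + moment a (fun=> 1%R) * moment b (@enorm R)))%E.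
Proof.
move=> ma mb; have me := @nnm_enorm R.
have m1 : nnm ((fun=> 1) : vec R -> R) by exact: nnm_cst.
have m1' : nnm ((fun=> 1) : collisions R -> R) by exact: nnm_cst.
rewrite ge0_muleDr; [|by apply: mule_ge0; exact: moment_ge0|by apply: mule_ge0; exact: moment_ge0].
rewrite -csphE -(mX_prod (nnm_wsph R) (nnmM ma me) (nnmM mb m1)) -(mX_prod (nnm_wsph R) (nnmM ma m1) (nnmM mb me)).
have nn (f h : vec R -> R) : nnm f -> nnm h -> nnm (fun z : collisions R => wsph z.2 * (f z.1.1 * h z.1.2)).
  move=> mf mh; apply: nnmM; first exact: (nnm_comp (nnm_wsph R) (@measurable_zq R)).
  by apply: nnmM; [exact: (nnm_comp mf (@measurable_zv R))|exact: (nnm_comp mh (@measurable_zw R))].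
have n1 := nn _ _ (nnmM ma me) (nnmM mb m1); have n2 := nn _ _ (nnmM ma m1) (nnmM mb me).
rewrite -(nintD _ n1 n2); apply: nint_le; [exact: nnm_coll|exact: nnmD n1 n2|move=> z].
rewrite mulr1 [leRHS](_ : _ = wsph z.2 * (enorm z.1.1 + enorm z.1.2) * (a z.1.1 * b z.1.2)); last by ring.
by apply: ler_wpM2r; [apply: mulr_ge0; exact: nnm_ge0|exact: ker_le].
Qed.

End GainBound.


Section TruncatedEntropy.
Variables (R : realType) (N : R).
Hypothesis N0 : 0 <= N.
Implicit Types x y m : R.

Definition eta y : R := Num.min (Num.max (ln y) 0) N.

(* The integral of [eta] from 1 to [y]. *)
Definition beta y : R := y * eta y - expR (eta y) + 1.

Lemma eta_ge0 y : 0 <= eta y.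
Proof. by rewrite le_min N0 le_max lexx orbT. Qed.

Lemma eta_le y : eta y <= N.
Proof. by rewrite ge_min lexx orbT. Qed.

Lemma ln_le_subr1 x : 0 < x -> ln x <= x - 1.
Proof. by move=> x0; have := @le_ln1Dx R (x - 1); rewrite (addrC 1) subrK; apply; lra. Qed.

Lemma eta_small y : y <= 1 -> eta y = 0.
Proof. by move=> y1; rewrite /eta max_r ?ln_le0// min_l. Qed.

Lemma eta_le_ln y : 1 <= y -> eta y <= ln y.
Proof. by move=> y1; rewrite ge_min ge_max lexx ln_ge0. Qed.

Lemma eta_lt y : 1 <= y -> eta y < N -> eta y = ln y.
Proof.
move=> y1; rewrite /eta max_l ?ln_ge0//; have [//|h] := leP (ln y) N.
by rewrite ltxx.
Qed.

Lemma ln_sub_le x y : 0 < x -> 0 < y -> x * (ln y - ln x) <= y - x.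
Proof.
move=> x0 y0; rewrite -ln_div ?posrE// -ler_pdivlMl// (le_trans (ln_le_subr1 _)) ?divr_gt0//.
by rewrite mulrBr mulVf ?gt_eqF// mulrC.
Qed.

Lemma eta_gt x y : eta x < eta y -> [/\ 1 < y, x < y & x <= 1 \/ eta x = ln x].
Proof.
move=> xy.
have y1 : 1 < y by rewrite ltNge; apply/negP => /eta_small y0; move: xy; rewrite y0 ltNge eta_ge0.
have [x1|x1] := leP x 1; first by split=> //; [exact: le_lt_trans y1|left].
have ex : eta x = ln x by apply: eta_lt (ltW x1) (lt_le_trans xy (eta_le y)).
split=> //; last by right.
rewrite -ltr_ln ?posrE ?(lt_trans ltr01)// -ex.
exact: lt_le_trans xy (eta_le_ln (ltW y1)).
Qed.

(** The truncated version of x ln y <= x ln x + y, that is, of ln (y/x) <= y/x - 1. The truncations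
    matter only where they help: if eta y exceeds eta x, then eta x is ln x or x is at most 1. *)
Lemma mul_eta_le x y : 0 <= x -> 0 <= y -> x * eta y <= x * eta x + y.
Proof.
move=> x0 y0; have [h|h] := leP (eta y) (eta x).
  by apply: (le_trans (ler_wpM2l x0 h)); rewrite lerDl.
have [y1 xy [x1|ex]] := eta_gt h.
  apply: (@le_trans _ _ (1 * ln y)).
    by apply: ler_pM => //; [exact: eta_ge0|exact: eta_le_ln (ltW y1)].
  rewrite mul1r (le_trans (ln_le_subr1 (lt_trans ltr01 y1)))//.
  by have : 0 <= x * eta x; [exact: mulr_ge0 x0 (eta_ge0 x)|lra].
have [x1|x1] := leP x 0.
  have -> : x = 0 by apply/le_anti; rewrite x1.
  by rewrite !mul0r add0r.
have := ler_wpM2l x0 (eta_le_ln (ltW y1)); have := ln_sub_le x1 (lt_trans ltr01 y1).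
by rewrite ex mulrBr; lra.
Qed.

Let K : R := 2 * expR N + 2 * N.

(** If eta x exceeds eta y, then y <= exp N, and eta increases with slope at most 1. For x <= 2 exp
    N this gives the first part of K; for larger x one has x <= 2 (x - y), and the bound N of eta
    gives the second. *)
Lemma eta_lip x y : 0 <= x -> 0 <= y -> x * eta x <= x * eta y + K * `|x - y|.
Proof.
move=> x0 y0; have e1 : 1 <= expR N by rewrite -expR0 ler_expR.
have K0 : 0 <= K by rewrite /K; have := N0; lra.
have [h|h] := leP (eta x) (eta y).
  by apply: (le_trans (ler_wpM2l x0 h)); rewrite lerDl mulr_ge0.
have [x1 yx hy] := eta_gt h.
have xp : 0 < x := lt_trans ltr01 x1.
rewrite ger0_norm ?subr_ge0 ?(ltW yx)//.
have yN : y <= expR N.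
  case: hy => [y1|ey]; first exact: le_trans e1.
  have [y1|y1] := leP y 1; first exact: le_trans e1.
  by rewrite -ler_ln ?posrE ?expR_gt0 ?(lt_trans ltr01)// expRK -ey eta_le.
have lip : eta x - eta y <= x - y.
  have ex := eta_le_ln (ltW x1).
  have lx := ln_le_subr1 xp; have y00 := eta_ge0 y.
  have [y1|y1] := leP y 1; first lra.
  case: hy => [|ey]; first by rewrite leNgt y1.
  have yp : 0 < y := lt_trans ltr01 y1.
  have := ln_sub_le yp xp; rewrite -ey => H.
  have : y * (eta x - eta y) <= x - y by apply: le_trans H; apply: ler_wpM2l => //; lra.
  have : 0 <= (y - 1) * (eta x - eta y) by apply: mulr_ge0; lra.
  lra.
have [xs|xs] := leP x (2 * expR N).
  have : x * (eta x - eta y) <= 2 * expR N * (x - y) by apply: ler_pM => //; lra.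
  have : 0 <= 2 * N * (x - y) by rewrite mulr_ge0 ?mulr_ge0//; lra.
  by rewrite /K; lra.
have : x * (eta x - eta y) <= x * N.
  by apply: ler_wpM2l => //; have := eta_le x; have := eta_ge0 y; lra.
have : N * x <= N * (2 * (x - y)) by apply: ler_wpM2l => //; lra.
have : 0 <= 2 * expR N * (x - y) by rewrite mulr_ge0 ?mulr_ge0//; lra.
by rewrite /K; lra.
Qed.

(* [eta x] maximises [m |-> x * m - exp m] over [[0, N]], so that [beta] is a
   supremum of affine functions. *)
Lemma beta_ge x m : 0 <= x -> 0 <= m -> m <= N -> x * m - expR m + 1 <= beta x.
Proof.
move=> x0 m0 mN; rewrite /beta lerD2r.
have T : expR (eta x) * (1 + (m - eta x)) <= expR m.
  have -> : expR m = expR (eta x) * expR (m - eta x) by rewrite -expRD addrC subrK.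
  by rewrite ler_wpM2l ?expR_ge0// expR_ge1Dx.
suff : 0 <= (expR (eta x) - x) * (m - eta x) by lra.
have [x1|x1] := leP x 1.
  by rewrite eta_small// expR0 subr0 mulr_ge0// subr_ge0.
have [h|h] := leP N (eta x).
  have -> : eta x = N by apply/le_anti; rewrite h eta_le.
  rewrite mulr_le0// ?subr_le0//.
  rewrite -ler_ln ?posrE ?expR_gt0 ?(lt_trans ltr01)// expRK.
  exact: le_trans h (eta_le_ln (ltW x1)).
by rewrite eta_lt ?(ltW x1)// lnK ?posrE ?(lt_trans ltr01)// subrr mul0r.
Qed.

Lemma beta_ge0 x : 0 <= x -> 0 <= beta x.
Proof. by move=> x0; have := beta_ge x0 (lexx 0) N0; rewrite mulr0 expR0 sub0r addNr. Qed.

(** The supporting line of [beta] at y, from [beta_ge] with m = eta y, written without subtraction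
    so that it can be integrated term by term. *)
Lemma beta_convex x y : 0 <= x -> beta y + eta y * x <= beta x + eta y * y.
Proof.
by move=> x0; have := beta_ge x0 (eta_ge0 y) (eta_le y); rewrite /beta; lra.
Qed.

Lemma beta_le x : beta x <= x * eta x.
Proof. by rewrite /beta; have := expR_ge1Dx (eta x); have := eta_ge0 x; lra. Qed.

Lemma measurable_eta : measurable_fun setT eta.
Proof.
by apply: measurable_minr => //; apply: measurable_maxr.
Qed.

Lemma measurable_beta : measurable_fun setT beta.
Proof.
apply: measurable_funD => //; apply: measurable_funB.
  by apply: measurable_funM => //; exact: measurable_eta.
by apply: measurableT_comp => //; exact: measurable_eta.
Qed.

End TruncatedEntropy.


Lemma production_ge0 (R : realType) (K D E l q : R) : 0 <= K -> 0 <= D -> 0 <= E ->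
  0 <= l -> 0 <= q -> 0 <= 2 * (K * (2 * (D * (1 + E))) + 4 * l / q ^+ 2).
Proof.
move=> K0 D0 E0 l0 q0; rewrite mulr_ge0// addr_ge0//.
  by rewrite mulr_ge0// mulr_ge0// mulr_ge0// addr_ge0.
by rewrite divr_ge0 ?sqr_ge0// mulr_ge0.
Qed.

Lemma production_le (R : realType) (K D D' E E' : R) q : 0 <= K -> 0 <= D -> 0 <= E ->
  D <= D' -> E <= E' ->
  2 * (K * (2 * (D * (1 + E))) + 4 * q) <= 2 * (K * (2 * (D' * (1 + E'))) + 4 * q).
Proof.
move=> K0 D0 E0 DD EE; rewrite ler_wpM2l// lerD2r ler_wpM2l// ler_wpM2l//.
by apply: ler_pM => //; [rewrite addr_ge0|rewrite lerD2l].
Qed.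

Lemma balance_le (R : realType) (x y L G : \bar R) (c : R) : x \is a fin_num ->
  y \is a fin_num -> L \is a fin_num ->
  (x + L = y + G -> G <= L + c%:E -> (fine x <= fine y + c)%R)%E.
Proof.
move=> fx fy fL; rewrite -(fineK fx) -(fineK fy) -(fineK fL).
by case: G => [G||]; rewrite -!EFinD//= lee_fin => -[]; lra.
Qed.

Lemma le_add_transfer (R : realType) (a b x y z : R) :
  a <= b + z -> x + b <= y + a -> x <= y + z.
Proof. lra. Qed.

Lemma eq_lee (R : realType) (x y : \bar R) : x = y -> (x <= y)%E.
Proof. by move=> ->. Qed.

Lemma fine_leD (R : realType) (x y z w : \bar R) : x \is a fin_num ->
  y \is a fin_num -> z \is a fin_num -> w \is a fin_num ->
  (x + y <= z + w -> (fine x + fine y <= fine z + fine w)%R)%E.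
Proof.
move=> fx fy fz fw; rewrite -(fineK fx) -(fineK fy) -(fineK fz) -(fineK fw).
by rewrite -!EFinD lee_fin.
Qed.

Section EntropyProduction.
Variable R : realType.
Local Notation leb := (@lebesgue_measure R).
Variables (e : R) (g : R -> vec R -> R).
Hypotheses (e0 : 0 < e) (e1 : e < 1) (gP : kflow e g) (gN : normalized g).
Variables (N : R) (N0 : 0 <= N).

Let ng := kf_nnm gP.
Let gi := kf_mom gP.
Let k : R := (1 + e) / 2.
Let K : R := 2 * expR N + 2 * N.

Let K0 : 0 <= K. Proof. by rewrite /K addr_ge0 ?mulr_ge0 ?expR_ge0. Qed.

Let k1 : 0 < 1 - k.
Proof. by rewrite /k subr_gt0 ltr_pdivrMr//; have := e1; lra. Qed.

Let g0 t v : 0 <= g t v. Proof. exact: nnm_ge0 (ng t). Qed.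

Let m1 : nnm ((fun=> 1) : vec R -> R). Proof. exact: nnm_cst. Qed.

(** |v| <= |v|^2/(2l) + l/2. A positive l with E <= l^2, in place of sqrt(E), avoids dividing by
    zero. *)
Lemma abs_moment_le (r l : R) : 0 <= r -> 0 < l -> En g r <= l ^+ 2 ->
  (moment (g r) (@enorm R) <= l%:E)%E.
Proof.
move=> r0 l0 El; have ms := @nnm_sqn R; have ni : 0 <= (2 * l)^-1 by rewrite invr_ge0 mulr_ge0// ltW.
have h0 : 0 <= l / 2 by rewrite divr_ge0// ltW.
have mb : nnm (fun v => (2 * l)^-1 * @sqn R v + l / 2 * 1).
  by apply: nnmD; apply: nnmZ.
apply: (@le_trans _ _ (moment (g r) (fun v => (2 * l)^-1 * @sqn R v + l / 2 * 1))).
  apply: le_moment => //; first exact: nnm_enorm.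
  move=> v; rewrite -subr_ge0 /sqn.
  rewrite (_ : _ - _ = (2 * l)^-1 * (enorm v - l) ^+ 2); last by field; rewrite gt_eqF.
  by rewrite mulr_ge0 ?sqr_ge0.
rewrite momentD//; [|exact: nnmZ|exact: nnmZ].
rewrite (momentZ ni (ng r) ms) (momentZ h0 (ng r) m1) (massE gP gN r0) mule1.
rewrite -(fineK (En_fin gP r)) -EFinM -EFinD lee_fin -/(En g r).
have : (2 * l)^-1 * En g r <= (2 * l)^-1 * l ^+ 2 by apply: ler_wpM2l.
have -> : (2 * l)^-1 * l ^+ 2 = l / 2 by field; rewrite gt_eqF.
lra.
Qed.

Let h (t : R) (v : vec R) : R := eta N (g t v).

Let mh t : nnm (h t).
Proof.
split=> [|v]; last exact: eta_ge0.
by apply: measurableT_comp; [exact: measurable_eta|exact: nnm_meas].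
Qed.

Lemma mom2E (r : R) : 0 <= r -> mom2 (g r) = (1 + En g r)%:E.
Proof.
move=> r0; rewrite -[mom2 _]/(moment (g r) (fun v => 1 + @sqn R v)) momentD//; last exact: nnm_sqn.
by rewrite (massE gP gN r0) -(fineK (En_fin gP r)) -EFinD.
Qed.

(** Exchanging the two particles turns the second velocity after the collision into the first, since
    the displacement is odd in u. *)
Lemma gain_collE r t : gain e g r (h t) =
  (2%:E * coll (g r) (g r) (fun z => h t (post1 e z.1.1 z.1.2 (ndir z))))%E.
Proof.
rewrite /gain.
have -> : coll (g r) (g r) (fun z => h t (post2 e z.1.1 z.1.2 (ndir z))) =
    coll (g r) (g r) (fun z => h t (post1 e z.1.1 z.1.2 (ndir z))).
  rewrite (coll_swap (ng r) (nnm_comp (mh t) (measurable_post2 e))).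
  apply: eq_coll => z; congr (h t _); rewrite /post1 /post2 /ndir /=.
  by rewrite -opprB dotNl mulrN scaleNr.
by rewrite -[X in (X + X)%E]mul1e -ge0_muleDl// -EFinD.
Qed.

Lemma loss_collE r t : loss g r (h t) = (2%:E * coll (g r) (g r) (fun z => h t z.1.1))%E.
Proof.
rewrite /loss.
have -> : coll (g r) (g r) (fun z => h t z.1.2) = coll (g r) (g r) (fun z => h t z.1.1).
  by rewrite (coll_swap (ng r) (nnm_comp (mh t) (@measurable_zw R))).
by rewrite -[X in (X + X)%E]mul1e -ge0_muleDl// -EFinD.
Qed.

(** At a collision, [mul_eta_le] replaces the logarithm at v' by that of [g r] at v, at the cost of
    [g t] at v'; [eta_lip] then replaces [g r] by [g t] under the logarithm, at the cost K times
    their difference. The first cost integrates to at most 4 l / (1 - k)^2 by the change of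
    variables, whatever N is; the second depends on N but tends to 0 with [dist2 g r t]. *)
Lemma gain_le_loss (r t l : R) : 0 <= r -> 0 <= t -> 0 < l -> En g r <= l ^+ 2 -> En g t <= l ^+ 2 ->
  (gain e g r (h t) <= loss g r (h t) +
     (2 * (K * (2 * (dist2 g r t * (1 + En g r))) + 4 * l / (1 - k) ^+ 2))%:E)%E.
Proof.
move=> r0 t0 l0 Er Et.
rewrite gain_collE loss_collE EFinM -ge0_muleDr; last 2 first.
- by apply: nint_ge0 => z; exact: nnm_ge0 (nnm_coll (ng r) (ng r) (nnm_comp (mh t) (@measurable_zv R))).
- rewrite lee_fin -(pmulr_rge0 _ (ltr0n _ 2)).
  exact: (production_ge0 K0 (dist2_ge0 gP r t) (En_ge0 gP r) (ltW l0) (ltW k1)).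
apply: lee_wpmul2l => //; rewrite EFinD.
have md := nnm_dist (ng r) (ng t).
have mc1 : nnm ((fun=> 1) : collisions R -> R) by exact: nnm_cst.
pose I := (\int[mX R]_z (ker z * (g t (post1 e z.1.1 z.1.2 (ndir z)) * g r z.1.2))%:E)%E.
have IB : (I <= (4 * l / (1 - k) ^+ 2)%:E)%E.
  have CV := gain_change_of_variables e0 e1 (ng r) (ng t).
  have q0 : 0 < (1 - k) ^+ 2 by rewrite exprn_gt0.
  have q0e : (0 < ((1 - k) ^+ 2)%:E)%E by rewrite lte_fin.
  rewrite -(lee_pmul2l _ q0e)//.
  rewrite /I CV -EFinM mulrC divfK ?gt_eqF//.
  apply: le_trans (coll1_le (ng t) (ng r)) _.
  rewrite (massE gP gN r0) (massE gP gN t0) mule1 mul1e.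
  rewrite (_ : 4 * l = 2 * (l + l)); last by ring.
  rewrite (EFinM 2) (EFinD l l); apply: lee_wpmul2l => //.
  by apply: leeD; exact: abs_moment_le.
have DB : (coll (fun v => `|g r v - g t v|)%R (g r) (fun=> 1%R) <= (2 * (dist2 g r t * (1 + En g r)))%:E)%E.
  apply: le_trans (@coll_le_mom2 _ _ _ _ 1 md (ng r) mc1 (fun z => lexx _)) _.
  by rewrite mul1e csphE (mom2E r0) -(fineK (dist2_fin gP r t)) -!EFinM.
apply: (@le_trans _ _ (coll (g r) (g r) (fun z => h t z.1.1) +
   (K%:E * coll (fun v => `|g r v - g t v|)%R (g r) (fun=> 1%R) + I))%E); last first.
  apply: leeD => //; apply: leeD => //; rewrite EFinM; apply: lee_wpmul2l => //.
have ncd : nnm (fun z : collisions R => ker z * (`|g r z.1.1 - g t z.1.1| * g r z.1.2) * 1).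
  exact: (nnm_coll md (ng r) mc1).
have nI : nnm (fun z : collisions R => ker z * (g t (post1 e z.1.1 z.1.2 (ndir z)) * g r z.1.2)).
  apply: nnmM; first exact: nnm_ker.
  by apply: nnmM; [exact: (nnm_comp (ng t) (measurable_post1 e))|exact: (nnm_comp (ng r) (@measurable_zw R))].
have nv := nnm_coll (ng r) (ng r) (nnm_comp (mh t) (@measurable_zv R)).
have np := nnm_coll (ng r) (ng r) (nnm_comp (mh t) (measurable_post1 e)).
have nKd := nnmZ K0 ncd.
rewrite /I /coll -(nintZ _ K0 ncd) -(nintD _ nKd nI) -(nintD _ nv (nnmD nKd nI)).
apply: nint_le; [exact: np|exact: nnmD nv (nnmD nKd nI)|move=> z].
rewrite /=; set x := g r z.1.1; set y := g r z.1.2; set p := post1 _ _ _ _.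
have x0 : 0 <= x by exact: g0.
have y0 : 0 <= y by exact: g0.
have A := mul_eta_le N0 x0 (nnm_ge0 p (ng t)).
have B := eta_lip N0 x0 (nnm_ge0 z.1.1 (ng t)).
rewrite /h -/K in A B *.
rewrite (_ : _ + _ = ker z * y * (x * eta N (g t z.1.1) + K * `|x - g t z.1.1| + g t p)); last by ring.
rewrite (_ : ker z * (x * y) * _ = ker z * y * (x * eta N (g t p))); last by ring.
apply: ler_wpM2l; first by apply: mulr_ge0 => //; exact: nnm_ge0 (nnm_ker R).
by apply: (le_trans A); rewrite lerD2r.
Qed.

Definition Sent (t : R) : R := fine (\int[leb3]_v (beta N (g t v))%:E)%E.

Lemma nnm_beta t : nnm (fun v => beta N (g t v)).
Proof.
split=> [|v]; last by apply: beta_ge0.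
by apply: measurableT_comp; [exact: measurable_beta|exact: nnm_meas].
Qed.

Lemma Sent_fin (t : R) : (\int[leb3]_v (beta N (g t v))%:E)%E \is a fin_num.
Proof.
have mb := nnm_beta t; rewrite ge0_fin_numE; last by apply: nint_ge0 => v; exact: nnm_ge0 mb.
have mN : nnm ((fun=> N) : vec R -> R) by exact: nnm_cst.
have f : moment (g t) (fun=> N) \is a fin_num.
  by apply: (moment_fin (ng t) mN (gi t) (M := N)) => v; rewrite ler_peMr// weight2_ge1.
rewrite ge0_fin_numE ?(moment_ge0 (ng t) mN)// in f; apply: le_lt_trans f.
apply: nint_le; [exact: mb|exact: nnmM (ng t) mN|move=> v].
apply: (le_trans (beta_le N0 _)); apply: ler_wpM2l; first exact: g0.
exact: eta_le.
Qed.

(** The test function [eta N (g t)] is fixed on [s, t]. The supporting line of [beta N] at [g t v]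
    bounds the increment of the entropy by that of the moment of this function, which the balance
    and [gain_le_loss] control. *)
Lemma entropy_step (s t l D : R) : 0 <= s -> s < t -> 0 < l -> En g s <= l ^+ 2 ->
  (forall r, s <= r -> r <= t -> dist2 g r t <= D) ->
  Sent t <= Sent s + (2 * (K * (2 * (D * (1 + En g 0))) + 4 * l / (1 - k) ^+ 2)) * (t - s).
Proof.
move=> s0 st l0 El HD; have t0 := le_trans s0 (ltW st).
have hN v : h t v <= N by exact: eta_le.
have hN2 v : h t v <= N * weight2 v.
  by apply: le_trans (hN v) _; rewrite ler_peMr// weight2_ge1.
have B := balance gP (mh t) s0 st.
pose c := 2 * (K * (2 * (D * (1 + En g 0))) + 4 * l / (1 - k) ^+ 2).
have mst : measurable (`[s, t]%classic : set R) by exact: measurable_itv.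
have D0 : 0 <= D by apply: le_trans (HD t (ltW st) (lexx t)); exact: dist2_ge0 gP _ _.
have c0 : 0 <= c.
  exact: (production_ge0 K0 D0 (En_ge0 gP 0) (ltW l0) (ltW k1)).
have fL : (\int[leb]_(r in `[s, t]) loss g r (h t))%E \is a fin_num.
  have E : (\int[leb]_(r in `[s, t]) loss g r (h t) = \int[leb]_(r in `[s, t]) (fine (loss g r (h t)))%:E)%E.
    by apply: eq_integral => r _; rewrite (fineK (loss_fin gP r (mh t) hN)).
  by rewrite E; exact: continuous_itv_fin (loss_continuous gP (mh t) hN).
have GL : (\int[leb]_(r in `[s, t]) gain e g r (h t) <=
    \int[leb]_(r in `[s, t]) loss g r (h t) + (c * (t - s))%:E)%E.
  rewrite -(itv_integral_cst c st).
  have cc (r : R) : (0 <= (cst c%:E) r :> \bar R)%E by rewrite lee_fin.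
  have L0 r := loss_ge0 gP r (mh t).
  have mcst : measurable_fun (`[s, t]%classic : set R) (cst c%:E : R -> \bar R) by exact: measurable_cst.
  rewrite -(itv_integralD mst L0 cc (measurable_loss gP mst (mh t)) mcst).
  apply: ge0_le_integral.
  - exact: mst.
  - by move=> r _; exact: (gain_ge0 gP r (mh t)).
  - exact: (measurable_gain gP mst (mh t)).
  - exact: (emeasurable_funD (measurable_loss gP mst (mh t)) mcst).
  - move=> r; rewrite /= in_itv/= => /andP[sr rt].
    have r0 := le_trans s0 sr.
    have Er : En g r <= l ^+ 2 by apply: le_trans El; exact: (En_nonincreasing e0 e1 gP gN).
    have Et : En g t <= l ^+ 2 by apply: le_trans El; exact: (En_nonincreasing e0 e1 gP gN s0 (ltW st)).
    have E0r := En_nonincreasing e0 e1 gP gN (lexx 0) r0.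
    have P := production_le (l / (1 - k) ^+ 2) K0 (dist2_ge0 gP r t) (En_ge0 gP r) (HD r sr rt) E0r.
    have Pe : ((2 * (K * (2 * (dist2 g r t * (1 + En g r))) + 4 * l / (1 - k) ^+ 2))%:E <= c%:E)%E.
      by rewrite lee_fin /c -![4 * l / _]mulrA; exact: P.
    exact: (le_trans (gain_le_loss r0 t0 l0 Er Et) (leeD (lexx _) Pe)).
have step1 : fine (moment (g t) (h t)) <= fine (moment (g s) (h t)) + c * (t - s).
  exact: (balance_le (moment_fin (ng t) (mh t) (gi t) hN2)
    (moment_fin (ng s) (mh t) (gi s) hN2) fL B GL).
have step2 : Sent t + fine (moment (g s) (h t)) <= Sent s + fine (moment (g t) (h t)).
  apply: (fine_leD (Sent_fin t) (moment_fin (ng s) (mh t) (gi s) hN2)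
    (Sent_fin s) (moment_fin (ng t) (mh t) (gi t) hN2)).
  have n1 := nnmM (ng s) (mh t); have n2 := nnmM (ng t) (mh t).
  have D1 := nintD leb3 (nnm_beta t) n1; have D2 := nintD leb3 (nnm_beta s) n2.
  apply: (le_trans (eq_lee (esym D1))); apply: (le_trans _ (eq_lee D2)).
  apply: nint_le; [exact: nnmD (nnm_beta t) n1|exact: nnmD (nnm_beta s) n2|move=> v].
  by rewrite [g s v * _]mulrC [g t v * _]mulrC; apply: beta_convex.
exact: le_add_transfer step1 step2.
Qed.

End EntropyProduction.


(** * The lower bound *)

Section LocalToGlobal.
Variable R : realType.

(** Continuous induction. Let c be the supremum of the points up to which phi has grown by at most
    eps per unit of time. A point of the set just below c, paired with T or with a point beyond c
    inside the same neighbourhood, shows that T itself is reached. *)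
Lemma local_growth (phi : R -> R) (T : R) : 0 <= T ->
  (forall eps, 0 < eps -> forall tau, 0 <= tau -> exists2 d, 0 < d &
     forall s t, 0 <= s -> s < t -> `|s - tau| < d -> `|t - tau| < d ->
       phi t <= phi s + eps * (t - s)) ->
  phi T <= phi 0.
Proof.
move=> T0 H; apply/ler_addgt0Pr => eta0 eta0_gt0.
have T1 : 0 < T + 1 by lra.
(* The slope is chosen so that the total growth over [0, T] stays below eta0; T + 1 is positive also
   for T = 0. *)
pose eps := eta0 / (T + 1); have eps0 : 0 < eps by rewrite divr_gt0.
pose A := [set x : R | [/\ 0 <= x, x <= T & phi x <= phi 0 + eps * x]].
have A0 : A 0 by split=> //; rewrite mulr0 addr0.
have ubA : ubound A T by move=> x [].
have supA : has_sup A by split; [exists 0|exists T].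
pose c := sup A.
have cT : c <= T by apply: ge_sup => //; exists 0.
have c0 : 0 <= c by apply: ub_le_sup => //; exists T.
have [d d0 Hd] := H eps eps0 c c0.
have [x [x0 xT xA] cx] := sup_adherent d0 supA.
have xc : x <= c by apply: ub_le_sup; [exists T|].
suff AT : phi T <= phi 0 + eps * T.
  apply: (le_trans AT); rewrite lerD2l /eps mulrAC ler_pdivrMr//.
  by rewrite ler_wpM2l ?(ltW eta0_gt0)//; lra.
have [->//|xT'] := eqVneq T x.
have xT2 : x < T by rewrite lt_neqAle eq_sym xT' xT.
have dx : `|x - c| < d by rewrite distrC ger0_norm ?subr_ge0// ltrBlDr -ltrBlDl.
have [Td|Td] := ltP T (c + d).
  have dT : `|T - c| < d by rewrite ger0_norm ?subr_ge0//; lra.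
  by have := Hd x T x0 xT2 dx dT; lra.
have dd : `|c + d / 2 - c| < d by rewrite addrAC subrr add0r ger0_norm; lra.
have xcd : x < c + d / 2 by lra.
have : c + d / 2 <= c.
  apply: ub_le_sup; first by exists T.
  by split; [lra|lra|have := Hd x _ x0 xcd dx dd; lra].
lra.
Qed.

End LocalToGlobal.

Section RealArithmetic.
Variable R : realType.

Lemma growth_transfer (G a b c d : R) : d = 0 -> a - G * b <= c - G * d -> a <= c + G * b.
Proof. by move=> ->; rewrite mulr0 subr0 lerBlDr. Qed.

Lemma dist_lower (x y d : R) : `|x - y| < d -> y - d <= x.
Proof. by rewrite ltr_norml => /andP[h _]; lra. Qed.

Lemma half_fraction (a eps : R) : 0 <= a -> 0 < eps -> a * (eps / (2 * a + 1)) <= eps / 2.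
Proof.
move=> a0 e0; rewrite mulrA ler_pdivrMr; last lra.
have -> : eps / 2 * (2 * a + 1) = a * eps + eps / 2 by field.
lra.
Qed.

Lemma between_dist (r s t tau d : R) : `|s - tau| < d -> `|t - tau| < d ->
  s <= r -> r <= t -> `|r - tau| < d.
Proof.
by rewrite !ltr_norml => /andP[a1 a2] /andP[b1 b2] sr rt; apply/andP; split; lra.
Qed.

Lemma local_growth_arith (S S' Y Y' r r' A G x D ep : R) :
  S <= S' + (A + G * (r' + x)) * D -> Y' + r * D <= Y -> r' - x <= r ->
  A <= ep / 2 -> G * (2 * x) = ep / 2 -> 0 <= G -> 0 <= D ->
  S - G * Y <= S' - G * Y' + ep * D.
Proof.
move=> ES YL ht AX GX G0 D0.
have h1 : G * (Y' + r * D) <= G * Y by rewrite ler_wpM2l.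
have h2 : G * (r' - x) * D <= G * r * D by rewrite ler_wpM2r// ler_wpM2l.
have h3 : A * D <= ep / 2 * D by rewrite ler_wpM2r.
have h4 : G * (2 * x) * D = ep / 2 * D by rewrite GX.
lra.
Qed.

End RealArithmetic.

Section EntropyGrowth.
Variable R : realType.
Local Notation leb := (@lebesgue_measure R).
Variables (e : R) (g : R -> vec R -> R).
Hypotheses (e0 : 0 < e) (e1 : e < 1) (gP : kflow e g) (gN : normalized g).

Let ng := kf_nnm gP.

Definition rootE (r : R) : R := Num.sqrt (En g r).

Lemma rootE_ge0 r : 0 <= rootE r. Proof. exact: sqrtr_ge0. Qed.

Lemma rootE_sqr r : rootE r ^+ 2 = En g r.
Proof. by apply: sqr_sqrtr; exact: (En_ge0 gP). Qed.

Lemma rootE_continuous : continuous rootE.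
Proof.
move=> r; apply: (@continuous_comp _ _ _ (En g) Num.sqrt); last exact: sqrt_continuous.
exact: (En_continuous gP).
Qed.

Lemma rootE_nonincreasing (s t : R) : 0 <= s -> s <= t -> rootE t <= rootE s.
Proof. by move=> s0 st; apply: ler_wsqrtr; exact: (En_nonincreasing e0 e1 gP gN). Qed.

Definition Yint (t : R) : R := \int[leb]_(s in `[0, t]) rootE s.

Lemma rootE_integrable (s t : R) : leb.-integrable `[s, t] (EFin \o rootE).
Proof. exact: continuous_itv_integrable rootE_continuous. Qed.

(** From monotonicity of [rootE]. The two inequalities stand in for Y' = sqrt(E) in what follows. *)
Lemma Yint_bounds (s t : R) : 0 <= s -> s < t ->
  Yint s + rootE t * (t - s) <= Yint t <= Yint s + rootE s * (t - s).
Proof.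
move=> s0 st; have t0 := le_trans s0 (ltW st).
have D : Yint t - Yint s = \int[leb]_(r in `]s, t]) rootE r.
  apply: Rintegral_itvB; first exact: rootE_integrable.
    by rewrite bnd_simp.
  by rewrite bnd_simp ltW.
have mst : measurable (`]s, t]%classic : set R) by exact: measurable_itv.
have sub2 : `]s, t]%classic `<=` `[s, t]%classic.
  by move=> x /=; rewrite !in_itv/= => /andP[/ltW -> ->].
have icont (phi : R -> R) : continuous phi -> leb.-integrable `]s, t]%classic (EFin \o phi).
  move=> cphi; apply: (@integrableS _ _ _ leb `[s, t]%classic).
  - exact: measurable_itv.
  - exact: mst.
  - exact: sub2.
  - exact: continuous_itv_integrable.
have ist := icont _ rootE_continuous.
have icst (c : R) : leb.-integrable `]s, t]%classic (EFin \o cst c).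
  by apply: icont; exact: cst_continuous.
have Ecst (c : R) : \int[leb]_(r in `]s, t]) cst c r = c * (t - s).
  by rewrite Rintegral_cst//= lebesgue_measure_itv/= lte_fin st.
apply/andP; split.
  rewrite -lerBrDl D -Ecst; apply: le_Rintegral => // r; rewrite /= in_itv/= => /andP[sr rt].
  exact: rootE_nonincreasing (le_trans s0 (ltW sr)) rt.
rewrite -lerBlDl D -Ecst; apply: le_Rintegral => // r; rewrite /= in_itv/= => /andP[sr rt].
exact: rootE_nonincreasing s0 (ltW sr).
Qed.

Lemma Yint0 : Yint 0 = 0.
Proof. by rewrite /Yint set_itv1 Rintegral_set1. Qed.

Lemma dist2_triangle (r t tau : R) : dist2 g r t <= dist2 g r tau + dist2 g t tau.
Proof.
have f1 := dist2_fin gP r t; have f2 := dist2_fin gP r tau; have f3 := dist2_fin gP t tau.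
rewrite -lee_fin EFinD /dist2 (fineK f1) (fineK f2) (fineK f3).
have mw := nnm_weight2 R.
have n1 := nnmM (nnm_dist (ng r) (ng t)) mw.
have n2 := nnmM (nnm_dist (ng r) (ng tau)) mw.
have n3 := nnmM (nnm_dist (ng t) (ng tau)) mw.
apply: (le_trans _ (eq_lee (nintD leb3 n2 n3))).
apply: nint_le; [exact: n1|exact: nnmD n2 n3|move=> v].
rewrite -mulrDl; apply: ler_wpM2r; first exact: nnm_ge0 mw.
by rewrite [X in _ <= _ + X]distrC; exact: ler_distD.
Qed.

Variables (N : R) (N0 : 0 <= N).

(** A factor 2 for the two velocities after a collision, 4 from the collision frequency with first
    moments at most l, and (1 - k)^-2 from the change of variables. *)
Definition growth : R := 8 / (1 - (1 + e) / 2) ^+ 2.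

Lemma growth_gt0 : 0 < growth.
Proof.
rewrite divr_gt0// exprn_gt0// subr_gt0 ltr_pdivrMr//; have := e1; lra.
Qed.

Lemma cvg_ball (phi : R -> R) (tau l eps : R) : phi x @[x --> tau] --> l -> 0 < eps ->
  exists2 d, 0 < d & forall x, `|x - tau| < d -> `|phi x - l| < eps.
Proof.
move=> /cvgrPdist_lt /(_ eps) H eps0.
have /nbhs_ballP[d /= d0 Hd] := H eps0.
by exists d => // x xd; rewrite distrC; apply: Hd; rewrite /ball/= distrC.
Qed.

(** With N fixed, the error of [entropy_step] that carries K is made small near each tau by
    continuity, and [local_growth] removes it. The resulting bound has no constant that depends on
    N. *)
Lemma entropy_growth (T : R) : 0 <= T -> Sent g N T <= Sent g N 0 + growth * Yint T.
Proof.
move=> T0.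
suff H : Sent g N T - growth * Yint T <= Sent g N 0 - growth * Yint 0.
  exact: growth_transfer Yint0 H.
pose K : R := 2 * expR N + 2 * N; pose A := 4 * (K * (1 + En g 0)).
have K0 : 0 <= K by rewrite /K addr_ge0 ?mulr_ge0 ?expR_ge0.
have A0 : 0 <= A.
  by rewrite mulr_ge0// mulr_ge0//; apply: addr_ge0; [exact: ler01|exact: (En_ge0 gP)].
have C0 := growth_gt0.
apply: (@local_growth R (fun t => Sent g N t - growth * Yint t)) => // eps eps0 tau tau0.
(* Near tau, sqrt(E) varies by at most 2 x1 between t and the bound l, and the distances are at most
   x2; each of the two errors costs at most eps/2. *)
pose x1 := eps / (4 * growth); pose x2 := eps / (2 * A + 1).
have x10 : 0 < x1 by rewrite divr_gt0// mulr_gt0.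
have B0 : 0 < 2 * A + 1 by apply: ltr_wpDl; [exact: mulr_ge0|exact: ltr01].
have x20 : 0 < x2 by exact: divr_gt0.
have [d1 d10 H1] := cvg_ball (@rootE_continuous tau) x10.
have x22 : 0 < x2 / 2 by exact: divr_gt0.
have [d2 d20 H2] := cvg_ball (dist2_cvg gP tau) x22.
exists (Num.min d1 d2); first by rewrite lt_min d10.
move=> s t s0 st; rewrite !lt_min => /andP[s1 s2] /andP[t1 t2].
pose l := rootE tau + x1.
have l0 : 0 < l by apply: ltr_wpDl; [exact: rootE_ge0|].
have El : En g s <= l ^+ 2.
  rewrite -rootE_sqr; have := H1 s s1; rewrite ltr_norml => /andP[_ h].
  have h2 : rootE s <= l by apply: ltW; rewrite -ltrBlDl.
  exact: (lerXn2r 2 (rootE_ge0 s) (ltW l0) h2).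
have HD r : s <= r -> r <= t -> dist2 g r t <= x2.
  move=> sr rt; apply: (le_trans (dist2_triangle r t tau)).
  have r2 := between_dist s2 t2 sr rt.
  have hr := le_lt_trans (ler_norm _) (H2 r r2); have ht := le_lt_trans (ler_norm _) (H2 t t2).
  rewrite !subr0 in hr ht; apply: ltW; apply: (lt_le_trans (ltrD hr ht)).
  by rewrite -splitr lexx.
have ES := entropy_step e0 e1 gP gN N0 s0 st l0 El HD.
have /andP[YL _] := Yint_bounds s0 st.
have ht : rootE tau - x1 <= rootE t.
  exact: dist_lower (H1 t t1).
have P : 2 * (K * (2 * (x2 * (1 + En g 0))) + 4 * l / (1 - (1 + e) / 2) ^+ 2) = A * x2 + growth * l.
  rewrite /A /growth; ring.
rewrite {}P in ES.
have Ax : A * x2 <= eps / 2.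
  exact: half_fraction A0 eps0.
have Gx : growth * (2 * x1) = eps / 2.
  by rewrite /x1; field; rewrite gt_eqF.
have ts : 0 <= t - s by rewrite subr_ge0 ltW.
exact: (local_growth_arith ES YL ht Ax Gx (ltW C0) ts).
Qed.

End EntropyGrowth.


Section ExponentialIntegral.
Variable R : realType.

(* The differential inequality [Y' >= a exp(-b Y)] makes [exp(b Y) - a b t] nondecreasing. *)
Lemma log_lower_bound (Y q : R -> R) (a b : R) : 0 < a -> 0 < b -> Y 0 = 0 ->
  (forall t, 0 <= t -> 0 <= q t <= q 0) ->
  (forall s t, 0 <= s -> s < t -> Y s + q t * (t - s) <= Y t <= Y s + q s * (t - s)) ->
  (forall t, 0 <= t -> a * expR (- (b * Y t)) <= q t) ->
  forall t, 0 <= t -> b^-1 * ln (1 + a * b * t) <= Y t.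
Proof.
move=> a0 b0 Y0 q0 HY Hq T T0.
have ab0 : 0 < a * b by exact: mulr_gt0.
suff H : a * b * T - expR (b * Y T) <= a * b * 0 - expR (b * Y 0).
  rewrite Y0 !mulr0 expR0 in H.
  have p0 : 0 < 1 + a * b * T by have := mulr_ge0 (ltW ab0) T0; lra.
  rewrite -(ler_pM2l b0) mulrA divff ?gt_eqF// mul1r -ler_expR lnK ?posrE//; lra.
apply: (@local_growth R (fun t => a * b * t - expR (b * Y t))) => // eps eps0 tau _.
pose M := q 0; have M0 : 0 <= M by have /andP[] := q0 0 (lexx 0).
(* With D = t - s, the increment of exp(b Y) is at least a b D exp(b (Y s - Y t)), hence at least a
   b D (1 - b M D): c is the coefficient of the error in D^2, absorbed for short intervals. *)
pose c := a * b * (b * M); have c0 : 0 <= c by exact: mulr_ge0 (ltW ab0) (mulr_ge0 (ltW b0) M0).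
exists (eps / (2 * (c + 1))); first by rewrite divr_gt0// mulr_gt0//; lra.
move=> s t s0 st hs ht.
have D0 : 0 < t - s by rewrite subr_gt0.
have DB : t - s <= eps / (c + 1).
  have E : eps / (c + 1) = eps / (2 * (c + 1)) + eps / (2 * (c + 1)).
    by field; rewrite gt_eqF//; lra.
  by move: hs ht; rewrite !ltr_norml => /andP[h1 h2] /andP[h3 h4]; rewrite E; lra.
have /andP[Y1 Y2] := HY s t s0 st; have t0 := le_trans s0 (ltW st).
have /andP[_ qs] := q0 s s0; have Q := Hq t t0.
set D := t - s in D0 DB Y1 Y2; set y := Y t in Q Y1 Y2 *; set y' := Y s in Y1 Y2 *.
have h1 : expR (b * y') * (1 + b * (y - y')) <= expR (b * y).
  have -> : expR (b * y) = expR (b * y') * expR (b * (y - y')) by rewrite -expRD; congr expR; ring.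
  by rewrite ler_wpM2l ?expR_ge0// expR_ge1Dx.
have h2 : a * expR (- (b * y)) * D <= y - y'.
  by have := ler_wpM2r (ltW D0) Q; lra.
have h3 : expR (b * y') * (b * (a * expR (- (b * y)) * D)) <= expR (b * y') * (b * (y - y')).
  by rewrite ler_wpM2l ?expR_ge0// ler_wpM2l// ltW.
have h4 : expR (b * y') * (b * (a * expR (- (b * y)) * D)) = a * b * D * expR (b * (y' - y)).
  by rewrite [b * (y' - y)]mulrBr expRD expRN; ring.
have h5 : a * b * D * (1 + b * (y' - y)) <= a * b * D * expR (b * (y' - y)).
  by rewrite ler_wpM2l ?expR_ge1Dx// mulr_ge0 ?ltW.
have h6 : y - y' <= M * D by have := ler_wpM2r (ltW D0) qs; rewrite -/M; lra.
have h7 : a * b * D * (1 - b * (M * D)) <= a * b * D * (1 + b * (y' - y)).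
  apply: ler_wpM2l; first exact: mulr_ge0 (ltW ab0) (ltW D0).
  by rewrite lerD2l -mulrN; apply: (ler_wpM2l (ltW b0)); lra.
have h8 : a * b * D * (1 - b * (M * D)) = a * b * D - c * D * D by rewrite /c; ring.
have h9 : c * D <= eps.
  apply: (@le_trans _ _ (c * (eps / (c + 1)))); first by rewrite ler_wpM2l.
  by rewrite mulrA ler_pdivrMr; [rewrite mulrC ler_wpM2l ?ltW//; lra|lra].
have h10 : c * D * D <= eps * D by apply: (ler_wpM2r (ltW D0)).
have h11 : expR (b * y') * (1 + b * (y - y')) = expR (b * y') + expR (b * y') * (b * (y - y')) by ring.
have h12 : a * b * t - a * b * s = a * b * D by rewrite /D; ring.
rewrite -/D; rewrite h11 in h1; rewrite h4 in h3; rewrite h8 in h7.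
have := le_trans h7 (le_trans h5 h3).
move: h1 h10 h12; move: (c * D * D) (eps * D) (a * b * D) (expR _ * (b * _)) => x4 x5 x6 x1.
move: (expR _) (expR _) (a * b * t) (a * b * s) => x2 x3 x7 x8; clear; lra.
Qed.

End ExponentialIntegral.

Section NonConcentration.
Variable R : realType.
Local Notation leb := (@lebesgue_measure R).

(** A cube contains the ball of radius rho, as the tail estimate requires, and its volume comes
    directly from the product measure. *)
Definition cubeset (rho : R) : set (vec R) := (`[- rho, rho] `*` `[- rho, rho]) `*` `[- rho, rho].

Lemma measurable_cubeset rho : measurable (cubeset rho).
Proof. by apply: measurableX; [apply: measurableX|]; exact: measurable_itv. Qed.

Lemma leb3_cubeset (rho : R) : 0 < rho ->
  (\int[leb3]_v (\1_(cubeset rho) v)%:E = (8 * rho ^+ 3)%:E)%E.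
Proof.
move=> r0; pose I := `[- rho, rho]%classic.
have mI : measurable (I : set (measurableTypeR R)) by exact: measurable_itv.
have lI : leb I = (2 * rho)%:E.
  rewrite /I lebesgue_measure_itv/= lte_fin ifT; last by lra.
  by rewrite -EFinD opprK; congr EFin; ring.
rewrite integral_indic//; last exact: measurable_cubeset.
have mII : measurable (I `*` I : set (measurableTypeR R * measurableTypeR R)) by exact: measurableX.
have E1 := @product_measure1E _ _ _ _ R (sf_prod leb leb) leb _ _ mII mI.
have E2 := @product_measure1E _ _ _ _ R leb leb _ _ mI mI.
rewrite setIT; apply: (eq_trans E1).
rewrite [X in (X * _)%E](E2 : sf_prod leb leb _ = _) [X in (_ * X)%E]lI [X in (X * X)%E]lI -!EFinM.
by congr EFin; ring.
Qed.

Lemma half_remainder (x y : R) : 1 <= x + y -> y <= 2^-1 -> 2^-1 <= x.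
Proof. lra. Qed.

Lemma half_of_double (x y z eps : R) : x * y <= 2 * (z + eps) -> x / 2 * y <= z + eps.
Proof. move=> H; have -> : x / 2 * y = x * y / 2 by ring. lra. Qed.

Lemma cubeset_compl (rho : R) (v : vec R) : 0 < rho -> ~ cubeset rho v -> rho ^+ 2 <= sqn v.
Proof.
move=> r0 nv; rewrite /sqn enorm_sqr /dot -!expr2.
have out x : ~ (x \in `[- rho, rho]) -> rho ^+ 2 <= x ^+ 2.
  rewrite in_itv/= -ler_norml => /negP; rewrite -ltNge => h.
  by rewrite -(real_normK (num_real x)) lerXn2r ?nnegrE// ltW.
have [s1 s2 s3] := And3 (sqr_ge0 v.1.1) (sqr_ge0 v.1.2) (sqr_ge0 v.2).
have [h1|h1] := pselect (v.1.1 \in `[- rho, rho]); last by have := out _ h1; lra.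
have [h2|h2] := pselect (v.1.2 \in `[- rho, rho]); last by have := out _ h2; lra.
have [h3|h3] := pselect (v.2 \in `[- rho, rho]); last by have := out _ h3; lra.
by exfalso; apply: nv.
Qed.

Variables (e : R) (g : R -> vec R -> R).
Hypotheses (e0 : 0 < e) (e1 : e < 1) (gP : kflow e g) (gN : normalized g).
Variable S0 : R.
Hypothesis S0P : forall N, 0 <= N -> Sent g N 0 <= S0.

Let ng := kf_nnm gP.
Let gi := kf_mom gP.
Let g0 t v : 0 <= g t v. Proof. exact: nnm_ge0 (ng t). Qed.

(** Chebyshev's inequality: outside the cube |v|^2 >= rho^2, so at most E/rho^2 <= 1/2 of the mass
    lies there. *)
Lemma half_mass (T rho : R) : 0 <= T -> 0 < rho -> 2 * En g T <= rho ^+ 2 ->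
  2^-1 <= fine (moment (g T) \1_(cubeset rho)).
Proof.
move=> T0 r0 Er; have mB : nnm (\1_(cubeset rho) : vec R -> R).
  by apply: nnm_indic; exact: measurable_cubeset.
have q0 : 0 <= (rho ^+ 2)^-1 by rewrite invr_ge0 sqr_ge0.
have mq : nnm (fun v => (rho ^+ 2)^-1 * @sqn R v) by exact: (nnmZ q0 (@nnm_sqn R)).
have m1 : nnm ((fun=> 1) : vec R -> R) by exact: nnm_cst.
have fB : moment (g T) \1_(cubeset rho) \is a fin_num.
  apply: (moment_fin (ng T) mB (gi T) (M := 1)) => v; rewrite mul1r.
  by apply: le_trans (weight2_ge1 v); rewrite indicE; case: (_ \in _).
have H : (moment (g T) (fun=> 1%R) <= moment (g T) \1_(cubeset rho) + ((rho ^+ 2)^-1)%:E * moment (g T) (@sqn R))%E.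
  rewrite -(momentZ q0 (ng T) (@nnm_sqn R)) -(momentD (ng T) mB mq).
  apply: le_moment; [exact: ng|exact: m1|exact: nnmD|move=> v].
  rewrite indicE; have [vB|vB] := pselect (cubeset rho v).
    by rewrite mem_set// lerDl mulr_ge0// (nnm_ge0 v (@nnm_sqn R)).
  by rewrite memNset// add0r mulrC ler_pdivlMr ?exprn_gt0// mul1r; exact: cubeset_compl.
rewrite (massE gP gN T0) -(fineK fB) -(fineK (En_fin gP T)) -EFinM -EFinD lee_fin -/(En g T) in H.
have h : (rho ^+ 2)^-1 * En g T <= 2^-1.
  by rewrite mulrC ler_pdivrMr ?exprn_gt0// ler_pdivlMl.
exact: half_remainder H h.
Qed.

(** The affine minorant N x - exp N + 1 of [beta N], integrated over the cube; elsewhere [beta N] is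
    nonnegative. *)
Lemma concentration_cost (T rho N : R) : 0 <= T -> 0 < rho -> 0 <= N ->
  N * fine (moment (g T) \1_(cubeset rho)) <= Sent g N T + (expR N - 1) * (8 * rho ^+ 3).
Proof.
move=> T0 r0 N0; have mB : nnm (\1_(cubeset rho) : vec R -> R).
  by apply: nnm_indic; exact: measurable_cubeset.
have fB : moment (g T) \1_(cubeset rho) \is a fin_num.
  apply: (moment_fin (ng T) mB (gi T) (M := 1)) => v; rewrite mul1r.
  by apply: le_trans (weight2_ge1 v); rewrite indicE; case: (_ \in _).
have c0 : 0 <= expR N - 1 by rewrite subr_ge0 -expR0 ler_expR.
have mb := nnm_beta gP N0 T.
rewrite -lee_fin EFinM (fineK fB) EFinD EFinM (fineK (Sent_fin gP N0 T)) -(leb3_cubeset r0).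
have mgB := nnmM (ng T) mB; have mcB := nnmZ c0 mB.
rewrite /moment -(nintZ leb3 N0 mgB) -(nintZ leb3 c0 mB) -(nintD leb3 mb mcB).
apply: nint_le; [exact: nnmZ N0 mgB|exact: nnmD mb mcB|move=> v].
rewrite indicE; case: (_ \in _).
  by rewrite !mulr1; have := beta_ge N0 (g0 T v) N0 (lexx N); rewrite mulrC; lra.
by rewrite !mulr0 addr0; exact: beta_ge0.
Qed.

(** With half of the mass in the cube of volume V, the cost gives N/2 <= S + 1 and N >= - ln V.
    Since S <= S0 + growth Y and V = 8 rho^3, solving for ln rho yields the exponents; the 3 in the
    denominators is the dimension. *)
Lemma radius_lower (T rho : R) : 0 <= T -> 0 < rho -> 2 * En g T <= rho ^+ 2 ->
  expR (- ((ln 8 + 2 * S0 + 2) / 3)) * expR (- (2 * growth e / 3 * Yint g T)) <= rho.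
Proof.
move=> T0 r0 Er; pose V := 8 * rho ^+ 3.
have V0 : 0 < V by rewrite mulr_gt0// exprn_gt0.
(* The truncation level at which exp N is comparable with 1/V, so that the correction (exp N - 1) V
   is at most 1. *)
pose N := Num.max 0 (- ln V).
have N0 : 0 <= N by rewrite le_max lexx.
have HM := half_mass T0 r0 Er; have HC := concentration_cost T0 r0 N0.
have HS := entropy_growth e0 e1 gP gN N0 T0; have HS0 := S0P N0.
have SG0 : 0 <= Sent g N T.
  by apply: fine_ge0; apply: nint_ge0 => v; exact: nnm_ge0 (nnm_beta gP N0 T).
rewrite -/V in HC.
have eV : (expR N - 1) * V <= 1.
  rewrite /N; have [h|h] := leP 0 (- ln V); last by rewrite expR0 subrr mul0r.
  by rewrite expRN lnK// mulrBl mulVf ?gt_eqF// mul1r lerBlDr lerDl ltW.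
have NB : - ln V <= N by rewrite le_max lexx orbT.
have lV : ln V = ln 8 + 3 * ln rho.
  by rewrite /V lnM ?posrE ?exprn_gt0// lnXn// mulr_natl.
rewrite -expRD -[leRHS]lnK// ler_expR.
rewrite {}lV in NB.
move: HM HC HS HS0 SG0 eV NB N0.
move: N (fine _) (Sent g N T) (Sent g N 0) (growth e) (Yint g T) ((expR N - 1) * V) (ln 8) (ln rho).
move=> n m s s0 G Y c l8 lr HM HC HS HS0 SG0 eV NB N0.
have h : n * 2^-1 <= n * m by rewrite ler_wpM2l.
have E : 3 * (- ((l8 + 2 * S0 + 2) / 3) - 2 * G / 3 * Y) = - (l8 + 2 * S0 + 2) - 2 * (G * Y) by field.
move: HS; move: (G * Y) E => GY E HS.
rewrite -(ler_pM2l (ltr0n _ 3)) E; lra.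
Qed.

Lemma rootE_lower (T : R) : 0 <= T ->
  expR (- ((ln 8 + 2 * S0 + 2) / 3)) / 2 * expR (- (2 * growth e / 3 * Yint g T)) <= rootE g T.
Proof.
(* The radius 2 (sqrt(E) + eps) is positive even if E = 0, and its square exceeds 2E; its factor 2
   is the 1/2 in the constant. *)
move=> T0; apply/ler_addgt0Pr => eps eps0.
have q0 := rootE_ge0 g T.
have r0 : 0 < 2 * (rootE g T + eps) by rewrite mulr_gt0// ltr_wpDl.
have Er : 2 * En g T <= (2 * (rootE g T + eps)) ^+ 2.
  rewrite -(rootE_sqr gP); move: (rootE g T) q0 => q q0.
  rewrite -subr_ge0 (_ : _ - _ = 2 * q ^+ 2 + 8 * (q * eps) + 4 * eps ^+ 2); last by ring.
  by rewrite !addr_ge0// !mulr_ge0// ?exprn_ge0// ltW.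
exact: half_of_double (radius_lower T0 r0 Er).
Qed.

Lemma Yint_lower : exists a b : R, [/\ 0 < a, 0 < b &
  forall t, 0 <= t -> b^-1 * ln (1 + a * b * t) <= Yint g t].
Proof.
exists (expR (- ((ln 8 + 2 * S0 + 2) / 3)) / 2), (2 * growth e / 3).
have a0 : 0 < expR (- ((ln 8 + 2 * S0 + 2) / 3)) / 2 by rewrite divr_gt0// expR_gt0.
have b0 : 0 < 2 * growth e / 3 by rewrite divr_gt0// mulr_gt0// growth_gt0.
split=> //; apply: (@log_lower_bound R (Yint g) (rootE g)) => //.
- exact: Yint0.
- move=> t t0; rewrite rootE_ge0; exact: (rootE_nonincreasing e0 e1 gP gN).
- by move=> s t s0 st; exact: (Yint_bounds e0 e1 gP gN).
- exact: rootE_lower.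
Qed.

End NonConcentration.


(** * Initial data *)

Section Extension.
Variables (R : realType) (e : R) (f0 : vec R -> R) (f : R -> vec R -> R).
Hypothesis fS : boltzmann_solution e f0 f.

(* Freezing the flow at negative times makes its continuity two-sided. *)
Definition extend (r : R) : vec R -> R := f (Num.max r 0).

Let M0 (r : R) : 0 <= Num.max r 0. Proof. by rewrite le_max lexx orbT. Qed.

Lemma extendE (r : R) : 0 <= r -> extend r = f r.
Proof. by move=> r0; rewrite /extend max_l. Qed.

Lemma nnm_extend r : nnm (extend r).
Proof.
split=> [|v]; first exact: (sol_measurable fS (M0 r)).
exact: (sol_ge0 fS _ (M0 r)).
Qed.

Lemma max0_within (r0 : R) :
  (fun r => Num.max r 0) @ r0 --> within `[0, +oo[ (nbhs (Num.max r0 0)).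
Proof.
have mc : (fun r => Num.max r 0) @ r0 --> Num.max r0 0.
  apply: (@continuous_max _ _ (fun r : R => r) (fun=> 0) r0); first exact: cvg_id.
  exact: cvg_cst.
move=> A hA; have := mc _ hA; rewrite /= !nbhs_simpl /=; apply: filterS => r; apply.
by rewrite /= in_itv/= andbT.
Qed.

Lemma kflow_extend : kflow e extend.
Proof.
split.
- exact: nnm_extend.
- by move=> r; exact: (sol_L12 fS (M0 r)).
- by move=> r0; exact: (cvg_comp _ _ (@max0_within r0) (sol_continuous fS (M0 r0))).
- move=> psi tp t t0; rewrite (extendE (ltW t0)).
  apply: (near_eq_is_derive _ (sol_eqn fS tp t0)).
  near=> s; rewrite extendE//; near: s.
  by near=> s; apply: ltW; near: s; exact: lt_nbhsr.
Unshelve. all: by end_near. Qed.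

Hypotheses (mf0 : measurable_fun setT f0) (f00 : forall v, 0 <= f0 v).

Lemma moment_extend0 (h : vec R -> R) : nnm h -> moment (extend 0) h = moment f0 h.
Proof.
move=> mh; have n0 := nnm_extend 0; have nf : nnm f0 by [].
apply: (ge0_ae_eq_integral measurableT).
- by apply/measurable_EFinP; exact: nnm_meas (nnmM n0 mh).
- by apply/measurable_EFinP; exact: nnm_meas (nnmM nf mh).
- by move=> v _; rewrite lee_fin; exact: nnm_ge0 (nnmM n0 mh).
- by move=> v _; rewrite lee_fin; exact: nnm_ge0 (nnmM nf mh).
- have [A [mA A0 sA]] := sol_init fS; exists A; split=> // v /= nE; apply: sA => E.
  by apply: nE => _; rewrite extendE// E.
Qed.

Hypotheses (mass1 : (\int[leb3]_v (f0 v)%:E = 1)%E)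
  (mom_x : \int[leb3]_v (f0 v * v.1.1) = 0)
  (mom_y : \int[leb3]_v (f0 v * v.1.2) = 0)
  (mom_z : \int[leb3]_v (f0 v * v.2) = 0).

Lemma mom2_init : (mom2 f0 < +oo)%E.
Proof.
have nf : nnm f0 by [].
rewrite -[mom2 f0]/(moment f0 (@weight2 R)) -(moment_extend0 (nnm_weight2 R)).
exact: kf_mom kflow_extend 0.
Qed.

(** The second moment makes the coordinates integrable, so the real integrals are linear, and the
    difference of the two moments is a combination of the three vanishing means. *)
Lemma momentum_init (u : vec R) : dot u u = 1 -> moment f0 (ppart u) = moment f0 (npart u).
Proof.
move=> u1; have nf : nnm f0 by [].
have fi := mom2_init; have nw := nnmM nf (nnm_weight2 R).
pose mv := (measurableTypeR R * measurableTypeR R * measurableTypeR R)%type.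
have coord (c : mv -> R) : measurable_fun setT c -> (forall v, `|c v| <= weight2 v) ->
    (@leb3 R).-integrable setT (fun v => (f0 v * c v)%:E).
  move=> mc cw; 
  have mfc : measurable_fun setT (fun v : mv => f0 v * c v) by exact: measurable_funM.
  apply: (@le_nnm_integrable _ _ _ leb3 (fun v => f0 v * c v) (fun v => f0 v * weight2 v) mfc nw _ fi) => v.
  by rewrite normrM (ger0_norm (f00 v)); apply: ler_wpM2l.
have bd (x : R) (v : vec R) : x ^+ 2 <= dot v v -> `|x| <= weight2 v.
  move=> xv; rewrite /weight2 enorm_sqr; apply: le_trans (lerD (lexx 1) xv).
  by have := sqr_ge0 (`|x| - 1); have := sqr_ge0 `|x|; rewrite -(real_normK (num_real x)); lra.
have i1 : (@leb3 R).-integrable setT (fun v => (f0 v * v.1.1)%:E).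
  apply: (coord (fun v => v.1.1)); first exact: measurableT_comp.
  by move=> v; apply: bd; rewrite /dot -!expr2 -addrA lerDl addr_ge0 ?sqr_ge0.
have i2 : (@leb3 R).-integrable setT (fun v => (f0 v * v.1.2)%:E).
  apply: (coord (fun v => v.1.2)); first exact: measurableT_comp.
  by move=> v; apply: bd; rewrite /dot -!expr2 addrAC lerDr addr_ge0 ?sqr_ge0.
have i3 : (@leb3 R).-integrable setT (fun v => (f0 v * v.2)%:E).
  apply: (coord (fun v => v.2)); first exact: measurable_snd.
  by move=> v; apply: bd; rewrite /dot -!expr2 lerDr addr_ge0 ?sqr_ge0.
have iP : (@leb3 R).-integrable setT (fun v => (f0 v * ppart u v)%:E).
  apply: (coord (ppart u) (nnm_meas (nnm_ppart u))) => v.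
  by rewrite ger0_norm ?(nnm_ge0 v (nnm_ppart u))//; exact: ppart_le_weight2.
have iN : (@leb3 R).-integrable setT (fun v => (f0 v * npart u v)%:E).
  apply: (coord (npart u) (nnm_meas (nnm_npart u))) => v.
  by rewrite ger0_norm ?(nnm_ge0 v (nnm_npart u))//; exact: npart_le_weight2.
have fP : moment f0 (ppart u) \is a fin_num.
  by apply: (moment_fin nf (nnm_ppart u) fi (M := 1)) => v; rewrite mul1r; exact: ppart_le_weight2.
have fN : moment f0 (npart u) \is a fin_num.
  by apply: (moment_fin nf (nnm_npart u) fi (M := 1)) => v; rewrite mul1r; exact: npart_le_weight2.
have E0 : \int[leb3]_v (u.1.1 * (f0 v * v.1.1) + u.1.2 * (f0 v * v.1.2) + u.2 * (f0 v * v.2)) = 0.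
  have k1 : (@leb3 R).-integrable setT (fun v => (u.1.1 * (f0 v * v.1.1))%:E).
    exact: (integrableZl measurableT u.1.1 i1).
  have k2 : (@leb3 R).-integrable setT (fun v => (u.1.2 * (f0 v * v.1.2))%:E).
    exact: (integrableZl measurableT u.1.2 i2).
  have k3 : (@leb3 R).-integrable setT (fun v => (u.2 * (f0 v * v.2))%:E).
    exact: (integrableZl measurableT u.2 i3).
  have k12 : (@leb3 R).-integrable setT (fun v => (u.1.1 * (f0 v * v.1.1) + u.1.2 * (f0 v * v.1.2))%:E).
    exact: (integrableD measurableT k1 k2).
  rewrite RintegralD// RintegralD//.
  by rewrite !RintegralZl// mom_x mom_y mom_z !mulr0 !addr0.
have E1 : \int[leb3]_v (f0 v * ppart u v) - \int[leb3]_v (f0 v * npart u v) = 0.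
  rewrite -RintegralB// -[RHS]E0; apply: eq_Rintegral => v _.
  by rewrite -mulrBr parts_sub /dot; ring.
by rewrite -(fineK fP) -(fineK fN); congr EFin; exact: subr0_eq E1.
Qed.

Lemma normalized_extend : normalized extend.
Proof.
split.
- rewrite moment_extend0; last exact: nnm_cst.
  by rewrite /moment; under eq_integral do rewrite mulr1.
- move=> u u1; rewrite !moment_extend0; [|exact: nnm_npart|exact: nnm_ppart].
  exact: momentum_init.
- move=> T T0; apply: le_lt_trans (sol_L13 fS T0); rewrite le_eqVlt; apply/orP; left.
  apply/eqP; apply: eq_integral => r; rewrite inE/= in_itv/= => /andP[r0 _].
  by rewrite /moment extendE.
Qed.

Lemma energy_extend (t : R) : 0 <= t -> energy f t = En extend t.
Proof. by move=> t0; rewrite /En /moment (extendE t0). Qed.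

End Extension.


(** * Finiteness of the initial entropy *)

Section GaussianTail.
Variable R : realType.
Local Notation leb := (@lebesgue_measure R).

Definition gauss3 (v : vec R) : R := gauss_fun v.1.1 * gauss_fun v.1.2 * gauss_fun v.2.

Let mg : nnm (gauss_fun : measurableTypeR R -> R).
Proof. by split; [exact: measurable_gauss_fun|exact: gauss_fun_ge0]. Qed.

Let mg2 : nnm (fun p : measurableTypeR R * measurableTypeR R => gauss_fun p.1 * gauss_fun p.2).
Proof.
apply: nnmM; first exact: (nnm_comp mg measurable_fst).
exact: (nnm_comp mg measurable_snd).
Qed.

Lemma nnm_gauss3 : nnm gauss3.
Proof.
apply: nnmM; first exact: (nnm_comp mg2 measurable_fst).
exact: (nnm_comp mg measurable_snd).
Qed.

Lemma gauss3E v : gauss3 v = expR (- enorm v ^+ 2).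
Proof. by rewrite /gauss3 /gauss_fun -!expRD enorm_sqr /dot; congr expR; ring. Qed.

Lemma gauss3_fin : (\int[leb3]_v (gauss3 v)%:E < +oo)%E.
Proof.
pose c := Num.sqrt (pi : R); have c0 : 0 <= c by exact: sqrtr_ge0.
have scale d (T : measurableType d) (mu : {measure set T -> \bar R}) (h : T -> R) : nnm h ->
    (\int[mu]_x (h x * c)%:E = c%:E * \int[mu]_x (h x)%:E)%E.
  by move=> mh; rewrite -nintZ//; apply: eq_integral => x _; rewrite mulrC.
have inner (k : R) : 0 <= k -> (\int[leb]_y (k * gauss_fun y)%:E = (k * c)%:E)%E.
  by move=> k0; rewrite nintZ// integralT_gauss -EFinM.
rewrite (sf_prod_tonelli1 (sf_prod leb leb) leb nnm_gauss3).
have E1 (p : R * R) : (\int[leb]_y (gauss3 (p, y))%:E = (gauss_fun p.1 * gauss_fun p.2 * c)%:E)%E.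
  exact: inner (mulr_ge0 (gauss_fun_ge0 p.1) (gauss_fun_ge0 p.2)).
under eq_integral => p _ do rewrite E1.
rewrite scale// (sf_prod_tonelli1 leb leb mg2).
have E2 (x : R) : (\int[leb]_y (gauss_fun x * gauss_fun y)%:E = (gauss_fun x * c)%:E)%E.
  exact: inner (gauss_fun_ge0 x).
under eq_integral => x _ do rewrite E2.
by rewrite scale// integralT_gauss -!EFinM ltry.
Qed.

(* Young's inequality for [x ln x], with [y <= exp y] at [y = - ln x - s]. *)
Lemma neg_entropy_le (x s : R) : 0 <= x -> 0 <= s -> x * Num.max (- ln x) 0 <= x * s + expR (- s).
Proof.
move=> x0 s0; have xs : 0 <= x * s + expR (- s) by rewrite addr_ge0 ?mulr_ge0 ?expR_ge0.
have [l0|l0] := leP (- ln x) 0; first by rewrite mulr0.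
have {}x0 : 0 < x by rewrite lt0r x0 andbT; apply/eqP => x00; move: l0; rewrite x00 ln0// oppr0 ltxx.
rewrite -lerBlDl -mulrBr.
have E : expR (- s) = x * expR (- ln x - s).
  by rewrite -[X in X * _](lnK x0) -expRD; congr expR; ring.
rewrite E; apply: ler_wpM2l; first exact: ltW.
by have := expR_ge1Dx (- ln x - s); lra.
Qed.

End GaussianTail.

Section InitialEntropy.
Variables (R : realType) (f0 : vec R -> R).
Hypotheses (mf0 : measurable_fun setT f0) (f00 : forall v, 0 <= f0 v).
Hypothesis energy_fin : (\int[leb3]_v (f0 v * enorm v ^+ 2)%:E < +oo)%E.

Let nf : nnm f0. Proof. by []. Qed.

Let mln : measurable_fun setT (fun v => ln (f0 v)).
Proof. exact: (measurableT_comp (@measurable_ln R) mf0). Qed.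

Let nnm_part (h : vec R -> R) : measurable_fun setT h -> nnm (fun v => f0 v * Num.max (h v) 0).
Proof.
move=> mh; apply: nnmM => //; split=> [|v]; last by rewrite le_max lexx orbT.
by apply: measurable_maxr => //; exact: measurable_cst.
Qed.

(** [neg_entropy_le] with s = |v|^2: the energy and a Gaussian integral control the part where f0 <
    1. *)
Lemma neg_entropy_fin : (\int[leb3]_v (f0 v * Num.max (- ln (f0 v)) 0)%:E < +oo)%E.
Proof.
have mN : nnm (fun v => f0 v * Num.max (- ln (f0 v)) 0).
  by apply: (nnm_part (h := fun v => - ln (f0 v))); exact: measurable_funN.
have mE := nnmM nf (@nnm_sqn R); have mG := nnm_gauss3 R.
apply: (@le_lt_trans _ _ (\int[leb3]_v (f0 v * sqn v + gauss3 v)%:E)%E).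
  apply: nint_le => //; first exact: nnmD.
  by move=> v; rewrite gauss3E; apply: neg_entropy_le; rewrite ?f00 ?sqr_ge0.
by rewrite nintD// lte_add_pinfty ?gauss3_fin.
Qed.

Hypothesis entropy_lt : (\int[leb3]_v (f0 v * ln (f0 v))%:E < +oo)%E.

(** If both parts of f0 ln f0 had infinite integral, the integral would be +oo - +oo, which
    evaluates to -oo and satisfies the hypothesis. Finiteness of the negative part rules this
    out. *)
Lemma pos_entropy_fin : (\int[leb3]_v (f0 v * Num.max (ln (f0 v)) 0)%:E < +oo)%E.
Proof.
have mP := nnm_part mln.
have P0 : (0 <= \int[leb3]_v (f0 v * Num.max (ln (f0 v)) 0)%:E)%E.
  by apply: nint_ge0 => v; exact: nnm_ge0 mP.
have := entropy_lt; rewrite integralE.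
have -> : (\int[leb3]_v ((fun v => (f0 v * ln (f0 v))%:E) ^\+ v) =
    \int[leb3]_v (f0 v * Num.max (ln (f0 v)) 0)%:E)%E.
  by apply: eq_integral => v _; rewrite funeposE -EFin_max maxr_pMr// mulr0.
have -> : (\int[leb3]_v ((fun v => (f0 v * ln (f0 v))%:E) ^\- v) =
    \int[leb3]_v (f0 v * Num.max (- ln (f0 v)) 0)%:E)%E.
  by apply: eq_integral => v _; rewrite funenegE -EFinN -EFin_max maxr_pMr// mulr0 mulrN.
move: P0 neg_entropy_fin.
case: (\int[leb3]_v (f0 v * Num.max (ln (f0 v)) 0)%:E)%E => [x||]//.
  by rewrite ltry.
case: (\int[leb3]_v _)%E => [y||]//.
Qed.

Variables (e : R) (f : R -> vec R -> R).
Hypothesis fS : boltzmann_solution e f0 f.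

(** [beta N y] <= y [eta N y] <= y max(ln y, 0), a bound uniform in N. *)
Lemma Sent_init (N : R) : 0 <= N ->
  Sent (extend f) N 0 <= fine (\int[leb3]_v (f0 v * Num.max (ln (f0 v)) 0)%:E).
Proof.
move=> N0; have gP := kflow_extend fS; have mb := nnm_beta gP N0 0.
have mP := nnm_part mln.
have fP : (\int[leb3]_v (f0 v * Num.max (ln (f0 v)) 0)%:E)%E \is a fin_num.
  by rewrite ge0_fin_numE ?pos_entropy_fin//; apply: nint_ge0 => v; exact: nnm_ge0 mP.
rewrite -lee_fin (fineK fP) (fineK (Sent_fin gP N0 0)).
have mbf : nnm (fun v => beta N (f0 v)).
  split=> [|v]; last exact: beta_ge0.
  by apply: measurableT_comp; [exact: measurable_beta|].
rewrite (_ : (\int[leb3]_v (beta N (extend f 0 v))%:E = \int[leb3]_v (beta N (f0 v))%:E)%E).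
  apply: nint_le => // v; apply: (le_trans (beta_le N0 _)).
  by apply: ler_wpM2l => //; rewrite /eta ge_min lexx.
apply: (ge0_ae_eq_integral measurableT).
- by apply/measurable_EFinP; exact: nnm_meas mb.
- by apply/measurable_EFinP; exact: nnm_meas mbf.
- by move=> v _; rewrite lee_fin; exact: nnm_ge0 mb.
- by move=> v _; rewrite lee_fin; exact: nnm_ge0 mbf.
- have [A [mA A0 sA]] := sol_init fS; exists A; split=> // v /= nE; apply: sA => E.
  by apply: nE => _; rewrite extendE// E.
Qed.

End InitialEntropy.


(** * Decay rate *)

Section DecayRate.
Variable R : realType.

(* On the scales [1 + t = 2^n c] the increments of [Y] are bounded by a geometric series. *)
Lemma no_fast_decay (Y q : R -> R) (a b lam K T0 : R) : 0 < a -> 0 < b -> 1 < lam -> 0 <= T0 ->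
  (forall t, 0 <= t -> 0 <= q t) ->
  (forall s t, 0 <= s -> s < t -> Y t <= Y s + q s * (t - s)) ->
  (forall t, 0 <= t -> b^-1 * ln (1 + a * b * t) <= Y t) ->
  ~ (forall t, T0 <= t -> (1 + t) `^ (2 * lam) * q t ^+ 2 <= K).
Proof.
move=> a0 b0 lam1 T00 q0 HY HL HK.
pose c := 1 + T0; have c1 : 1 <= c by rewrite lerDl.
pose x n : R := 2 ^+ n * c; pose r : R := 2 `^ (1 - lam).
have xc n : c <= x n by rewrite -[leLHS]mul1r ler_wpM2r ?(le_trans ler01)// exprn_ege1// ler1n.
have x0 n : 0 < x n by apply: lt_le_trans (xc n); apply: lt_le_trans c1.
have xS n : x n.+1 = 2 * x n by rewrite /x exprS mulrA.
have r1 : r < 1.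
  rewrite /r -opprB powRN invf_lt1 ?powR_gt0//.
  have {1}<- : 1 `^ (lam - 1) = 1 by rewrite powR1.
  by apply: gt0_ltr_powR; rewrite ?nnegrE ?subr_gt0// ltr1n.
pose p n := x n `^ (1 - lam); have pS n : p n.+1 = r * p n by rewrite /p xS powRM// ltW.
(* G is the sum of the geometric series with first term K' and ratio r; K' + G r = G makes Y + G p
   nonincreasing along the dyadic times. *)
pose K' := K + 1; pose G := K' / (1 - r).
have rn : 1 - r != 0 by rewrite gt_eqF ?subr_gt0.
have GE : K' + G * r = G by rewrite /G; move: (r) (K') rn => y z h; field.
have step n : q (x n - 1) * x n <= K' * p n.
  have t0 : T0 <= x n - 1 by have := xc n; rewrite /c; lra.
  have := HK _ t0; have Q := q0 _ (le_trans T00 t0); rewrite addrC subrK.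
  rewrite [2 * lam]mulrC powRrM powR_mulrn ?powR_ge0// -exprMn => h.
  have pE : x n = x n `^ lam * p n.
    have xn0 : x n != 0 by rewrite gt_eqF.
    by rewrite /p -powRD ?xn0 ?implybT// [lam + _]addrC subrK powRr1// ltW.
  rewrite [X in q _ * X]pE mulrA; apply: ler_wpM2r; first exact: powR_ge0.
  (* y^2 <= K implies y <= K + 1, which avoids a square root of K. *)
  rewrite mulrC; move: h; set y := _ * _ => h; rewrite /K'.
  by have := sqr_ge0 (y - 1); have := sqr_ge0 y; lra.
have bound n : Y (x n - 1) + G * p n <= Y (x 0 - 1) + G * p 0.
  elim: n => [//|n IH]; apply: le_trans IH.
  have s0 : 0 <= x n - 1 by rewrite subr_ge0 (le_trans c1).
  have st : x n - 1 < x n.+1 - 1 by rewrite xS; have := x0 n; lra.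
  have := HY _ _ s0 st; have := step n; rewrite pS.
  have -> : x n.+1 - 1 - (x n - 1) = x n by rewrite xS; ring.
  have -> : G * (r * p n) = (G * r) * p n by ring.
  have E : G * p n = K' * p n + G * r * p n by rewrite -{1}GE; ring.
  by rewrite E; lra.
have K0 : 0 <= K'.
  have := HK T0 (lexx T0); have := mulr_ge0 (powR_ge0 (1 + T0) (2 * lam)) (sqr_ge0 (q T0)).
  by rewrite /K'; lra.
have G0 : 0 <= G by rewrite divr_ge0// subr_ge0 ltW.
pose B := Y (x 0 - 1) + G * p 0.
(* Since 2^k - 1 >= k, the dyadic time number k is late enough for the logarithm to exceed the bound
   B. *)
pose k := Num.bound `|(expR (b * B) - 1) / (a * b)|.
have s0 : 0 <= x k - 1 by rewrite subr_ge0 (le_trans c1).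
have ab0 := mulr_gt0 a0 b0.
have L1 : 1 + a * b * (x k - 1) <= expR (b * B).
  have pos : 0 < 1 + a * b * (x k - 1) by rewrite ltr_wpDr// mulr_ge0// ltW.
  rewrite -[leLHS](lnK pos) ler_expR -(ler_pM2l (_ : 0 < b^-1)) ?invr_gt0//.
  rewrite mulrA mulVf ?gt_eqF// mul1r; apply: le_trans (HL _ s0) _.
  by apply: le_trans (bound k); rewrite lerDl mulr_ge0// powR_ge0.
have L2 : (expR (b * B) - 1) / (a * b) < k%:R.
  by apply: le_lt_trans (ler_norm _) (archi_boundP (normr_ge0 _)).
have L3 : k%:R <= x k - 1 :> R.
  apply: (@le_trans _ _ (2 ^+ k - 1)).
    by rewrite lerBrDr natr1 -natrX ler_nat ltn_expl.
  by rewrite lerB// ler_peMr// exprn_ge0.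
have := lt_le_trans L2 L3; rewrite ltr_pdivrMr// [_ * (a * b)]mulrC.
by move: L1; move: (x k - 1) (expR _) => y z; lra.
Qed.

Variable E : R -> R.
Hypothesis E0 : forall t, 0 <= t -> 0 <= E t.
Hypothesis haff : exists2 C, 0 <= C & forall t, 0 <= t -> (1 + t) ^+ 2 * E t <= C.
Hypothesis slow : forall lam K T0, 1 < lam -> 0 <= T0 ->
  ~ (forall t, T0 <= t -> (1 + t) `^ (2 * lam) * E t <= K).

Let F lam (t : R) := ((1 + t) `^ (2 * lam) * E t)%:E.

Lemma sup_bounded_rates :
  sup [set lam | 0 <= lam /\ (ereal_sup [set F lam t | t in `[0%R, +oo[] < +oo)%E] = 1.
Proof.
set S := [set lam | _].
have S1 : S 1.
  split=> //; have [C C0 HC] := haff; apply: le_lt_trans (ltry C).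
  apply: ge_ereal_sup => _ [t /= ht <-]; have t0 : 0 <= t by move: ht; rewrite in_itv/= andbT.
  by rewrite lee_fin mulr1 powR_mulrn ?HC// addr_ge0.
have Sle : ubound S 1.
  move=> lam [lam0 h]; rewrite leNgt; apply/negP => lam1.
  have ub t : 0 <= t -> (F lam t <= ereal_sup [set F lam t | t in `[0%R, +oo[])%E.
    by move=> t0; apply: ereal_sup_ubound; exists t => //=; rewrite in_itv/= t0.
  move: h ub; case: (ereal_sup _) => [K _ ub|//|_ ub].
    by apply: (slow lam1 (lexx 0) (K := K)) => t t0; rewrite -lee_fin; exact: ub.
  by have := ub 0 (lexx 0).
apply/le_anti/andP; split; first by apply: ge_sup => //; exists 1.
by apply: ub_le_sup => //; exists 1.
Qed.

(** Otherwise the weighted energy is below 1 from some time on; this is why [slow] excludes bounds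
    that start at an arbitrary T0. *)
Lemma limsup_gt0 lam : 1 < lam -> (0 < limf_esup (F lam) +oo%R)%E.
Proof.
move=> lam1; rewrite ltNge; apply/negP => h.
have := le_lt_trans h (@lte01 R); rewrite limf_esupE => /ereal_inf_lt[_ [V [M [_ VM]] <-] hV].
pose T0 := Num.max 0 (M + 1).
apply: (slow lam1 (_ : 0 <= T0) (K := 1)); first by rewrite le_max lexx.
move=> t tT; have Vt : V t.
  by apply: VM; apply: lt_le_trans tT; rewrite lt_max ltrDl ltr01 orbT.
rewrite -lee_fin; apply: (le_trans _ (ltW hV)).
by apply: ereal_sup_ubound; exists t.
Qed.

(** The weighted energy times (1 + t)^(2 - 2 lam) is bounded by Haff's estimate, and this power
    tends to infinity. *)
Lemma limsup_le0 lam : 0 < lam -> lam < 1 -> (limf_esup (F lam) +oo%R <= 0)%E.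
Proof.
move=> lam0 lam1; have [C C0 HC] := haff.
apply/lee_addgt0Pr => eps eps0; rewrite add0e.
pose k := 2 - 2 * lam; have k0 : 0 < k by rewrite /k; lra.
(* Once (1 + t)^k >= D, the weighted energy is at most C / D <= eps; the summand 1 keeps D positive
   when C = 0. *)
pose D := C / eps + 1; have D0 : 0 < D by rewrite ltr_wpDl// divr_ge0// ltW.
pose M := Num.max 0 (D `^ k^-1).
rewrite limf_esupE; apply: (@le_trans _ _ (ereal_sup (F lam @` `]M, +oo[))).
  apply: ereal_inf_lbound; exists `]M, +oo[%classic => //.
  by exists M; split=> [|x]; [exact: num_real|rewrite /= in_itv/= andbT].
apply: ge_ereal_sup => _ [t /= ht <-]; move: ht; rewrite in_itv/= andbT gt_max => /andP[t0 tM].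
rewrite lee_fin; set x := 1 + t.
have x0 : 0 < x by rewrite ltr_pwDl// ltW.
have xD : D <= x `^ k.
  rewrite -[leLHS](powRr1 (ltW D0)) -(mulVf (lt0r_neq0 k0)) powRrM.
  apply: ge0_ler_powR; rewrite ?nnegrE ?powR_ge0 ?(ltW k0) ?(ltW x0)//.
  by rewrite /x; move: tM; move: (D `^ _) => y; lra.
have xk : x `^ (2 * lam) * x `^ k = x ^+ 2.
  have xn0 : x != 0 by rewrite gt_eqF.
  rewrite -(powR_mulrn 2 (ltW x0)) -powRD ?xn0 ?implybT//; congr (_ `^ _).
  by rewrite /k; ring.
have hC := HC t (ltW t0); rewrite -/x -xk in hC.
have y0 : 0 <= x `^ (2 * lam) * E t by rewrite mulr_ge0 ?powR_ge0 ?E0 ?ltW.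
have h1 : x `^ (2 * lam) * E t * D <= C.
  apply: le_trans hC; rewrite [leRHS]mulrAC; exact: ler_wpM2l.
have DE : eps * D = C + eps by rewrite /D; field; rewrite gt_eqF.
rewrite -(ler_pM2r D0) DE; apply: (le_trans h1); rewrite lerDl ltW//.
Qed.

(** Every lam > 1 belongs to the set and none below 1 does; the infimum is approached by 1 + eps,
    and membership of 1 itself is left open. *)
Lemma inf_nonvanishing_rates :
  inf [set lam | 0 < lam /\ (0 < limf_esup (F lam) +oo%R)%E] = 1.
Proof.
set S := [set lam | _].
have Slt lam : 1 < lam -> S lam.
  by move=> lam1; split; [exact: lt_trans ltr01 lam1|exact: limsup_gt0].
have Sge : lbound S 1.
  move=> lam [lam0 h]; rewrite leNgt; apply/negP => lam1.
  by have := lt_le_trans h (limsup_le0 lam0 lam1); rewrite ltxx.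
apply/le_anti/andP; split; last by apply: lb_le_inf => //; exists 2; apply: Slt; rewrite ltr1n.
apply/ler_addgt0Pr => eps eps0; apply: ge_inf; first by exists 1.
by apply: Slt; rewrite ltrDl.
Qed.

End DecayRate.

Theorem theorem3p10 (R : realType) (e : R) (f0 : vec R -> R)
  (f : R -> vec R -> R) :
  0 < e -> e < 1 ->
  measurable_fun setT f0 ->
  (forall v, 0 <= f0 v) ->
  (\int[leb3]_v (f0 v)%:E = 1)%E ->
  \int[leb3]_v (f0 v * v.1.1) = 0 ->
  \int[leb3]_v (f0 v * v.1.2) = 0 ->
  \int[leb3]_v (f0 v * v.2) = 0 ->
  (\int[leb3]_v (f0 v * enorm v ^+ 2)%:E < +oo)%E ->
  (\int[leb3]_v (f0 v * ln (f0 v))%:E < +oo)%E ->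
  boltzmann_solution e f0 f ->
  (exists a b : R, 0 < a /\ 0 < b /\
     forall t : R, 0 <= t ->
       \int[lebesgue_measure]_(s in `[0, t]) Num.sqrt (energy f s)
         >= b^-1 * ln (1 + a * b * t)) /\
  sup [set lam : R | 0 <= lam /\
         (ereal_sup [set ((1 + t) `^ (2 * lam) * energy f t)%:E
                       | t in `[0%R, +oo[] < +oo)%E]
  = inf [set lam : R | 0 < lam /\
           (0 < limf_esup (fun t : R =>
                  ((1 + t) `^ (2 * lam) * energy f t)%:E) +oo%R)%E] /\
  inf [set lam : R | 0 < lam /\
         (0 < limf_esup (fun t : R =>
                ((1 + t) `^ (2 * lam) * energy f t)%:E) +oo%R)%E] = 1.
Proof.
move=> e0 e1 mf0 f00 mass1 momx momy momz energy_fin entropy_lt fS.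
have gP := kflow_extend fS.
have gN := normalized_extend fS mf0 f00 mass1 momx momy momz.
have [a [b [a0 b0 HY]]] := Yint_lower e0 e1 gP gN
  (fun N N0 => Sent_init mf0 f00 energy_fin entropy_lt fS N0).
have EE (t : R) : 0 <= t -> energy f t = En (extend f) t := energy_extend f (t := t).
split.
  exists a, b; split; first exact: a0.
  split=> [|t t0]; first exact: b0.
  apply: (le_trans (HY t t0)).
  rewrite le_eqVlt; apply/orP; left; apply/eqP; apply: eq_Rintegral => s.
  rewrite inE/= in_itv/= => /andP[s0 _]; rewrite /rootE (EE s s0); exact: erefl.
have E0 (t : R) : 0 <= t -> 0 <= energy f t.
  by move=> t0; rewrite (EE t t0); exact: En_ge0 gP t.
have haff : exists2 C, 0 <= C & forall t, 0 <= t -> (1 + t) ^+ 2 * energy f t <= C.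
  have [C C0 HC] := En_upper e0 e1 gP gN; exists C => [|t t0]; first exact: C0.
  rewrite (EE t t0); exact: HC.
have slow (lam K T0 : R) : 1 < lam -> 0 <= T0 ->
    ~ (forall t, T0 <= t -> (1 + t) `^ (2 * lam) * energy f t <= K).
  move=> lam1 T00 HK; apply: (no_fast_decay a0 b0 lam1 T00 (q := rootE (extend f))) HY _.
  - by move=> t _; exact: rootE_ge0.
  - by move=> s t s0 st; have /andP[] := Yint_bounds e0 e1 gP gN s0 st.
  - move=> t tT; rewrite (rootE_sqr gP) -EE; first exact: HK.
    exact: le_trans T00 tT.
by rewrite (sup_bounded_rates haff slow) (inf_nonvanishing_rates E0 haff slow).
Qed.
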